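(* Let $A$ be a finite dimensional Hopf algebra over an algebraically closed field $k$. Assume (fg): $\mathrm{H}^{\mathrm{ev}}(A,k)$ is finitely generated and, for any two finite dimensional $A$-modules $M$ and $N$, the $\mathrm{H}^{\mathrm{ev}}(A,k)$-module $\mathrm{Ext}^{\bullet}_A(M,N)$ is finitely generated. Let $B_0$ be the principal block of $A$ and let $H^{\bullet}:=\mathrm{HH}^0(B_0)\cdot\mathrm{H}^{\mathrm{ev}}(A,k)$ be the subalgebra of $\mathrm{HH}^{\bullet}(B_0)$ generated by $\mathrm{HH}^0(B_0)$ and the image of $\mathrm{H}^{\mathrm{ev}}(A,k)$ in $\mathrm{HH}^{\bullet}(B_0)$. Then for every finite dimensional $B_0$-module $M$ the support varieties $\mathcal{V}_H(M)$ and $\mathcal{V}_A(M)$ are isomorphic.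
   Context: Modules are left modules. $\mathrm{H}^{\bullet}(A,k)=\mathrm{Ext}_A^{\bullet}(k,k)$, with $k$ the trivial module (via the counit); $\mathrm{H}^{\mathrm{ev}}(A,k)=\bigoplus_{n\ge0}\mathrm{H}^n(A,k)$ if $\mathrm{char}\,k=2$ and $\bigoplus_{n\ge0}\mathrm{H}^{2n}(A,k)$ if $\mathrm{char}\,k\ne2$; it is commutative. It acts on $\mathrm{Ext}^{\bullet}_A(M,N)$ via $-\otimes_kM:\mathrm{H}^{\bullet}(A,k)\to\mathrm{Ext}^{\bullet}_A(M,M)$ (or the analogous map for $N$) followed by Yoneda composition. The principal block $B_0$ is the unique indecomposable ideal direct summand of $A$ whose unity element acts as the identity on $k$. For an algebra $C$, $\mathrm{HH}^{\bullet}(C)=\mathrm{Ext}^{\bullet}_{C^e}(C,C)$ with $C^e=C\otimes C^{\mathrm{op}}$, and $\mathrm{HH}^{\bullet}(C)$ acts on $\mathrm{Ext}^{\bullet}_C(M,N)$ via the ring homomorphism $\eta\mapsto\eta\otimes_CM$ into $\mathrm{Ext}^{\bullet}_C(M,M)$ followed by Yoneda composition. Embedding: the map $\delta:A\to A^e$, $\delta(a)=\sum a_1\otimes S(a_2)$ ($S$ the antipode), is an injective algebra homomorphism with $A^e\otimes_{\delta(A)}k\cong A$, and the induction functor $A^e\otimes_{\delta(A)}-$ yields an injective homomorphism of graded algebras $\mathrm{H}^{\bullet}(A,k)\to\mathrm{HH}^{\bullet}(A)$. Composing with the projection of $\mathrm{HH}^{\bullet}(A)$ onto its direct factor $\mathrm{HH}^{\bullet}(B_0)$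 gives an embedding $\mathrm{H}^{\bullet}(A,k)\to\mathrm{HH}^{\bullet}(B_0)$. Varieties: $\mathcal{V}_A(M)$ is the maximal ideal spectrum of $\mathrm{H}^{\mathrm{ev}}(A,k)/I_A(M)$, where $I_A(M)$ is the annihilator of the action of $\mathrm{H}^{\mathrm{ev}}(A,k)$ on $\mathrm{Ext}_A^{\bullet}(M,M)$. Let $\mathcal{N}_H$ be the ideal of $H^{\bullet}$ generated by the homogeneous nilpotent elements and the Jacobson radical of $H^0$, and $\overline{H^{\bullet}}=H^{\bullet}/\mathcal{N}_H$. $\mathcal{V}_H(M)$ is the closed subvariety of the maximal ideal spectrum of $\overline{H^{\bullet}}$ consisting of those maximal ideals whose inverse image in $H^{\bullet}$ contains the annihilator of the action of $H^{\bullet}$ on $\mathrm{Ext}^{\bullet}_{B_0}(M,M)=\mathrm{Ext}^{\bullet}_A(M,M)$. Isomorphism means isomorphism of affine varieties (reduced coordinate rings). *)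

(* Defs.v *)
From HB Require Import structures.
From mathcomp Require Import all_boot all_algebra falgebra.
From mathcomp Require Import boolp classical_sets.

Set Implicit Arguments.
Unset Strict Implicit.
Unset Printing Implicit Defensive.

Import GRing.Theory.
Local Open Scope ring_scope.
Local Open Scope quotient_scope.

(* Every element of X (x)_R Y is a finite sum of pure tensors; two formal
   sums are identified when every R-balanced biadditive map into an abelian
   group takes the same value on them.  The right action ra of R on X and
   the left action la of R on Y are arbitrary functions. *)
Section Tensor.
Variables (R : Type) (X Y : zmodType) (ra : X -> R -> X) (la : R -> Y -> Y).

Definition balanced (Z : zmodType) (b : X -> Y -> Z) : Prop :=
  [/\ forall x x' y, b (x + x') y = b x y + b x' y,
      forall x y y', b x (y + y') = b x y + b x y' &
      forall x r y, b (ra x r) y = b x (la r y)].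

Definition tsum (Z : zmodType) (b : X -> Y -> Z) (s : seq (X * Y)) : Z :=
  \sum_(p <- s) b p.1 p.2.

Definition teq (s t : seq (X * Y)) : bool :=
  `[< forall (Z : zmodType) (b : X -> Y -> Z),
        balanced b -> tsum b s = tsum b t >].

Lemma teq_refl : reflexive teq. Proof. by move=> s; apply/asboolP. Qed.
Lemma teq_sym : symmetric teq.
Proof.
by move=> s t; apply/asboolP/asboolP => E Z b /E ->.
Qed.
Lemma teq_trans : transitive teq.
Proof.
move=> t s u /asboolP E1 /asboolP E2; apply/asboolP => Z b B.
by rewrite (E1 _ _ B) (E2 _ _ B).
Qed.
Canonical teq_equiv := EquivRel teq teq_refl teq_sym teq_trans.

Definition tensor : Type := {eq_quot teq}.
HB.instance Definition _ := Choice.on tensor.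

Definition tpi (s : seq (X * Y)) : tensor := \pi_({eq_quot teq}) s.
Definition trepr (t : tensor) : seq (X * Y) := repr (t : {eq_quot teq}).

Lemma treprK t : tpi (trepr t) = t. Proof. exact: reprK. Qed.

Lemma tpiP s t :
  (forall (Z : zmodType) (b : X -> Y -> Z), balanced b -> tsum b s = tsum b t) ->
  tpi s = tpi t.
Proof. by move=> E; apply/eqmodP/asboolP. Qed.

(* The additive map X (x)_R Y -> Z with x (x) y |-> b x y, when b is balanced. *)
Definition tlift (Z : zmodType) (b : X -> Y -> Z) (t : tensor) : Z :=
  tsum b (trepr t).

Lemma tlift_pi (Z : zmodType) (b : X -> Y -> Z) s :
  balanced b -> tlift b (tpi s) = tsum b s.
Proof.
by move=> B; have /eqmodP/asboolP/(_ Z b B) := treprK (tpi s).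
Qed.

Lemma tsum_cat (Z : zmodType) (b : X -> Y -> Z) s t :
  tsum b (s ++ t) = tsum b s + tsum b t.
Proof. by rewrite /tsum big_cat. Qed.

Lemma balanced0l (Z : zmodType) (b : X -> Y -> Z) y : balanced b -> b 0 y = 0.
Proof. by case=> D _ _; apply: (addrI (b 0 y)); rewrite -D !addr0. Qed.

Lemma balancedNl (Z : zmodType) (b : X -> Y -> Z) x y :
  balanced b -> b (- x) y = - b x y.
Proof.
move=> B; have [D _ _] := B.
by apply: (addrI (b x y)); rewrite -D !subrr balanced0l.
Qed.

Definition tadd s t := tpi (trepr s ++ trepr t).
Definition topp t := tpi [seq (- p.1, p.2) | p <- trepr t].

Lemma tlift_add (Z : zmodType) (b : X -> Y -> Z) s t :
  balanced b -> tlift b (tadd s t) = tlift b s + tlift b t.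
Proof. by move=> B; rewrite tlift_pi // tsum_cat. Qed.

Lemma tlift_opp (Z : zmodType) (b : X -> Y -> Z) t :
  balanced b -> tlift b (topp t) = - tlift b t.
Proof.
move=> B; rewrite tlift_pi // /tlift /tsum big_map -sumrN.
by apply: eq_bigr => p _; exact: balancedNl.
Qed.

Lemma tens_eq s t :
  (forall (Z : zmodType) (b : X -> Y -> Z), balanced b -> tlift b s = tlift b t) ->
  s = t.
Proof. by move=> E; rewrite -(treprK s) -(treprK t); apply: tpiP => Z b /E. Qed.

Lemma taddA : associative tadd.
Proof. by move=> s t u; apply: tens_eq => Z b B; rewrite !tlift_add // addrA. Qed.
Lemma taddC : commutative tadd.
Proof. by move=> s t; apply: tens_eq => Z b B; rewrite !tlift_add // addrC. Qed.
Lemma tadd0 : left_id (tpi [::]) tadd.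
Proof.
move=> t; apply: tens_eq => Z b B.
by rewrite tlift_add // tlift_pi // /tsum big_nil add0r.
Qed.
Lemma taddN : left_inverse (tpi [::]) topp tadd.
Proof.
move=> t; apply: tens_eq => Z b B.
by rewrite tlift_add // tlift_opp // tlift_pi // /tsum big_nil addNr.
Qed.
HB.instance Definition _ := GRing.isZmodule.Build tensor taddA taddC tadd0 taddN.

Definition pure (x : X) (y : Y) : tensor := tpi [:: (x, y)].

Lemma tlift_pure (Z : zmodType) (b : X -> Y -> Z) x y :
  balanced b -> tlift b (pure x y) = b x y.
Proof. by move=> B; rewrite tlift_pi // /tsum big_seq1. Qed.

Lemma tliftD (Z : zmodType) (b : X -> Y -> Z) s t :
  balanced b -> tlift b (s + t) = tlift b s + tlift b t.
Proof. exact: tlift_add. Qed.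

Lemma tlift0 (Z : zmodType) (b : X -> Y -> Z) : balanced b -> tlift b 0 = 0.
Proof. by move=> B; rewrite tlift_pi // /tsum big_nil. Qed.

Lemma balanced_pure : balanced pure.
Proof.
split=> *; apply: tens_eq => Z b B; rewrite ?tliftD // !tlift_pure //;
by case: B.
Qed.

Lemma tens_sum t : t = \sum_(p <- trepr t) pure p.1 p.2.
Proof.
apply: tens_eq => Z b B; rewrite {1}/tlift /tsum.
rewrite (big_morph (tlift b) (fun s t => tliftD s t B) (tlift0 B)).
by apply: eq_bigr => p _; rewrite tlift_pure.
Qed.

Lemma tens_ext (Z : zmodType) (f g : tensor -> Z) :
  {morph f : x y / x + y} -> {morph g : x y / x + y} ->
  (forall x y, f (pure x y) = g (pure x y)) -> f =1 g.
Proof.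
have E0 (h : tensor -> Z) : {morph h : x y / x + y} -> h 0 = 0.
  by move=> D; apply: (addrI (h 0)); rewrite -D !addr0.
move=> Df Dg E t; rewrite (tens_sum t).
rewrite (big_morph f Df (E0 f Df)) (big_morph g Dg (E0 g Dg)).
by apply: eq_bigr.
Qed.

Lemma tlift_morph (Z Z' : zmodType) (b : X -> Y -> Z) (g : Z -> Z') t :
  {morph g : x y / x + y} -> g (tlift b t) = tlift (fun x y => g (b x y)) t.
Proof.
move=> D; have g0 : g 0 = 0 by apply: (addrI (g 0)); rewrite -D !addr0.
by rewrite /tlift /tsum (big_morph g D g0).
Qed.

Lemma tlift_fD (Z : zmodType) (b b' : X -> Y -> Z) t :
  tlift (fun x y => b x y + b' x y) t = tlift b t + tlift b' t.
Proof. by rewrite /tlift /tsum big_split. Qed.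

Lemma eq_tlift (Z : zmodType) (b b' : X -> Y -> Z) t :
  (forall x y, b x y = b' x y) -> tlift b t = tlift b' t.
Proof. by move=> E; apply: eq_bigr. Qed.

End Tensor.

Lemma pureDl R X Y ra la x x' y :
  @pure R X Y ra la (x + x') y = pure ra la x y + pure ra la x' y.
Proof. by have [-> _ _] := balanced_pure ra la. Qed.
Lemma pureDr R X Y ra la x y y' :
  @pure R X Y ra la x (y + y') = pure ra la x y + pure ra la x y'.
Proof. by have [_ -> _] := balanced_pure ra la. Qed.
Lemma pureM R X Y ra la x r y :
  @pure R X Y ra la (ra x r) y = pure ra la x (la r y).
Proof. by have [_ _ ->] := balanced_pure ra la. Qed.

Section ConverseAlgebra.
Variables (k : fieldType) (A : algType k).

HB.instance Definition _ := GRing.Zmodule_isLmodule.Build k A^c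
  (@scalerA k A) (@scale1r k A) (@scalerDr k A) (fun v a b => @scalerDl k A v a b).
Fact converse_scalerAl (c : k) (u v : A^c) : c *: (u * v) = (c *: u) * v.
Proof. exact: (@scalerAr k A c v u). Qed.
HB.instance Definition _ := GRing.Lmodule_isLalgebra.Build k A^c converse_scalerAl.
Fact converse_scalerAr (c : k) (u v : A^c) : c *: (u * v) = u * (c *: v).
Proof. exact: (@scalerAl k A c v u). Qed.
HB.instance Definition _ := GRing.Lalgebra_isAlgebra.Build k A^c converse_scalerAr.
End ConverseAlgebra.

Section VectorTensor.
Variables (k : fieldType) (V W : lmodType k).
Definition scl_r (x : V) (c : k) : V := c *: x.
Definition scl_l (c : k) (y : W) : W := c *: y.
Definition vtens : Type := tensor scl_r scl_l.
HB.instance Definition _ := GRing.Zmodule.on vtens.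
Definition vpure (x : V) (y : W) : vtens := pure scl_r scl_l x y.
End VectorTensor.

Section AlgebraTensor.
Variables (k : fieldType) (A : falgType k) (B : algType k).

Definition atens : Type := vtens A B.
HB.instance Definition _ := GRing.Zmodule.on atens.
Definition apure (a : A) (b : B) : atens := vpure a b.

Lemma apureDl a a' b : apure (a + a') b = apure a b + apure a' b.
Proof. exact: pureDl. Qed.
Lemma apureDr a b b' : apure a (b + b') = apure a b + apure a b'.
Proof. exact: pureDr. Qed.
Lemma apureZ c a b : apure (c *: a) b = apure a (c *: b).
Proof. exact: (pureM (@scl_r k A) (@scl_l k B)). Qed.

Definition amul (s t : atens) : atens :=
  tlift (fun a b => tlift (fun a' b' => apure (a * a') (b * b')) t) s.
Definition ascale (c : k) (t : atens) : atens :=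
  tlift (fun a b => apure (c *: a) b) t.

Lemma amul_bal_in a b : 
  balanced (@scl_r k A) (@scl_l k B) (fun a' b' => apure (a * a') (b * b')).
Proof.
split=> [x x' y|x y y'|x c y]; rewrite ?mulrDr ?apureDl ?apureDr //.
by rewrite /scl_r /scl_l -!scalerAr apureZ.
Qed.
Lemma amul_bal (t : atens) : balanced (@scl_r k A) (@scl_l k B)
  (fun a b => tlift (fun a' b' => apure (a * a') (b * b')) t).
Proof.
split=> [x x' y|x y y'|x c y].
- by rewrite -tlift_fD; apply: eq_tlift => a b; rewrite mulrDl apureDl.
- by rewrite -tlift_fD; apply: eq_tlift => a b; rewrite mulrDl apureDr.
- by apply: eq_tlift => a b; rewrite /scl_r /scl_l -!scalerAl apureZ.
Qed.
Lemma ascale_bal c : 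
  balanced (@scl_r k A) (@scl_l k B) (fun a b => apure (c *: a) b).
Proof.
split=> [x x' y|x y y'|x d y]; rewrite ?scalerDr ?apureDl ?apureDr //.
by rewrite /scl_r /scl_l scalerA mulrC -scalerA apureZ.
Qed.

Lemma amulE a b a' b' : amul (apure a b) (apure a' b') = apure (a * a') (b * b').
Proof.
by rewrite /amul tlift_pure ?tlift_pure //; [exact: amul_bal_in | exact: amul_bal].
Qed.
Lemma amulDl : left_distributive amul +%R.
Proof. by move=> s t u; rewrite /amul tliftD //; exact: amul_bal. Qed.
Lemma amulDr : right_distributive amul +%R.
Proof.
move=> s t u; rewrite /amul -tlift_fD; apply: eq_tlift => a b.
by rewrite tliftD //; exact: amul_bal_in.
Qed.
Lemma atens_ext (Z : zmodType) (f g : atens -> Z) :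
  {morph f : x y / x + y} -> {morph g : x y / x + y} ->
  (forall x y, f (apure x y) = g (apure x y)) -> f =1 g.
Proof. exact: tens_ext. Qed.

Lemma amulA : associative amul.
Proof.
move=> s t u; move: s; apply: atens_ext => [x y|x y|a b].
- by rewrite amulDl.
- by rewrite !amulDl.
move: t; apply: atens_ext => [x y|x y|a' b'].
- by rewrite amulDl amulDr.
- by rewrite amulDr amulDl.
move: u; apply: atens_ext => [x y|x y|a'' b''].
- by rewrite !amulDr.
- by rewrite !amulDr.
by rewrite !amulE !mulrA.
Qed.
Lemma amul1 : left_id (apure 1 1) amul.
Proof.
apply: atens_ext => [x y|x y|a b] //; first by rewrite amulDr.
by rewrite amulE !mul1r.
Qed.
Lemma amulr1 : right_id (apure 1 1) amul.
Proof.
apply: atens_ext => [x y|x y|a b] //; first by rewrite amulDl.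
by rewrite amulE !mulr1.
Qed.
Lemma atens1_neq0 : apure 1 1 != 0.
Proof.
pose e := vbasis (fullv : {vspace A}).
have [i ci] : exists i, coord e i 1 != 0.
  apply: contrapT => N; have /negP := @oner_neq0 A; apply; apply/eqP.
  rewrite (coord_vbasis (memvf 1)) big1 // => i _.
  by have [->|/eqP ci] := eqVneq (coord e i 1) 0; rewrite ?scale0r //; case: N; exists i; apply/eqP.
pose b (x : A) (y : B) := coord e i x *: y.
have B' : balanced (@scl_r k A) (@scl_l k B) b.
  split=> [x x' y|x y y'|x c y]; rewrite /b ?linearD ?scalerDl ?scalerDr //.
  by rewrite /scl_r /scl_l linearZ /= !scalerA mulrC.
apply: contra_neq (ci) => E.
have : tlift b (apure 1 1) = 0 by rewrite E tlift0.
rewrite /apure tlift_pure // /b => /eqP.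
by rewrite scaler_eq0 oner_eq0 orbF => /eqP.
Qed.
HB.instance Definition _ := GRing.Zmodule_isNzRing.Build atens
  amulA amul1 amulr1 amulDl amulDr atens1_neq0.

Lemma ascaleE c a b : ascale c (apure a b) = apure (c *: a) b.
Proof. by rewrite /ascale tlift_pure //; exact: ascale_bal. Qed.
Lemma ascaleDr : right_distributive ascale +%R.
Proof. by move=> c s t; rewrite /ascale tliftD //; exact: ascale_bal. Qed.
Lemma ascaleDl t : {morph ascale^~ t : c d / c + d}.
Proof.
move=> c d; rewrite /ascale -tlift_fD; apply: eq_tlift => a b.
by rewrite scalerDl apureDl.
Qed.
Lemma ascaleA c d t : ascale c (ascale d t) = ascale (c * d) t.
Proof.
move: t; apply: atens_ext => [x y|x y|a b]; rewrite ?ascaleDr //.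
by rewrite !ascaleE scalerA.
Qed.
Lemma ascale1 : left_id 1 ascale.
Proof.
apply: atens_ext => [x y|x y|a b] //; first by rewrite ascaleDr.
by rewrite ascaleE scale1r.
Qed.
HB.instance Definition _ := GRing.Zmodule_isLmodule.Build k atens
  ascaleA ascale1 ascaleDr ascaleDl.

Lemma atens_scalerAl c (s t : atens) : c *: (s * t) = (c *: s) * t.
Proof.
move: s; apply: atens_ext => [x y|x y|a b]; rewrite ?mulrDl ?scalerDr ?mulrDl //.
move: t; apply: atens_ext => [x y|x y|a' b']; rewrite ?mulrDr ?scalerDr //.
by rewrite -[LHS]/(ascale _ (amul _ _)) -[RHS]/(amul (ascale _ _) _) !(amulE, ascaleE) scalerAl.
Qed.
HB.instance Definition _ := GRing.Lmodule_isLalgebra.Build k atens atens_scalerAl.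
Lemma atens_scalerAr c (s t : atens) : c *: (s * t) = s * (c *: t).
Proof.
move: s; apply: atens_ext => [x y|x y|a b]; rewrite ?mulrDl ?scalerDr //.
move: t; apply: atens_ext => [x y|x y|a' b']; rewrite ?mulrDr ?scalerDr ?mulrDr //.
by rewrite -[LHS]/(ascale _ (amul _ _)) -[RHS]/(amul _ (ascale _ _)) !(amulE, ascaleE) scalerAr.
Qed.
HB.instance Definition _ := GRing.Lalgebra_isAlgebra.Build k atens atens_scalerAr.

End AlgebraTensor.

(* C^e = C (x) C^op; left C^e-modules are C-C-bimodules. *)
Definition env (k : fieldType) (C : falgType k) : algType k := atens C C^c.
Definition epure (k : fieldType) (C : falgType k) (a b : C) : env C :=
  @apure k C C^c a b.

Section BimoduleRegular.
Variables (k : fieldType) (C : falgType k).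

Lemma epureM a b a' b' :
  epure a b * epure a' b' = epure (a * a') (b' * b) :> env C.
Proof. exact: (@amulE k C C^c). Qed.

Lemma env_ext (Z : zmodType) (f g : env C -> Z) :
  {morph f : x y / x + y} -> {morph g : x y / x + y} ->
  (forall a b, f (epure a b) = g (epure a b)) -> f =1 g.
Proof. exact: (@atens_ext k C C^c). Qed.

(* C as a C^e-module: (a (x) b) c = a c b *)
Definition bireg : Type := C.
HB.instance Definition _ := GRing.Zmodule.on bireg.
Definition bireg_act (t : env C) (c : bireg) : bireg :=
  tlift (fun (a : C) (b : C^c) => (a * c * (b : C) : C)) t.

Lemma bireg_bal (c : C) : balanced (@scl_r k C) (@scl_l k C^c)
  (fun (a : C) (b : C^c) => (a * c * (b : C) : C)).
Proof.
split=> [x x' y|x y y'|x d y]; rewrite ?mulrDl ?mulrDr //.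
by rewrite /scl_r /scl_l -!scalerAl; exact: (scalerAr d (x * c) (y : C)).
Qed.
Lemma bireg_actE a b c : bireg_act (epure a b) c = (a * c * b : C).
Proof. by rewrite /bireg_act tlift_pure //; exact: bireg_bal. Qed.
Lemma bireg_actDl c : {morph bireg_act^~ c : s t / s + t}.
Proof. by move=> s t; rewrite /bireg_act tliftD //; exact: bireg_bal. Qed.
Lemma bireg_actDr : right_distributive bireg_act +%R.
Proof.
move=> t c d; rewrite /bireg_act -tlift_fD; apply: eq_tlift => a b.
by rewrite mulrDr mulrDl.
Qed.
Lemma bireg_actA s t c : bireg_act s (bireg_act t c) = bireg_act (s * t) c.
Proof.
move: s; apply: env_ext => [x y|x y|a b]; rewrite ?mulrDl ?bireg_actDl //.
move: t; apply: env_ext => [x y|x y|a' b'].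
- by rewrite bireg_actDl bireg_actDr.
- by rewrite mulrDr bireg_actDl.
by rewrite epureM !bireg_actE !mulrA.
Qed.
Lemma bireg_act1 : left_id 1 bireg_act.
Proof. by move=> c; rewrite -[1]/(epure 1 1) bireg_actE mul1r mulr1. Qed.
HB.instance Definition _ := GRing.Zmodule_isLmodule.Build (env C) bireg
  bireg_actA bireg_act1 bireg_actDr bireg_actDl.

End BimoduleRegular.

Record hopf (k : fieldType) (A : falgType k) := Hopf {
  comul : {lrmorphism A -> atens A A};
  counit : {lrmorphism A -> k | *%R};
  antipode : {linear A -> A};
  hopf_coassoc : forall a : A,
    tlift (fun x y => vpure (comul x) y) (comul a) =
    tlift (fun x y => tlift (fun y1 y2 => vpure (apure x y1) y2) (comul y))
      (comul a) :> vtens (atens A A) A;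
  hopf_counitl : forall a : A, tlift (fun x y => counit x *: y) (comul a) = a;
  hopf_counitr : forall a : A, tlift (fun x y => counit y *: x) (comul a) = a;
  hopf_antipodel : forall a : A,
    tlift (fun x y => antipode x * y) (comul a) = (counit a)%:A;
  hopf_antipoder : forall a : A,
    tlift (fun x y => x * antipode y) (comul a) = (counit a)%:A
}.

Section Restriction.
Variables (R S : pzRingType) (theta : {rmorphism R -> S}) (M : lmodType S).
Definition restr : Type := let _ := theta in M.
HB.instance Definition _ := GRing.Zmodule.copy restr M.
Definition restr_act (r : R) (m : restr) : restr := theta r *: (m : M).
Lemma restr_actA a b m : restr_act a (restr_act b m) = restr_act (a * b) m.
Proof. by rewrite /restr_act scalerA rmorphM. Qed.
Lemma restr_act1 : left_id 1 restr_act.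
Proof. by move=> m; rewrite /restr_act rmorph1 scale1r. Qed.
Lemma restr_actDr : right_distributive restr_act +%R.
Proof. by move=> a x y; rewrite /restr_act scalerDr. Qed.
Lemma restr_actDl m : {morph restr_act^~ m : a b / a + b}.
Proof. by move=> a b; rewrite /restr_act rmorphD scalerDl. Qed.
HB.instance Definition _ := GRing.Zmodule_isLmodule.Build R restr
  restr_actA restr_act1 restr_actDr restr_actDl.
End Restriction.

Definition trivmod (k : fieldType) (A : falgType k) (H : hopf A) : lmodType A :=
  restr (counit H) k^o.

(* finite dimensional over k; the scalar c acts as c 1_R *)
Definition fin_dim (k : fieldType) (R : algType k) (M : lmodType R) : Prop :=
  exists s : seq M, forall m : M, exists c : nat -> k,
    m = \sum_(i < size s) (c i)%:A *: s`_i.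

(* f (r x + y) = theta(r) f(x) + f(y); R-linearity is semilin idfun *)
Definition semilin (R S : pzRingType) (theta : R -> S)
    (U : lmodType R) (V : lmodType S) (f : U -> V) : Prop :=
  forall r x y, f (r *: x + y) = theta r *: f x + f y.

(* ... -> C_2 -> C_1 -> C_0 -> Y *)
Record aseq (R : pzRingType) (Y : lmodType R) := ASeq {
  term :> nat -> lmodType R;
  bd : forall n, {linear term n.+1 -> term n};
  aug : {linear term 0%N -> Y}
}.
Arguments bd {R Y} a n.
Arguments aug {R Y} a.

Definition projective (R : pzRingType) (P : lmodType R) : Prop :=
  forall (U V : lmodType R) (g : {linear U -> V}) (f : {linear P -> V}),
    (forall v, exists u, g u = v) ->
    exists h : {linear P -> U}, forall x, g (h x) = f x.

Definition proj_resolution (R : pzRingType) (Y : lmodType R) (P : aseq Y) : Prop :=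
  [/\ forall n, projective (P n),
      forall y, exists x, aug P x = y,
      forall x, aug P x = 0 <-> exists y, bd P 0 y = x &
      forall n x, bd P n x = 0 <-> exists y, bd P n.+1 y = x].

(* An inhomogeneous family u : P -> Q has components u j i : P_j -> Q_i,
   of degree j - i. *)
Definition family (R S : pzRingType) (Y : lmodType R) (Z : lmodType S)
  (P : aseq Y) (Q : aseq Z) : Type := forall j i, P j -> Q i.

(* u - v = d h + h d for some h with components of degree >= -1 *)
Definition homotopic (R S : pzRingType) (theta : R -> S) (Y : lmodType R)
    (Z : lmodType S) (P : aseq Y) (Q : aseq Z) (u v : family P Q) : Prop :=
  exists h : family P Q,
    [/\ forall j i, semilin theta (h j i),
        forall j i x, (j.+1 < i)%N -> h j i x = 0,
        forall i x, u 0%N i x - v 0%N i x = bd Q i (h 0%N i.+1 x) &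
        forall j i x, u j.+1 i x - v j.+1 i x =
          bd Q i (h j.+1 i.+1 x) + h j i (bd P j x)].

(* Elements of the direct sum over n >= 0 of the chain maps P[n] -> Q, without
   sign twist of the differential: the components are the lifts occurring in
   the usual description of the Yoneda composition. *)
Unset Implicit Arguments.
Record chain_map (R : pzRingType) (Y Z : lmodType R) (P : aseq Y) (Q : aseq Z) :=
  ChainMap {
  cm :> forall j i, P j -> Q i;
  cm_lin : forall j i, semilin idfun (cm j i);
  cm_deg : forall j i x, (j < i)%N -> cm j i x = 0;
  cm_bound : exists N, forall j i x, (i + N < j)%N -> cm j i x = 0;
  cm_bd : forall j i x, bd Q i (cm j.+1 i.+1 x) = cm j i (bd P j x)
}.
Set Implicit Arguments.
Arguments chain_map {R Y Z} P Q.
Arguments ChainMap {R Y Z P Q}.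
Arguments cm {R Y Z P Q} f j i x : rename.
Arguments cm_lin {R Y Z P Q} f j i : rename.
Arguments cm_deg {R Y Z P Q} f j i x : rename.
Arguments cm_bound {R Y Z P Q} f : rename.
Arguments cm_bd {R Y Z P Q} f j i x : rename.

HB.instance Definition _ (R : pzRingType) (Y Z : lmodType R) (P : aseq Y)
  (Q : aseq Z) := gen_eqMixin (chain_map P Q).
HB.instance Definition _ (R : pzRingType) (Y Z : lmodType R) (P : aseq Y)
  (Q : aseq Z) := gen_choiceMixin (chain_map P Q).

Section SemilinTheory.
Variables (R S : pzRingType) (theta : {rmorphism R -> S}).
Variables (U : lmodType R) (V : lmodType S).
Implicit Types f g : U -> V.

Lemma semilinD f x y : semilin theta f -> f (x + y) = f x + f y.
Proof. by move=> L; rewrite -[x]scale1r L rmorph1 !scale1r. Qed.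
Lemma semilin0 f : semilin theta f -> f 0 = 0.
Proof. by move=> L; apply: (addrI (f 0)); rewrite -semilinD // !addr0. Qed.
Lemma semilinN f x : semilin theta f -> f (- x) = - f x.
Proof. by move=> L; apply: (addrI (f x)); rewrite -semilinD // !subrr semilin0. Qed.
Lemma semilinZ f r x : semilin theta f -> f (r *: x) = theta r *: f x.
Proof. by move=> L; rewrite -[r *: x]addr0 L semilin0 // addr0. Qed.
Lemma semilin_sum f I r (P : pred I) F : semilin theta f ->
  f (\sum_(i <- r | P i) F i) = \sum_(i <- r | P i) f (F i).
Proof. 
by move=> L; apply: (big_morph f (fun x y => semilinD x y L) (semilin0 L)).
Qed.
End SemilinTheory.

Section Homotopy.
Variables (R : pzRingType) (Y Z : lmodType R) (P : aseq Y) (Q : aseq Z).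
Implicit Types (u v w : family P Q) (f g : chain_map P Q).
Local Notation hmt := (@homotopic R R idfun Y Z P Q).

Lemma homotopic_eq u v : (forall j i x, u j i x = v j i x) -> hmt u v.
Proof.
move=> E; exists (fun _ _ _ => 0); split=> //.
- by move=> j i r x y; rewrite scaler0 addr0.
- by move=> i x; rewrite E subrr linear0.
- by move=> j i x; rewrite E subrr linear0 addr0.
Qed.

Lemma homotopicD u v u' v' : hmt u v -> hmt u' v' ->
  hmt (fun j i x => u j i x + u' j i x) (fun j i x => v j i x + v' j i x).
Proof.
case=> h [hl hd h0 h1] [h' [hl' hd' h0' h1']].
exists (fun j i x => h j i x + h' j i x); split.
- by move=> j i r x y; rewrite hl hl' scalerDr addrACA.
- by move=> j i x lt; rewrite hd // hd' // addr0.
- by move=> i x; rewrite opprD addrACA h0 h0' linearD.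
- by move=> j i x; rewrite opprD addrACA h1 h1' linearD addrACA.
Qed.

Lemma homotopicN u v : hmt u v ->
  hmt (fun j i x => - u j i x) (fun j i x => - v j i x).
Proof.
case=> h [hl hd h0 h1]; exists (fun j i x => - h j i x); split.
- by move=> j i r x y; rewrite hl opprD scalerN.
- by move=> j i x lt; rewrite hd // oppr0.
- by move=> i x; rewrite -opprD h0 linearN.
- by move=> j i x; rewrite -opprD h1 linearN -opprD.
Qed.

Lemma homotopic_sym u v : hmt u v -> hmt v u.
Proof.
case=> h [hl hd h0 h1]; exists (fun j i x => - h j i x); split.
- by move=> j i r x y; rewrite hl opprD scalerN.
- by move=> j i x lt; rewrite hd // oppr0.
- by move=> i x; rewrite -opprB h0 linearN.
- by move=> j i x; rewrite -opprB h1 linearN -opprD.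
Qed.

Lemma homotopic_trans v u w : hmt u v -> hmt v w -> hmt u w.
Proof.
case=> h [hl hd h0 h1] [h' [hl' hd' h0' h1']].
exists (fun j i x => h j i x + h' j i x); split.
- by move=> j i r x y; rewrite hl hl' scalerDr addrACA.
- by move=> j i x lt; rewrite hd // hd' // addr0.
- by move=> i x; rewrite linearD -h0 -h0' addrA subrK.
- by move=> j i x; rewrite linearD addrACA -h1 -h1' addrA subrK.
Qed.

(* Ext^*(Y, Z) when P and Q are projective resolutions of Y and Z *)
Definition ext_rel (f g : chain_map P Q) : bool := `[< hmt f g >].
Lemma ext_refl : reflexive ext_rel.
Proof. by move=> f; apply/asboolP/homotopic_eq. Qed.
Lemma ext_sym : symmetric ext_rel.
Proof. by move=> f g; apply/asboolP/asboolP; apply: homotopic_sym. Qed.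
Lemma ext_trans : transitive ext_rel.
Proof.
move=> g f h /asboolP E1 /asboolP E2; apply/asboolP.
exact: homotopic_trans E1 E2.
Qed.
Canonical ext_equiv := EquivRel ext_rel ext_refl ext_sym ext_trans.

Definition Ext : Type := {eq_quot ext_rel}.
HB.instance Definition _ := Choice.on Ext.
Definition ext_cls (f : chain_map P Q) : Ext := \pi_({eq_quot ext_rel}) f.
Definition ext_rep (e : Ext) : chain_map P Q := repr (e : {eq_quot ext_rel}).

Lemma ext_repK e : ext_cls (ext_rep e) = e. Proof. exact: reprK. Qed.
Lemma ext_clsP f g : ext_cls f = ext_cls g <-> hmt f g.
Proof. by split=> [/eqmodP/asboolP|E]; last by apply/eqmodP/asboolP. Qed.
Lemma ext_rep_cls f : hmt (ext_rep (ext_cls f)) f.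
Proof. by apply/ext_clsP; rewrite ext_repK. Qed.
Lemma ext_ind (T : Ext -> Prop) : (forall f, T (ext_cls f)) -> forall e, T e.
Proof. by move=> H e; rewrite -[e]ext_repK. Qed.

Lemma bound_add (f g : chain_map P Q) : exists N, forall j i x,
  (i + N < j)%N -> f j i x + g j i x = 0.
Proof.
have [N fN] := cm_bound f; have [M gM] := cm_bound g.
exists (N + M)%N => j i x lt; rewrite fN ?gM ?addr0 //; apply: leq_ltn_trans lt.
  by rewrite leq_add2l leq_addl.
by rewrite leq_add2l leq_addr.
Qed.

Definition cm_add (f g : chain_map P Q) : chain_map P Q.
Proof.
refine (@ChainMap _ _ _ P Q (fun j i x => f j i x + g j i x) _ _ (bound_add f g) _).
- by move=> j i r x y; rewrite !cm_lin /= scalerDr addrACA.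
- by move=> j i x lt; rewrite !cm_deg // addr0.
- by move=> j i x; rewrite linearD !cm_bd.
Defined.
Definition cm_opp (f : chain_map P Q) : chain_map P Q.
Proof.
refine (@ChainMap _ _ _ P Q (fun j i x => - f j i x) _ _ _ _).
- by move=> j i r x y; rewrite cm_lin /= opprD scalerN.
- by move=> j i x lt; rewrite cm_deg // oppr0.
- by have [N fN] := cm_bound f; exists N => j i x lt; rewrite fN // oppr0.
- by move=> j i x; rewrite linearN cm_bd.
Defined.
Definition cm_zero : chain_map P Q.
Proof.
refine (@ChainMap _ _ _ P Q (fun j i x => 0) _ _ _ _) => //.
- by move=> j i r x y; rewrite scaler0 addr0.
- by exists 0%N.
- by move=> j i x; rewrite linear0.
Defined.

Definition ext_add (e e' : Ext) := ext_cls (cm_add (ext_rep e) (ext_rep e')).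
Definition ext_opp (e : Ext) := ext_cls (cm_opp (ext_rep e)).
Lemma ext_addE f g : ext_add (ext_cls f) (ext_cls g) = ext_cls (cm_add f g).
Proof. by apply/ext_clsP; apply: homotopicD; apply: ext_rep_cls. Qed.
Lemma ext_oppE f : ext_opp (ext_cls f) = ext_cls (cm_opp f).
Proof. by apply/ext_clsP; apply: homotopicN; apply: ext_rep_cls. Qed.
Lemma ext_eq f g : (forall j i x, f j i x = g j i x) -> ext_cls f = ext_cls g.
Proof. by move=> E; apply/ext_clsP/homotopic_eq. Qed.

Lemma ext_addA : associative ext_add.
Proof.
elim/ext_ind=> f; elim/ext_ind=> g; elim/ext_ind=> h.
by rewrite !ext_addE; apply: ext_eq => j i x /=; rewrite addrA.
Qed.
Lemma ext_addC : commutative ext_add.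
Proof.
elim/ext_ind=> f; elim/ext_ind=> g.
by rewrite !ext_addE; apply: ext_eq => j i x /=; rewrite addrC.
Qed.
Lemma ext_add0 : left_id (ext_cls cm_zero) ext_add.
Proof.
elim/ext_ind=> f.
by rewrite ext_addE; apply: ext_eq => j i x /=; rewrite add0r.
Qed.
Lemma ext_addN : left_inverse (ext_cls cm_zero) ext_opp ext_add.
Proof.
elim/ext_ind=> f.
by rewrite ext_oppE ext_addE; apply: ext_eq => j i x /=; rewrite addNr.
Qed.
HB.instance Definition _ :=
  GRing.isZmodule.Build Ext ext_addA ext_addC ext_add0 ext_addN.

End Homotopy.

Section Composition.
Variable R : pzRingType.

Section Comp2.
Variables (X Y Z : lmodType R) (P : aseq X) (Q : aseq Y) (T : aseq Z).
Implicit Types (f : chain_map Q T) (g : chain_map P Q).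

Definition cm_comp f g : chain_map P T.
Proof.
refine (@ChainMap _ _ _ P T (fun j i x => \sum_(l < j.+1) f l i (g j l x)) _ _ _ _).
- move=> j i r x y; rewrite scaler_sumr -big_split /=; apply: eq_bigr => l _.
  by rewrite !cm_lin.
- move=> j i x lt; apply: big1 => l _; rewrite cm_deg //.
  by apply: leq_trans lt; rewrite ltnS -ltnS.
- have [N fN] := cm_bound f; have [M gM] := cm_bound g.
  exists (N + M)%N => j i x lt; apply: big1 => l _.
  have [le|lt'] := leqP l (i + N); last by rewrite fN.
  rewrite gM ?(semilin0 (cm_lin f _ _)) //.
  by apply: leq_ltn_trans lt; rewrite addnA leq_add2r.
- move=> j i x; rewrite linear_sum big_ord_recl /= cm_deg //.
  rewrite linear0 add0r; apply: eq_bigr => l _.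
  by rewrite -cm_bd -cm_bd.
Defined.
End Comp2.

Section CompHomotopy.
Variables (X Y Z : lmodType R) (P : aseq X) (Q : aseq Y) (T : aseq Z).
Implicit Types (f : chain_map Q T) (g : chain_map P Q).

Lemma cm_comp_homl f f' g : @homotopic R R idfun _ _ Q T f f' ->
  @homotopic R R idfun _ _ P T (cm_comp f g) (cm_comp f' g).
Proof.
case=> h [hl hd h0 h1].
exists (fun j i x => \sum_(l < j.+1) h l i (g j l x)); split.
- move=> j i r x y; rewrite scaler_sumr -big_split /=; apply: eq_bigr => l _.
  by rewrite cm_lin hl.
- move=> j i x lt; apply: big1 => l _; rewrite hd //.
  by apply: leq_trans lt; rewrite ltnS.
- by move=> i x; rewrite /= !big_ord1 h0.
- move=> j i x /=; rewrite -sumrB linear_sum.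
  rewrite big_ord_recl [in RHS]big_ord_recl /= h0 -addrA; congr (_ + _).
  by rewrite -big_split /=; apply: eq_bigr => l _; rewrite h1 cm_bd.
Qed.

Lemma cm_comp_homr f g g' : @homotopic R R idfun _ _ P Q g g' ->
  @homotopic R R idfun _ _ P T (cm_comp f g) (cm_comp f g').
Proof.
case=> h [hl hd h0 h1].
have fB l i x y : f l i (x - y) = f l i x - f l i y.
  by rewrite (semilinD _ _ (cm_lin f _ _)) (semilinN _ (cm_lin f _ _)).
have d0 i x : bd T i (f 0%N i.+1 x) = 0 by rewrite cm_deg // linear0.
exists (fun j i x => \sum_(l < j.+2) f l i (h j l x)); split.
- move=> j i r x y; rewrite scaler_sumr -big_split /=; apply: eq_bigr => l _.
  by rewrite hl cm_lin.
- move=> j i x lt; apply: big1 => l _; rewrite cm_deg //.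
  by apply: leq_trans lt; rewrite ltnS -ltnS.
- move=> i x; rewrite /= !big_ord_recl !big_ord0 !addr0 linearD d0 add0r.
  by rewrite cm_bd -fB h0.
- move=> j i x /=; rewrite -sumrB linear_sum [X in X + _]big_ord_recl /= d0 add0r.
  rewrite -big_split /=; apply: eq_bigr => l _.
  by rewrite -fB h1 cm_bd (semilinD _ _ (cm_lin f _ _)).
Qed.

Definition ext_comp (e : Ext Q T) (e' : Ext P Q) : Ext P T :=
  ext_cls (cm_comp (ext_rep e) (ext_rep e')).

Lemma ext_compE f g : ext_comp (ext_cls f) (ext_cls g) = ext_cls (cm_comp f g).
Proof.
apply/ext_clsP; apply: (@homotopic_trans _ _ _ _ _ (cm_comp f (ext_rep (ext_cls g)))).
  by apply/cm_comp_homl/ext_rep_cls.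
by apply/cm_comp_homr/ext_rep_cls.
Qed.

Lemma ext_compDl e1 e2 e' : ext_comp (e1 + e2) e' = ext_comp e1 e' + ext_comp e2 e'.
Proof.
elim/ext_ind: e1 => f1; elim/ext_ind: e2 => f2; elim/ext_ind: e' => g.
rewrite -[_ + _]/(ext_add _ _) -[RHS]/(ext_add _ _) ext_addE !ext_compE ext_addE.
by apply: ext_eq => j i x /=; rewrite big_split.
Qed.
Lemma ext_compDr e e1 e2 : ext_comp e (e1 + e2) = ext_comp e e1 + ext_comp e e2.
Proof.
elim/ext_ind: e1 => g1; elim/ext_ind: e2 => g2; elim/ext_ind: e => f.
rewrite -[_ + _]/(ext_add _ _) -[RHS]/(ext_add _ _) ext_addE !ext_compE ext_addE.
apply: ext_eq => j i x /=; rewrite -big_split /=; apply: eq_bigr => l _.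
by rewrite (semilinD _ _ (cm_lin f _ _)).
Qed.
End CompHomotopy.

Lemma ext_compA (X Y Z W : lmodType R) (P : aseq X) (Q : aseq Y) (T : aseq Z)
    (U : aseq W) (e1 : Ext T U) (e2 : Ext Q T) (e3 : Ext P Q) :
  ext_comp e1 (ext_comp e2 e3) = ext_comp (ext_comp e1 e2) e3.
Proof.
elim/ext_ind: e1 => f; elim/ext_ind: e2 => g; elim/ext_ind: e3 => h.
rewrite !ext_compE; apply: ext_eq => j i x /=.
pose F (l m : nat) := f l i (g m l (h j m x)).
have -> : \sum_(l < j.+1) f l i (\sum_(m < j.+1) g m l (h j m x)) =
          \sum_(m < j.+1) \sum_(l < j.+1) F l m.
  rewrite exchange_big /=; apply: eq_bigr => l _.
  by rewrite (semilin_sum _ _ _ (cm_lin f _ _)).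
apply: eq_bigr => m _; rewrite [RHS](big_ord_widen j.+1 (fun l => F l m)) //.
rewrite [RHS]big_mkcond /=; apply: eq_bigr => l _.
rewrite ltnS; case: leqP => // lt.
by rewrite /F (cm_deg g) // (semilin0 (cm_lin f _ _)).
Qed.

Section Unit.
Variables (X : lmodType R) (P : aseq X).
Definition cid (j i : nat) : P j -> P i :=
  match j =P i with
  | ReflectT e => fun x => ecast n (P n) e x
  | ReflectF _ => fun=> 0
  end.
Arguments cid : clear implicits.
Lemma cid_id j x : cid j j x = x.
Proof. by rewrite /cid; case: eqP => // e; rewrite eq_axiomK. Qed.
Lemma cid_neq j i x : j != i -> cid j i x = 0.
Proof. by rewrite /cid; case: eqP. Qed.
Definition cm_id : chain_map P P.
Proof.
refine (@ChainMap _ _ _ P P cid _ _ _ _).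
- move=> j i r x y; have [E|ne] := eqVneq j i.
    by case: i / E; rewrite !cid_id.
  by rewrite !cid_neq // scaler0 addr0.
- by move=> j i x lt; rewrite cid_neq // ltn_eqF.
- by exists 0%N => j i x lt; rewrite cid_neq // neq_ltn -[i]addn0 lt orbT.
- move=> j i x; have [E|ne] := eqVneq j i; first by case: i / E; rewrite !cid_id.
  by rewrite !cid_neq ?linear0.
Defined.

Lemma ext_comp1 (Y : lmodType R) (Q : aseq Y) (e : Ext Q P) :
  ext_comp (ext_cls cm_id) e = e.
Proof.
elim/ext_ind: e => f; rewrite ext_compE; apply: ext_eq => j i x /=.
have [le|lt] := leqP i j.
  rewrite (bigD1 (Ordinal (le : i < j.+1)%N)) //= cid_id big1 ?addr0 // => l ne.
  by rewrite cid_neq //; apply: contraNneq ne => E; apply/eqP/val_inj.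
rewrite cm_deg // big1 // => l _; rewrite cid_neq // neq_ltn.
by rewrite (leq_ltn_trans _ lt) // -ltnS.
Qed.
Lemma ext_compr1 (Y : lmodType R) (Q : aseq Y) (e : Ext P Q) :
  ext_comp e (ext_cls cm_id) = e.
Proof.
elim/ext_ind: e => f; rewrite ext_compE; apply: ext_eq => j i x /=.
rewrite big_ord_recr /= cid_id big1 ?add0r // => l _.
by rewrite cid_neq ?(semilin0 (cm_lin f _ _)) // neq_ltn ltn_ord orbT.
Qed.

HB.instance Definition _ := GRing.Zmodule_isPzRing.Build (Ext P P)
  (@ext_compA _ _ _ _ P P P P) (@ext_comp1 _ P) (@ext_compr1 _ P)
  (@ext_compDl _ _ _ P P P) (@ext_compDr _ _ _ P P P).
End Unit.

End Composition.

Section ExtScale.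
Variables (k : fieldType) (R : algType k) (Y Z : lmodType R).
Variables (P : aseq Y) (Q : aseq Z).
Definition cm_scale (c : k) (f : chain_map P Q) : chain_map P Q.
Proof.
refine (@ChainMap _ _ _ P Q (fun j i x => c%:A *: f j i x) _ _ _ _).
- by move=> j i r x y; rewrite cm_lin /= scalerDr !scalerA mulr_algl mulr_algr.
- by move=> j i x lt; rewrite cm_deg // scaler0.
- by have [N fN] := cm_bound f; exists N => j i x lt; rewrite fN // scaler0.
- by move=> j i x; rewrite linearZ /= cm_bd.
Defined.
Definition ext_scale c (e : Ext P Q) := ext_cls (cm_scale c (ext_rep e)).
Lemma ext_scaleE c f : ext_scale c (ext_cls f) = ext_cls (cm_scale c f).
Proof.
apply/ext_clsP; have [h [hl hd h0 h1]] := ext_rep_cls f.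
exists (fun j i x => c%:A *: h j i x); split.
- by move=> j i r x y; rewrite hl /= scalerDr !scalerA mulr_algl mulr_algr.
- by move=> j i x lt; rewrite hd // scaler0.
- by move=> i x; rewrite /= -scalerBr h0 linearZ.
- by move=> j i x; rewrite /= -scalerBr h1 linearZ scalerDr.
Qed.
Lemma ext_scaleA c d e : ext_scale c (ext_scale d e) = ext_scale (c * d) e.
Proof.
elim/ext_ind: e => f; rewrite !ext_scaleE; apply: ext_eq => j i x /=.
by rewrite scalerA mulr_algl scalerA.
Qed.
Lemma ext_scale1 : left_id 1 ext_scale.
Proof.
by elim/ext_ind=> f; rewrite ext_scaleE; apply: ext_eq => j i x /=; rewrite !scale1r.
Qed.
Lemma ext_scaleDr : right_distributive ext_scale +%R.
Proof.
move=> c; elim/ext_ind=> f; elim/ext_ind=> g.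
rewrite -[_ + _]/(ext_add _ _) -[RHS]/(ext_add _ _) ext_addE !ext_scaleE ext_addE.
by apply: ext_eq => j i x /=; rewrite scalerDr.
Qed.
Lemma ext_scaleDl e : {morph ext_scale^~ e : c d / c + d}.
Proof.
move=> c d; elim/ext_ind: e => f.
rewrite -[RHS]/(ext_add _ _) !ext_scaleE ext_addE.
by apply: ext_eq => j i x /=; rewrite !scalerDl.
Qed.
HB.instance Definition _ := GRing.Zmodule_isLmodule.Build k (Ext P Q)
  ext_scaleA ext_scale1 ext_scaleDr ext_scaleDl.
End ExtScale.

(* phi : Q -> C is a theta-semilinear chain map over p : Y -> Z *)
Definition is_lift (R S : pzRingType) (theta : R -> S) (Y : lmodType R)
    (Z : lmodType S) (Q : aseq Y) (C : aseq Z) (p : Y -> Z)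
    (phi : forall n, Q n -> C n) : Prop :=
  [/\ forall n, semilin theta (phi n),
      forall x, aug C (phi 0%N x) = p (aug Q x) &
      forall n x, bd C n (phi n.+1 x) = phi n (bd Q n x)].

(* z and u correspond to each other along a lift phi of p, i.e.,
   phi o z ~ u o phi *)
Definition lies_over (R S : pzRingType) (theta : R -> S) (Y : lmodType R)
    (Z : lmodType S) (Q : aseq Y) (C : aseq Z) (p : Y -> Z)
    (z : family Q Q) (u : family C C) : Prop :=
  exists2 phi : forall n, Q n -> C n, is_lift theta p phi &
    @homotopic R S theta Y Z Q C
      (fun j i x => phi i (z j i x)) (fun j i x => u j i (phi j x)).

(* M (x)_k N, with A acting through comul; the scalars c in k act on A-modules
   as c 1_A *)
Section TensorModule.
Variables (k : fieldType) (A : falgType k) (H : hopf A).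

Section Object.
Variables (M N : lmodType A).
Definition kact_r (x : M) (c : k) : M := c%:A *: x.
Definition kact_l (c : k) (y : N) : N := c%:A *: y.
Definition ktens : Type := let _ := H in tensor kact_r kact_l.
HB.instance Definition _ := GRing.Zmodule.copy ktens (tensor kact_r kact_l).
Definition kpure (x : M) (y : N) : ktens := pure kact_r kact_l x y.

Lemma kpureDl x x' y : kpure (x + x') y = kpure x y + kpure x' y.
Proof. exact: pureDl. Qed.
Lemma kpureDr x y y' : kpure x (y + y') = kpure x y + kpure x y'.
Proof. exact: pureDr. Qed.
Lemma kpureZ (c : k) x y : kpure (c%:A *: x) y = kpure x (c%:A *: y).
Proof. exact: (pureM kact_r kact_l). Qed.
Lemma ktens_ext (Z : zmodType) (f g : ktens -> Z) :
  {morph f : x y / x + y} -> {morph g : x y / x + y} ->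
  (forall x y, f (kpure x y) = g (kpure x y)) -> f =1 g.
Proof. exact: tens_ext. Qed.

Definition kact2 (s : atens A A) (t : ktens) : ktens :=
  tlift (fun x y => tlift (fun a b => kpure (a *: x) (b *: y)) s) t.
Lemma scaleZA (a : A) (c : k) (V : lmodType A) (v : V) :
  (c *: a) *: v = a *: (c%:A *: v).
Proof. by rewrite scalerA mulr_algr. Qed.
Lemma kact2_bal_in x y : balanced (@scl_r k A) (@scl_l k A)
  (fun a b => kpure (a *: x) (b *: y)).
Proof.
split=> [a a' b|a b b'|a c b]; rewrite ?scalerDl ?kpureDl ?kpureDr //.
by rewrite /scl_r /scl_l -(mulr_algl c a) -(mulr_algl c b) -!scalerA kpureZ.
Qed.
Lemma kact2_bal (s : atens A A) : balanced kact_r kact_l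
  (fun x y => tlift (fun a b => kpure (a *: x) (b *: y)) s).
Proof.
split=> [x x' y|x y y'|x c y].
- by rewrite -tlift_fD; apply: eq_tlift => a b; rewrite scalerDr kpureDl.
- by rewrite -tlift_fD; apply: eq_tlift => a b; rewrite scalerDr kpureDr.
apply: eq_tlift => a b; rewrite /kact_r /kact_l -!scaleZA.
by rewrite -(mulr_algl c a) -(mulr_algl c b) -!scalerA kpureZ.
Qed.
Lemma kact2E a b x y : kact2 (apure a b) (kpure x y) = kpure (a *: x) (b *: y).
Proof.
by rewrite /kact2 tlift_pure ?tlift_pure //; [exact: kact2_bal_in | exact: kact2_bal].
Qed.
Lemma kact2Dr s : {morph kact2 s : t t' / t + t'}.
Proof. by move=> t t'; rewrite /kact2 tliftD //; exact: kact2_bal. Qed.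
Lemma kact2Dl t : {morph kact2^~ t : s s' / s + s'}.
Proof.
move=> s s'; rewrite /kact2 -tlift_fD; apply: eq_tlift => x y.
by rewrite tliftD //; exact: kact2_bal_in.
Qed.
Lemma kact2M s s' t : kact2 (s * s') t = kact2 s (kact2 s' t).
Proof.
move: t; apply: ktens_ext => [t t'|t t'|x y]; rewrite ?kact2Dr //.
move: s; apply: atens_ext => [s t|s t|a b]; rewrite ?mulrDl ?kact2Dl //.
move: s'; apply: atens_ext => [s t|s t|a' b'].
- by rewrite mulrDr kact2Dl.
- by rewrite kact2Dl kact2Dr.
by rewrite -[_ * _]/(amul _ _) amulE !kact2E !scalerA.
Qed.

Definition kact (a : A) (t : ktens) : ktens := kact2 (comul H a) t.
Lemma kactA a b t : kact a (kact b t) = kact (a * b) t.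
Proof. by rewrite /kact rmorphM kact2M. Qed.
Lemma kact1 : left_id 1 kact.
Proof.
move=> t; rewrite /kact rmorph1; move: t; apply: ktens_ext => [t t'|t t'|x y] //.
  by rewrite kact2Dr.
by rewrite -[1]/(apure 1 1) kact2E !scale1r.
Qed.
Lemma kactDr : right_distributive kact +%R.
Proof. by move=> a t t'; apply: kact2Dr. Qed.
Lemma kactDl t : {morph kact^~ t : a b / a + b}.
Proof. by move=> a b; rewrite /kact rmorphD kact2Dl. Qed.
HB.instance Definition _ := GRing.Zmodule_isLmodule.Build A ktens
  kactA kact1 kactDr kactDl.
End Object.

Section Morphism.
Variables (M M' N : lmodType A) (f : {linear M -> M'}).
Definition kmap (t : ktens M N) : ktens M' N :=
  tlift (fun x y => kpure (f x) y) t.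
Lemma kmap_bal : balanced (@kact_r M) (@kact_l N) (fun x y => kpure (f x) y).
Proof.
split=> [x x' y|x y y'|x c y]; rewrite ?linearD ?kpureDl ?kpureDr //.
by rewrite /kact_r linearZ /= kpureZ.
Qed.
Lemma kmapD : {morph kmap : t t' / t + t'}.
Proof. by move=> t t'; rewrite /kmap tliftD //; exact: kmap_bal. Qed.
Lemma kmapE x y : kmap (kpure x y) = kpure (f x) y.
Proof. by rewrite /kmap tlift_pure //; exact: kmap_bal. Qed.
Lemma kmap_act2 s t : kmap (kact2 s t) = kact2 s (kmap t).
Proof.
move: t; apply: ktens_ext => [t t'|t t'|x y]; rewrite ?kact2Dr ?kmapD ?kact2Dr //.
move: s; apply: atens_ext => [s t|s t|a b]; rewrite ?kact2Dl ?kmapD ?kact2Dl //.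
by rewrite kact2E !kmapE kact2E linearZ.
Qed.
Lemma kmap_linear : linear kmap.
Proof. by move=> a t t'; rewrite kmapD; congr (_ + _); apply: kmap_act2. Qed.
HB.instance Definition _ := GRing.isLinear.Build A (ktens M N) (ktens M' N) _
  kmap kmap_linear.
End Morphism.

(* P (x)_k M, augmented to k (x)_k M = M *)
Section Sequence.
Variables (P : aseq (trivmod H)) (M : lmodType A).
Definition kaug (t : ktens (P 0%N) M) : M :=
  tlift (fun x m => ((aug P x : k)%:A : A) *: m) t.
Lemma augD x y : (aug P (x + y) : k) = (aug P x : k) + (aug P y : k).
Proof. exact: (linearD (aug P)). Qed.
Lemma augZ a x : (aug P (a *: x) : k) = counit H a * (aug P x : k).
Proof. by rewrite linearZ. Qed.
Lemma kaug_bal : balanced (@kact_r (P 0%N)) (@kact_l M)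
  (fun x m => ((aug P x : k)%:A : A) *: m).
Proof.
split=> [x x' m|x m m'|x c m]; rewrite ?scalerDr // ?augD ?scalerDl ?scalerDl //.
by rewrite /kact_r augZ linearZ /= rmorph1 mulr1 /kact_l scalerA mulr_algl scalerA mulrC.
Qed.
Lemma kaugD : {morph kaug : t t' / t + t'}.
Proof. by move=> t t'; rewrite /kaug tliftD //; exact: kaug_bal. Qed.
Lemma kaugE x m : kaug (kpure x m) = ((aug P x : k)%:A : A) *: m.
Proof. by rewrite /kaug tlift_pure //; exact: kaug_bal. Qed.
Lemma kaug_act2 (s : atens A A) t : 
  kaug (kact2 s t) = tlift (fun a b => counit H a *: b) s *: kaug t.
Proof.
have B : balanced (@scl_r k A) (@scl_l k A) (fun a b => counit H a *: b).
  split=> [a a' b|a b b'|a c b]; rewrite ?rmorphD ?scalerDl ?scalerDr //.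
  by rewrite /scl_r /scl_l linearZ /= scalerA mulrC.
move: t; apply: ktens_ext => [t t'|t t'|x m].
- by rewrite kact2Dr kaugD.
- by rewrite kaugD scalerDr.
move: s; apply: atens_ext => [s t|s t|a b].
- by rewrite kact2Dl kaugD.
- by rewrite tliftD // scalerDl.
rewrite kact2E !kaugE [apure _ _]/(apure _ _) tlift_pure //.
by rewrite augZ !scalerA mulr_algl mulr_algr scalerA mulrC.
Qed.
Lemma kaug_linear : linear kaug.
Proof.
move=> a t t'; rewrite kaugD; congr (_ + _).
by rewrite -[a *: t]/(kact2 (comul H a) t) kaug_act2 hopf_counitl.
Qed.
HB.instance Definition _ := GRing.isLinear.Build A (ktens (P 0%N) M) M _
  kaug kaug_linear.
Definition kseq : aseq M :=
  @ASeq A M (fun n => ktens (P n) M) (fun n => @kmap _ _ _ (bd P n)) kaug.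
End Sequence.

End TensorModule.

(* S (x)_R X, for theta : R -> S and S a right R-module via theta *)
Section Induction.
Variables (R S : pzRingType) (theta : R -> S).

Section Object.
Variable X : lmodType R.
Definition iact_r (s : S) (r : R) : S := s * theta r.
Definition iact_l (r : R) (x : X) : X := r *: x.
Definition induced : Type := tensor iact_r iact_l.
HB.instance Definition _ := GRing.Zmodule.on induced.
Definition ipure (s : S) (x : X) : induced := pure iact_r iact_l s x.
Lemma ipureDl s s' x : ipure (s + s') x = ipure s x + ipure s' x.
Proof. exact: pureDl. Qed.
Lemma ipureDr s x x' : ipure s (x + x') = ipure s x + ipure s x'.
Proof. exact: pureDr. Qed.
Lemma ipureM s r x : ipure (s * theta r) x = ipure s (r *: x).
Proof. exact: (pureM iact_r iact_l). Qed.
Lemma induced_ext (Z : zmodType) (f g : induced -> Z) :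
  {morph f : x y / x + y} -> {morph g : x y / x + y} ->
  (forall s x, f (ipure s x) = g (ipure s x)) -> f =1 g.
Proof. exact: tens_ext. Qed.

Definition iact (s : S) (t : induced) : induced :=
  tlift (fun s' x => ipure (s * s') x) t.
Lemma iact_bal s : balanced iact_r iact_l (fun s' x => ipure (s * s') x).
Proof.
split=> [t t' x|t x x'|t r x]; rewrite ?mulrDr ?ipureDl ?ipureDr //.
by rewrite /iact_r mulrA ipureM.
Qed.
Lemma iactE s s' x : iact s (ipure s' x) = ipure (s * s') x.
Proof. by rewrite /iact tlift_pure //; exact: iact_bal. Qed.
Lemma iactDr : right_distributive iact +%R.
Proof. by move=> s t t'; rewrite /iact tliftD //; exact: iact_bal. Qed.
Lemma iactDl t : {morph iact^~ t : s s' / s + s'}.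
Proof.
move=> s s'; rewrite /iact -tlift_fD; apply: eq_tlift => s'' x.
by rewrite mulrDl ipureDl.
Qed.
Lemma iactA s s' t : iact s (iact s' t) = iact (s * s') t.
Proof.
move: t; apply: induced_ext => [t t'|t t'|t x]; rewrite ?iactDr //.
by rewrite !iactE mulrA.
Qed.
Lemma iact1 : left_id 1 iact.
Proof.
apply: induced_ext => [t t'|t t'|t x] //; first by rewrite iactDr.
by rewrite iactE mul1r.
Qed.
HB.instance Definition _ := GRing.Zmodule_isLmodule.Build S induced
  iactA iact1 iactDr iactDl.
End Object.

Section Morphism.
Variables (X X' : lmodType R) (f : {linear X -> X'}).
Definition imap (t : induced X) : induced X' := tlift (fun s x => ipure s (f x)) t.
Lemma imap_bal : balanced iact_r (@iact_l X) (fun s x => ipure s (f x)).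
Proof.
split=> [s s' x|s x x'|s r x]; rewrite ?linearD ?ipureDl ?ipureDr //.
by rewrite /iact_r /iact_l ipureM linearZ.
Qed.
Lemma imapD : {morph imap : t t' / t + t'}.
Proof. by move=> t t'; rewrite /imap tliftD //; exact: imap_bal. Qed.
Lemma imapE s x : imap (ipure s x) = ipure s (f x).
Proof. by rewrite /imap tlift_pure //; exact: imap_bal. Qed.
Lemma imap_linear : linear imap.
Proof.
move=> s t t'; rewrite imapD; congr (_ + _).
move: t; apply: induced_ext => [x y|x y|s' x].
- by rewrite scalerDr imapD.
- by rewrite imapD scalerDr.
by rewrite -[_ *: ipure _ _]/(iact _ _) iactE !imapE -[RHS]/(iact _ _) iactE.
Qed.
HB.instance Definition _ := GRing.isLinear.Build S (induced X) (induced X') _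
  imap imap_linear.
End Morphism.
End Induction.

Section DeltaInduction.
Variables (k : fieldType) (A : falgType k) (H : hopf A).

Definition delta (a : A) : env A :=
  tlift (fun x y => epure x (antipode H y)) (comul H a).

Lemma delta_act a (c : k) :
  delta a *: (c%:A : bireg A) = ((counit H a * c)%:A : A).
Proof.
rewrite -[LHS]/(bireg_act (delta a) (c%:A : A)).
rewrite /delta (@tlift_morph _ _ _ _ _ _ _ _ (@bireg_act k A ^~ (c%:A : A))); last first.
  exact: bireg_actDl.
rewrite mulrC -[RHS]scalerA -(hopf_antipoder H).
rewrite (@tlift_morph _ _ _ _ _ _ _ _ (fun x : A => c *: x)); last by move=> x y; rewrite scalerDr.
apply: eq_tlift => x y; rewrite bireg_actE mulr_algr.
by rewrite scalerAl.
Qed.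

Variable P : aseq (trivmod H).
Let I n := induced delta (P n).

(* A^e (x)_delta(A) k = A, via s (x) 1 |-> s 1_A *)
Definition iaug (t : I 0) : bireg A :=
  tlift (fun s x => s *: ((aug P x : k)%:A : bireg A)) t.
Lemma iaug_bal : balanced (iact_r delta) (@iact_l A (P 0%N))
  (fun s x => s *: ((aug P x : k)%:A : bireg A)).
Proof.
split=> [s s' x|s x x'|s a x]; first by rewrite scalerDl.
  by rewrite augD -scalerDr; congr (_ *: _); apply: (@scalerDl k A 1).
rewrite /iact_r /iact_l -scalerA; congr (_ *: _).
by rewrite delta_act augZ.
Qed.
Lemma iaugD : {morph iaug : t t' / t + t'}.
Proof. by move=> t t'; rewrite /iaug tliftD //; exact: iaug_bal. Qed.
Lemma iaugE s x : iaug (ipure delta s x) = s *: ((aug P x : k)%:A : bireg A).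
Proof. by rewrite /iaug tlift_pure //; exact: iaug_bal. Qed.
Lemma iaug_linear : linear iaug.
Proof.
move=> s t t'; rewrite iaugD; congr (_ + _).
move: t; apply: induced_ext => [x y|x y|s' x].
- by rewrite scalerDr iaugD.
- by rewrite iaugD scalerDr.
by rewrite -[_ *: ipure _ _ _]/(iact _ _) iactE !iaugE scalerA.
Qed.
HB.instance Definition _ := GRing.isLinear.Build (env A) (I 0) (bireg A) _
  iaug iaug_linear.
Definition iseq : aseq (bireg A) :=
  @ASeq (env A) (bireg A) I (fun n => @imap _ _ delta _ _ (bd P n)) iaug.
End DeltaInduction.

(* X (x)_C M, for X a left C^e-module: 1 (x) c acts as c on the right of X *)
Section BimoduleTensor.
Variables (k : fieldType) (C : falgType k).

Section Object.
Variables (X : lmodType (env C)) (M : lmodType C).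
Definition bact_r (x : X) (c : C) : X := epure 1 c *: x.
Definition bact_l (c : C) (m : M) : M := c *: m.
Definition btens : Type := tensor bact_r bact_l.
HB.instance Definition _ := GRing.Zmodule.on btens.
Definition bpure (x : X) (m : M) : btens := pure bact_r bact_l x m.
Lemma bpureDl x x' m : bpure (x + x') m = bpure x m + bpure x' m.
Proof. exact: pureDl. Qed.
Lemma bpureDr x m m' : bpure x (m + m') = bpure x m + bpure x m'.
Proof. exact: pureDr. Qed.
Lemma bpureM x c m : bpure (epure 1 c *: x) m = bpure x (c *: m).
Proof. exact: (pureM bact_r bact_l). Qed.
Lemma btens_ext (Z : zmodType) (f g : btens -> Z) :
  {morph f : x y / x + y} -> {morph g : x y / x + y} ->
  (forall x m, f (bpure x m) = g (bpure x m)) -> f =1 g.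
Proof. exact: tens_ext. Qed.

Definition bact (c : C) (t : btens) : btens :=
  tlift (fun x m => bpure (epure c 1 *: x) m) t.
Lemma bact_bal c : balanced bact_r bact_l (fun x m => bpure (epure c 1 *: x) m).
Proof.
split=> [x x' m|x m m'|x d m]; rewrite ?scalerDr ?bpureDl ?bpureDr //.
by rewrite /bact_r /bact_l -bpureM !scalerA !epureM !mul1r !mulr1.
Qed.
Lemma bactE c x m : bact c (bpure x m) = bpure (epure c 1 *: x) m.
Proof. by rewrite /bact tlift_pure //; exact: bact_bal. Qed.
Lemma bactDr : right_distributive bact +%R.
Proof. by move=> c t t'; rewrite /bact tliftD //; exact: bact_bal. Qed.
Lemma bactDl t : {morph bact^~ t : c d / c + d}.
Proof.
move=> c d; rewrite /bact -tlift_fD; apply: eq_tlift => x m.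
by rewrite -bpureDl -scalerDl; congr (bpure (_ *: _) _); apply: apureDl.
Qed.
Lemma bactA c d t : bact c (bact d t) = bact (c * d) t.
Proof.
move: t; apply: btens_ext => [t t'|t t'|x m]; rewrite ?bactDr //.
by rewrite !bactE scalerA epureM mulr1.
Qed.
Lemma bact1 : left_id 1 bact.
Proof.
apply: btens_ext => [t t'|t t'|x m] //; first by rewrite bactDr.
by rewrite bactE scale1r.
Qed.
HB.instance Definition _ := GRing.Zmodule_isLmodule.Build C btens
  bactA bact1 bactDr bactDl.
End Object.

Section Morphism.
Variables (X X' : lmodType (env C)) (M : lmodType C) (f : {linear X -> X'}).
Definition bmap (t : btens X M) : btens X' M := tlift (fun x m => bpure (f x) m) t.
Lemma bmap_bal : balanced (@bact_r X) (@bact_l M) (fun x m => bpure (f x) m).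
Proof.
split=> [x x' m|x m m'|x c m]; rewrite ?linearD ?bpureDl ?bpureDr //.
by rewrite /bact_r linearZ /= bpureM.
Qed.
Lemma bmapD : {morph bmap : t t' / t + t'}.
Proof. by move=> t t'; rewrite /bmap tliftD //; exact: bmap_bal. Qed.
Lemma bmapE x m : bmap (bpure x m) = bpure (f x) m.
Proof. by rewrite /bmap tlift_pure //; exact: bmap_bal. Qed.
Lemma bmap_linear : linear bmap.
Proof.
move=> c t t'; rewrite bmapD; congr (_ + _).
move: t; apply: btens_ext => [x y|x y|x m].
- by rewrite scalerDr bmapD.
- by rewrite bmapD scalerDr.
by rewrite -[_ *: bpure _ _]/(bact _ _) bactE !bmapE linearZ -[RHS]/(bact _ _) bactE.
Qed.
HB.instance Definition _ := GRing.isLinear.Build C (btens X M) (btens X' M) _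
  bmap bmap_linear.
End Morphism.

(* P (x)_C M, augmented to C (x)_C M = M *)
Section Sequence.
Variables (P : aseq (bireg C)) (M : lmodType C).
Definition baug (t : btens (P 0%N) M) : M :=
  tlift (fun x m => (aug P x : C) *: m) t.
Lemma baugD0 x y : (aug P (x + y) : C) = (aug P x : C) + (aug P y : C).
Proof. exact: (linearD (aug P)). Qed.
Lemma baugZ0 a b x : (aug P (epure a b *: x) : C) = a * (aug P x : C) * b.
Proof. by rewrite linearZ; exact: bireg_actE. Qed.
Lemma baug_bal : balanced (@bact_r (P 0%N)) (@bact_l M)
  (fun x m => (aug P x : C) *: m).
Proof.
split=> [x x' m|x m m'|x c m]; rewrite ?scalerDr // ?baugD0 ?scalerDl //.
by rewrite /bact_r baugZ0 mul1r scalerA.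
Qed.
Lemma baugD : {morph baug : t t' / t + t'}.
Proof. by move=> t t'; rewrite /baug tliftD //; exact: baug_bal. Qed.
Lemma baugE x m : baug (bpure x m) = (aug P x : C) *: m.
Proof. by rewrite /baug tlift_pure //; exact: baug_bal. Qed.
Lemma baug_linear : linear baug.
Proof.
move=> c t t'; rewrite baugD; congr (_ + _).
move: t; apply: btens_ext => [x y|x y|x m].
- by rewrite scalerDr baugD.
- by rewrite baugD scalerDr.
by rewrite -[_ *: bpure _ _]/(bact _ _) bactE !baugE baugZ0 mulr1 scalerA.
Qed.
HB.instance Definition _ := GRing.isLinear.Build C (btens (P 0%N) M) M _
  baug baug_linear.
Definition bseq : aseq M :=
  @ASeq C M (fun n => btens (P n) M) (fun n => @bmap _ _ _ (bd P n)) baug.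
End Sequence.
End BimoduleTensor.

Local Open Scope classical_set_scope.

Section Block.
Variables (k : fieldType) (A : falgType k) (H : hopf A).

Definition two_sided (I : {vspace A}) : bool :=
  ({:A} * I <= I)%VS && (I * {:A} <= I)%VS.

Record principal_block := PrincipalBlock {
  block :> {aspace A};
  block_ideal : two_sided block;
  block_summand : exists C : {vspace A},
    [/\ two_sided C, (block + C = {:A})%VS & (block :&: C = 0)%VS];
  block_indecomposable : forall I J : {vspace A},
    two_sided I -> two_sided J -> (I + J = block)%VS -> (I :&: J = 0)%VS ->
    I = 0%VS \/ J = 0%VS;
  (* the unity of the block, algid block, acts as the identity on k *)
  block_principal : forall x : trivmod H, algid block *: x = x
}.

Variable B : principal_block.

Definition block_proj (a : A) : subvs_of B := vsproj B (a * algid B).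

Lemma block_projE a : vsval (block_proj a) = a * algid B.
Proof.
rewrite vsprojK //; have /andP[/subvP le _] := block_ideal B.
by apply: le; rewrite memv_mul ?memvf ?memv_algid.
Qed.
Lemma block_algidC a : algid B * a = a * algid B.
Proof.
have /andP[/subvP l /subvP r] := block_ideal B.
have Be := memv_algid B.
have e1 : a * algid B \in (B : {vspace A}) by apply: l; rewrite memv_mul ?memvf.
have e2 : algid B * a \in (B : {vspace A}) by apply: r; rewrite memv_mul ?memvf.
by rewrite -[LHS](algidr e2) -mulrA (algidl e1).
Qed.
Lemma block_projB : zmod_morphism block_proj.
Proof. by move=> a b; rewrite /block_proj mulrBl linearB. Qed.
Lemma block_projM : monoid_morphism block_proj.
Proof.
split=> [|a b]; apply: val_inj => /=; first by rewrite block_projE mul1r.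
rewrite !block_projE -!mulrA; congr (a * _).
by rewrite mulrA block_algidC -mulrA algidl // memv_algid.
Qed.
HB.instance Definition _ :=
  GRing.isZmodMorphism.Build A (subvs_of B) block_proj block_projB.
HB.instance Definition _ :=
  GRing.isMonoidMorphism.Build A (subvs_of B) block_proj block_projM.

Definition block_proj_env (t : env A) : env (subvs_of B) :=
  tlift (fun a b => epure (block_proj a) (block_proj b)) t.

Definition inflate (M : lmodType (subvs_of B)) : lmodType A := restr block_proj M.

End Block.

(* Subalgebras and their ideals are subsets of an ambient k-algebra E with
   structure map sc. *)
Section Spectrum.
Variables (k : fieldType) (E : pzRingType) (sc : k -> E).
Implicit Types S I J m G : set E.

Definition is_subalg S : Prop :=
  [/\ forall c, S (sc c), forall x y, S x -> S y -> S (x + y) &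
      forall x y, S x -> S y -> S (x * y)].
Definition gen_subalg G : set E := smallest is_subalg G.
Definition fg_subalg S : Prop :=
  exists2 s : seq E, (forall x, x \in s -> S x) &
    S `<=` gen_subalg [set x | x \in s].

Definition is_ideal S I : Prop :=
  [/\ I `<=` S, I 0, forall x y, I x -> I y -> I (x + y) &
      forall s x, S s -> I x -> I (s * x) /\ I (x * s)].
Definition gen_ideal S G : set E := smallest (is_ideal S) G.
Definition is_maximal S m : Prop :=
  [/\ is_ideal S m, ~ m 1 &
      forall J, is_ideal S J -> m `<=` J -> ~ J 1 -> J = m].
(* S is commutative wherever this is used *)
Definition jacobson S : set E :=
  [set x | S x /\ forall m, is_maximal S m -> m x].

(* An affine variety: a set of points with its regular functions to k. *)
Record variety := Variety {
  point : Type;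
  regular : (point -> k) -> Prop
}.
Definition var_iso (V W : variety) : Prop :=
  exists2 phi : point V -> point W, bijective phi &
    forall g : point W -> k, regular g <-> regular (g \o phi).

(* The maximal ideal spectrum of S/I, I generated by G: its points are written
   as the maximal ideals m of S containing G.  As S/m = k for S finitely
   generated, s in S defines the function m |-> the c in k with s - c in m. *)
Definition spec_point S G : Type := {m : set E | is_maximal S m /\ G `<=` m}.
Definition spec S G : variety :=
  @Variety (spec_point S G)
    (fun g => exists2 s, S s & forall m : spec_point S G, sval m (s - sc (g m))).
End Spectrum.

Section ExtAlgebra.
Variables (k : fieldType) (R : algType k) (Y : lmodType R) (P : aseq Y).

Definition ext_sc (c : k) : Ext P P := c *: (1 : Ext P P).

Definition ext_homog (n : nat) : set (Ext P P) :=
  [set e | exists2 f, ext_cls f = e &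
           forall j i x, j != (i + n)%N -> cm f j i x = 0].
Definition ext_even : set (Ext P P) :=
  [set e | exists2 f, ext_cls f = e &
           forall j i x, odd (j - i) -> cm f j i x = 0].
End ExtAlgebra.
Arguments ext_sc {k R Y} P c.
Arguments ext_homog {k R Y} P n.
Arguments ext_even {k R Y} P.

Lemma cm_linear (R : pzRingType) (Y Z : lmodType R) (P : aseq Y) (Q : aseq Z)
  (f : chain_map P Q) j i : linear (cm f j i).
Proof. exact: cm_lin. Qed.
HB.instance Definition _ (R : pzRingType) (Y Z : lmodType R) (P : aseq Y)
  (Q : aseq Z) (f : chain_map P Q) j i :=
  GRing.isLinear.Build R (P j) (Q i) _ (cm f j i) (@cm_linear R Y Z P Q f j i).

Section Varieties.
Variables (k : fieldType) (A : falgType k) (H : hopf A).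

Section Cohomology.
(* P is a projective resolution of k, so that Ext P P is H^*(A, k) *)
Variable P : aseq (trivmod H).

Definition Hev : set (Ext P P) :=
  [set e | 2%N \in [pchar k] \/ ext_even P e].

(* eta |-> eta (x)_k M.  Here, as for the other maps between Ext algebras below,
   the comparison theorem says that exactly one class satisfies the condition,
   so the default value of xget is never used. *)
Definition tens_k (M : lmodType A) (Q : aseq M) (eta : Ext P P) : Ext Q Q :=
  xget 0 [set e | @lies_over A A idfun M M Q (kseq P M) id (ext_rep e)
                    (fun j i => kmap (ext_rep eta j i))].

(* H^ev(A, k) acts by Yoneda composition with eta (x)_k M. *)
Definition ann_A (M : lmodType A) (Q : aseq M) : set (Ext P P) :=
  [set eta | Hev eta /\ forall e : Ext Q Q, e * tens_k Q eta = 0].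

Definition V_A (M : lmodType A) (Q : aseq M) : variety k :=
  spec (ext_sc P) Hev (ann_A Q).

Definition fg_condition : Prop :=
  fg_subalg (ext_sc P) Hev /\
  forall (M N : lmodType A) (Q : aseq M) (T : aseq N),
    fin_dim M -> fin_dim N -> proj_resolution Q -> proj_resolution T ->
    exists s : seq (Ext Q T), forall e : Ext Q T,
      exists2 c : nat -> Ext P P, (forall i, Hev (c i)) &
        e = \sum_(i < size s) ext_comp s`_i (tens_k Q (c i)).
End Cohomology.
Arguments Hev P : clear implicits.
Arguments tens_k P {M} Q eta.
Arguments ann_A P {M} Q.
Arguments V_A P {M} Q.
Arguments fg_condition P : clear implicits.

Section Hochschild.
(* P, PA and PB are projective resolutions of k over A, of A over A^e and of B
   over B^e *)
Variables (P : aseq (trivmod H)) (PA : aseq (bireg A)).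
Variables (B : principal_block H) (PB : aseq (bireg (subvs_of B))).

(* induced by A^e (x)_delta(A) - *)
Definition HH_emb (eta : Ext P P) : Ext PA PA :=
  xget 0 [set e | @lies_over _ _ idfun _ _ PA (iseq P) id (ext_rep e)
                    (fun j i => imap (ext_rep eta j i))].

(* The projection onto the direct factor Ext_{B^e}(B, B): e and z have the same
   image in Ext_{A^e}(A, B) = Ext_{B^e}(B, B) along PA -> PB over A -> B. *)
Definition HH_proj (e : Ext PA PA) : Ext PB PB :=
  xget 0 [set z | @lies_over _ _ (block_proj_env B) _ _ PA PB (block_proj B)
                    (ext_rep e) (ext_rep z)].

(* zeta |-> zeta (x)_B M *)
Definition tens_B (M : lmodType (subvs_of B)) (Q : aseq M) (zeta : Ext PB PB) :
    Ext Q Q :=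
  xget 0 [set e | @lies_over _ _ idfun _ _ Q (bseq PB M) id (ext_rep e)
                    (fun j i => bmap (ext_rep zeta j i))].

(* The subalgebra generated by HH^0(B) and the image of H^ev(A, k). *)
Definition Hsub : set (Ext PB PB) :=
  gen_subalg (ext_sc PB)
    (ext_homog PB 0 `|` [set HH_proj (HH_emb eta) | eta in Hev P]).

Definition Hsub0 : set (Ext PB PB) := Hsub `&` ext_homog PB 0.

Definition N_H : set (Ext PB PB) :=
  gen_ideal Hsub
    ([set e | [/\ Hsub e, (exists n, ext_homog PB n e) & exists m, e ^+ m = 0]]
     `|` jacobson Hsub0).

Definition ann_H (M : lmodType (subvs_of B)) (Q : aseq M) : set (Ext PB PB) :=
  [set zeta | Hsub zeta /\ forall e : Ext Q Q, e * tens_B Q zeta = 0].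

(* The maximal ideals of H/N_H whose inverse image in H contains ann_H. *)
Definition V_H (M : lmodType (subvs_of B)) (Q : aseq M) : variety k :=
  spec (ext_sc PB) Hsub (N_H `|` ann_H Q).
End Hochschild.
End Varieties.

Arguments Hev {k A H} P.
Arguments tens_k {k A H} P {M} Q eta.
Arguments ann_A {k A H} P {M} Q.
Arguments V_A {k A H} P {M} Q.
Arguments fg_condition {k A H} P.
Arguments HH_emb {k A H} P PA eta.
Arguments HH_proj {k A H} PA {B} PB e.
Arguments tens_B {k A H B} PB {M} Q zeta.
Arguments Hsub {k A H} P PA {B} PB.
Arguments Hsub0 {k A H} P PA {B} PB.
Arguments N_H {k A H} P PA {B} PB.
Arguments ann_H {k A H} P PA {B} PB {M} Q.
Arguments V_H {k A H} P PA {B} PB {M} Q.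

(* Main.v *)
From HB Require Import structures.
From mathcomp Require Import all_boot all_algebra falgebra.
From mathcomp Require Import boolp classical_sets.
Require Import Defs.

(** Let Phi : H^ev(A,k) -> HH(A) -> HH(B0) be the embedding. The center HH^0(B0) is
    local with residue field k and is central in HH(B0), and H^ev(A,k) is commutative;
    hence H = Phi(H^ev) + N_H with N_H nil. Moreover Phi(eta) (x)_B0 M = 0 iff
    eta (x)_k M = 0, i.e. ann_A is the inverse image of ann_H. So m |-> Phi^-1(m) is a
    bijection from the maximal ideals containing N_H and ann_H to those containing
    ann_A, with inverse n |-> Phi(n) + N_H + ann_H, and it matches regular functions.

    Classes in Ext are handled through their cocycles: chain maps into an exact
    complex are homotopic iff their augmented degree 0 components differ by a
    coboundary. Passing between A and its block uses lifts along the non-unital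
    inclusion of B0 in A. *)

Set Implicit Arguments.
Unset Strict Implicit.
Unset Printing Implicit Defensive.

Import GRing.Theory.
Local Open Scope ring_scope.

(** * Semilinear maps and comparison of resolutions *)

(** The maps between Ext algebras are specified only by a condition up to homotopy along some lift.
    Each is therefore treated as a relation between chain maps, shown to be single valued and
    compatible with the operations. All lifts and homotopies come from one recursion,
    [solve_homotopy], set up for inhomogeneous families and for ring maps that need not preserve 1.
    Exactness of P (x)_k M and of PB (x)_B M comes from contractions linear over a smaller ring (k,
    or B acting on the right), since these survive the tensor product. For A^e (x)_delta(A) P,
    flatness of A^e over delta(A) is replaced by the Hopf isomorphism A^e (x)_delta(A) X = X (x)_k
    A. Tensored with M over A, the same isomorphism turns A^e (x)_delta(A) P into P (x)_k M; this is
    why H^ev(A, k) acts on M in the same way through Hochschild cohomology as through - (x)_k M.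
    Commutativity of H^ev(A, k) comes from a diagonal P -> P (x)_k P: a cocycle can be applied to
    either factor, and contracting both factors gives the same result in either order. *)

Section Semilinear.
Variables (R S : pzRingType) (theta : R -> S).

(** No condition at 1: the inclusion of the block into A sends 1 to a central idempotent. For such
    maps [semilin] does not imply additivity, so [slin] asks for it separately. *)
Definition rng_morph := {morph theta : x y / x + y} /\ {morph theta : x y / x * y}.

Definition slin (U : lmodType R) (V : lmodType S) (f : U -> V) : Prop :=
  {morph f : x y / x + y} /\ forall r x, f (r *: x) = theta r *: f x.

Section Theory.
Variables (U : lmodType R) (V : lmodType S).
Implicit Types f g : U -> V.

Lemma slinD f x y : slin f -> f (x + y) = f x + f y. Proof. by case. Qed.
Lemma slinZ f r x : slin f -> f (r *: x) = theta r *: f x. Proof. by case. Qed.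
Lemma slin0 f : slin f -> f 0 = 0.
Proof. by move=> L; apply: (addrI (f 0)); rewrite -slinD // !addr0. Qed.
Lemma slinN f x : slin f -> f (- x) = - f x.
Proof. by move=> L; apply: (addrI (f x)); rewrite -slinD // !subrr slin0. Qed.
Lemma slinB f x y : slin f -> f (x - y) = f x - f y.
Proof. by move=> L; rewrite slinD // slinN. Qed.
Lemma slin_sum f I r (P : pred I) F : slin f ->
  f (\sum_(i <- r | P i) F i) = \sum_(i <- r | P i) f (F i).
Proof. by move=> L; apply: (big_morph f (fun x y => slinD x y L) (slin0 L)). Qed.

Lemma slin_zero : slin (fun _ : U => 0 : V).
Proof. by split=> [x y|r x]; rewrite ?addr0 ?scaler0. Qed.
Lemma slin_add f g : slin f -> slin g -> slin (fun x => f x + g x).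
Proof.
move=> [fD fZ] [gD gZ]; split=> [x y|r x]; first by rewrite fD gD addrACA.
by rewrite fZ gZ scalerDr.
Qed.
Lemma slin_opp f : slin f -> slin (fun x => - f x).
Proof.
by move=> [fD fZ]; split=> [x y|r x]; rewrite ?fD ?opprD // fZ scalerN.
Qed.
Lemma slin_sub f g : slin f -> slin g -> slin (fun x => f x - g x).
Proof. by move=> F G; apply: slin_add F (slin_opp G). Qed.
Lemma slin_bigsum I (r : seq I) (F : I -> U -> V) :
  (forall i, slin (F i)) -> slin (fun x => \sum_(i <- r) F i x).
Proof.
move=> L; split=> [x y|a x].
  by rewrite -big_split; apply: eq_bigr => i _; case: (L i).
by rewrite scaler_sumr; apply: eq_bigr => i _; case: (L i).
Qed.
End Theory.

Section Pullback.
Variables (P : lmodType R) (U V : lmodType S) (f : P -> V) (g : {linear U -> V}).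
Variables (th : rng_morph) (Lf : slin f).

(** The second condition cuts U down to the part on which [theta 1] acts as the identity; without it
    R would not act unitally on the pullback. *)
Definition pullback_pred : pred (P * U) :=
  fun p => `[< f p.1 = g p.2 /\ theta 1 *: p.2 = p.2 >].

Lemma pullback_closed : GRing.zmod_closed pullback_pred.
Proof.
split; first by apply/asboolP; rewrite /= linear0 slin0 // scaler0.
move=> p q /asboolP[p1 p2] /asboolP[q1 q2]; apply/asboolP => /=.
by rewrite slinB // linearB /= p1 q1 scalerBr p2 q2.
Qed.
HB.instance Definition _ := GRing.isZmodClosed.Build _ pullback_pred pullback_closed.

(** The [let]s keep [th] and [Lf] as parameters of the type, since its module structure depends on
    both. *)
Definition pullback : Type := let _ := th in let _ := Lf in {p : P * U | pullback_pred p}.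
HB.instance Definition _ := SubType.copy pullback {p : P * U | pullback_pred p}.
HB.instance Definition _ := [Choice of pullback by <:].
HB.instance Definition _ := [SubChoice_isSubZmodule of pullback by <:].

Lemma pullback_act_subproof r (p : pullback) :
  pullback_pred (r *: (val p).1, theta r *: (val p).2).
Proof.
have /asboolP[p1 p2] := valP p; have [_ tM] := th.
by apply/asboolP; rewrite /= slinZ // p1 linearZ /= scalerA -tM mul1r.
Qed.
Definition pullback_act r (p : pullback) : pullback := Sub _ (pullback_act_subproof r p).

Lemma pullback_actA a b p : pullback_act a (pullback_act b p) = pullback_act (a * b) p.
Proof. by have [_ tM] := th; apply: val_inj => /=; rewrite !scalerA tM. Qed.
Lemma pullback_act1 : left_id 1 pullback_act.
Proof.
move=> p; apply: val_inj => /=; have /asboolP[_ ->] := valP p.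
by rewrite scale1r -surjective_pairing.
Qed.
Lemma pullback_actDr : right_distributive pullback_act +%R.
Proof. by move=> a x y; apply: val_inj => /=; rewrite !scalerDr. Qed.
Lemma pullback_actDl p : {morph pullback_act^~ p : a b / a + b}.
Proof. by have [tD _] := th; move=> a b; apply: val_inj => /=; rewrite tD !scalerDl. Qed.
HB.instance Definition _ := GRing.Zmodule_isLmodule.Build R pullback
  pullback_actA pullback_act1 pullback_actDr pullback_actDl.

Definition pullback_fst (p : pullback) : P := (val p).1.
Lemma pullback_fst_linear : linear pullback_fst. Proof. by []. Qed.
HB.instance Definition _ := GRing.isLinear.Build R pullback P _ pullback_fst
  pullback_fst_linear.
End Pullback.

(* [theta] need not preserve 1. *)
Lemma projective_slin (P : lmodType R) (U V : lmodType S) (f : P -> V)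
    (g : {linear U -> V}) :
  rng_morph -> projective P -> slin f -> (forall x, exists u, g u = f x) ->
  exists2 h : P -> U, slin h & forall x, g (h x) = f x.
Proof.
move=> th Pp Lf surj; have [tD tM] := th.
pose W := pullback g th Lf.
have [|h hK] := @Pp W P (@pullback_fst _ _ _ f g th Lf) idfun.
  move=> x; have [u gu] := surj x.
  (* The preimage u is moved into the corner. Its image is still f(x), because f(x) = f(1 x) =
     theta(1) f(x). *)
  have Q : pullback_pred f g (x, theta 1 *: u).
    apply/asboolP; split=> /=; last by rewrite scalerA -tM mul1r.
    by rewrite linearZ /= gu -slinZ // scale1r.
  by exists (Sub _ Q).
exists (fun x => (val (h x)).2) => [|x].
  by split=> [x y|r x]; rewrite ?linearD ?linearZ.
by have /asboolP[<- _] := valP (h x); congr f; apply: hK.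
Qed.

(** Choosing the zero solution whenever possible makes vanishing propagate through the recursion
    below; the degree and boundedness conditions on chain maps and homotopies come from this. *)
Lemma projective_slin0 (P : lmodType R) (U V : lmodType S) (f : P -> V)
    (g : {linear U -> V}) :
  rng_morph -> projective P -> slin f -> (forall x, exists u, g u = f x) ->
  exists h : P -> U, [/\ slin h, forall x, g (h x) = f x &
    (forall x, f x = 0) -> forall x, h x = 0].
Proof.
move=> th Pp Lf surj; have [f0|Nf0] := pselect (forall x, f x = 0).
  by exists (fun=> 0); split=> // [|x]; [exact: slin_zero | rewrite linear0 f0].
by have [h] := projective_slin th Pp Lf surj; exists h.
Qed.
End Semilinear.

Lemma slin_comp (R S T : pzRingType) (th1 : R -> S) (th2 : S -> T)
  (U : lmodType R) (V : lmodType S) (W : lmodType T) (f : V -> W) (g : U -> V) :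
  slin th2 f -> slin th1 g -> slin (th2 \o th1) (f \o g).
Proof.
by move=> [fD fZ] [gD gZ]; split=> [x y|r x] /=; rewrite ?gD ?fD // gZ fZ.
Qed.

Lemma linear_slin (R : pzRingType) (U V : lmodType R) (f : {linear U -> V}) :
  slin idfun f.
Proof. by split=> [x y|r x]; rewrite ?linearD ?linearZ. Qed.

Lemma slin_semilin (R S : pzRingType) (theta : R -> S) (U : lmodType R)
  (V : lmodType S) (f : U -> V) : slin theta f -> semilin theta f.
Proof. by move=> [D Z] r x y; rewrite D Z. Qed.

Lemma semilin_slin (R S : pzRingType) (theta : R -> S) (U : lmodType R)
  (V : lmodType S) (f : U -> V) : theta 1 = 1 -> semilin theta f -> slin theta f.
Proof.
move=> t1 L; have D x y : f (x + y) = f x + f y.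
  by rewrite -[x]scale1r L t1 !scale1r.
split=> // r x; have f0 : f 0 = 0 by apply: (addrI (f 0)); rewrite -D !addr0.
by rewrite -[r *: x]addr0 L f0 addr0.
Qed.

(** Comparison needs projectivity only at the source; the targets P (x)_k M, P (x)_C M and A^e
    (x)_delta(A) P are only shown to be exact. *)
Definition exact_resolution (R : pzRingType) (Y : lmodType R) (C : aseq Y) : Prop :=
  [/\ forall y, exists x, aug C x = y,
      forall x, aug C x = 0 <-> exists y, bd C 0 y = x &
      forall n x, bd C n x = 0 <-> exists y, bd C n.+1 y = x].

Lemma proj_resolution_exact (R : pzRingType) (Y : lmodType R) (P : aseq Y) :
  proj_resolution P -> exact_resolution P.
Proof. by case. Qed.

Section Exact.
Variables (R : pzRingType) (Y : lmodType R) (C : aseq Y).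
Hypothesis Ce : exact_resolution C.
Lemma aug_bd x : aug C (bd C 0 x) = 0.
Proof. by have [_ E _] := Ce; apply/E; exists x. Qed.
Lemma bd_bd n x : bd C n (bd C n.+1 x) = 0.
Proof. by have [_ _ E] := Ce; apply/E; exists x. Qed.
End Exact.

(** * The homotopy equation and its recursive solution *)

Section Solve.
Variables (R S : pzRingType) (theta : R -> S) (th : rng_morph theta).
Variables (Y : lmodType R) (Z : lmodType S) (Q : aseq Y) (C : aseq Z).
Hypotheses (Qp : forall n, projective (Q n)).
Hypothesis (Qd : forall n x, bd Q n (bd Q n.+1 x) = 0).
Hypothesis (Ce : exact_resolution C).
Variables (w : family Q C) (g : forall j, Q j -> Z).
Arguments w : clear implicits.
Arguments g : clear implicits.
Hypotheses (Lw : forall j i, slin theta (w j i)).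
Hypothesis (w0 : forall i x, w 0%N i.+1 x = 0).
Hypothesis (wd : forall j i x, bd C i (w j.+1 i.+1 x) = w j i (bd Q j x)).
Hypotheses (Lg : forall j, slin theta (g j)) (g0 : forall x, aug C (w 0%N 0%N x) = 0).
Hypothesis (gd : forall j x, aug C (w j.+1 0%N x) = g j (bd Q j x)).

(** Column i+1 has to satisfy d H' = [res i H]; [good] says that this can be solved, and [next] that
    it has been, with the zero solution wherever the right-hand side vanishes. *)
Let res i (H : forall j, Q j -> C i) j : Q j -> C i :=
  match j with
  | 0%N => w 0%N i
  | j'.+1 => fun x => w j'.+1 i x - H j' (bd Q j' x)
  end.
Arguments res : clear implicits.
Let good i (H : forall j, Q j -> C i) :=
  (forall j, slin theta (H j)) /\ forall j x, exists y, bd C i y = res i H j x.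
Let next i (H : forall j, Q j -> C i) (H' : forall j, Q j -> C i.+1) :=
  forall j, (forall x, bd C i (H' j x) = res i H j x) /\
            ((forall x, res i H j x = 0) -> forall x, H' j x = 0).

Let slin_bdr j i (f : Q j -> C i) : slin theta f -> slin theta (fun x => f (bd Q j x)).
Proof. by move=> L; apply: (slin_comp L (linear_slin (bd Q j))). Qed.

Let res_slin i H j : good H -> slin theta (res i H j).
Proof.
case=> L _; case: j => [|j]; first exact: Lw.
by apply: slin_sub (Lw _ _) _; apply: slin_bdr.
Qed.

Let step i H : good H -> exists H' : forall j, Q j -> C i.+1, good H' /\ next H H'.
Proof.
move=> G; have /= E j := projective_slin0 th (@Qp j) (res_slin j G) (G.2 j).
exists (fun j => sval (boolp.cid (E j))); split; last first.
  by move=> j; have [_ ? ?] := svalP (boolp.cid (E j)).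
split=> [j|]; first by have [] := svalP (boolp.cid (E j)).
(* By exactness it is enough that d kills the next residue, which follows from d w = w d and from d
   d = 0 in Q. *)
have [_ _ Ex] := Ce; move=> [|j] x; apply/Ex.
  by rewrite /= w0 linear0.
have [_ D _] := svalP (boolp.cid (E j)); rewrite /= linearB /= wd D.
case: j {D} x => [|j] x /=; first by rewrite subrr.
by rewrite Qd (slin0 (G.1 j)) subr0 subrr.
Qed.

Let start : exists H : forall j, Q j -> C 0%N,
  good H /\ forall j, (forall x, aug C (H j x) = g j x) /\
                      ((forall x, g j x = 0) -> forall x, H j x = 0).
Proof.
have [Es E0 _] := Ce.
have /= E j := projective_slin0 th (@Qp j) (Lg j) (fun x => Es (g j x)).
exists (fun j => sval (boolp.cid (E j))); split; last first.
  by move=> j; have [_ ? ?] := svalP (boolp.cid (E j)).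
split=> [j|]; first by have [] := svalP (boolp.cid (E j)).
move=> [|j] x; apply/E0; first exact: g0.
have [_ D _] := svalP (boolp.cid (E j)).
by rewrite /= linearB /= gd D subrr.
Qed.

(** All j are treated at once and the recursion runs over i; solvability is carried along because
    the next column is chosen from it. *)
Let Hseq : forall i, {H : forall j, Q j -> C i | good H} :=
  fix F i := match i with
  | 0%N => exist _ _ (proj1 (svalP (boolp.cid start)))
  | i'.+1 => exist _ _ (proj1 (svalP (boolp.cid (step (svalP (F i'))))))
  end.

Let Hseq_next i : next (sval (Hseq i)) (sval (Hseq i.+1)).
Proof. exact: proj2 (svalP (boolp.cid (step (svalP (Hseq i))))). Qed.

(** Three uses: w = u - v gives a homotopy between chain families, w = 0 lifts a cocycle g to a
    chain family, and the difference of two lifts gives their homotopy. The clauses on zero provide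
    the degree bounds. *)
Lemma solve_homotopy : exists H : family Q C,
  [/\ forall j i, slin theta (H j i),
      forall j, (forall x, aug C (H j 0%N x) = g j x) /\
                ((forall x, g j x = 0) -> forall x, H j 0%N x = 0),
      forall i, (forall x, bd C i (H 0%N i.+1 x) = w 0%N i x) /\
                ((forall x, w 0%N i x = 0) -> forall x, H 0%N i.+1 x = 0) &
      forall j i,
        (forall x, bd C i (H j.+1 i.+1 x) = w j.+1 i x - H j i (bd Q j x)) /\
        ((forall x, w j.+1 i x - H j i (bd Q j x) = 0) ->
         forall x, H j.+1 i.+1 x = 0)].
Proof.
exists (fun j i => sval (Hseq i) j); split=> [j i|j|i|j i].
- by have [] := svalP (Hseq i).
- exact: proj2 (svalP (boolp.cid start)) j.
- exact: Hseq_next i 0%N.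
- exact: Hseq_next i j.+1.
Qed.
End Solve.

(* Chain maps without the boundedness of [chain_map], along a map of rings. *)
Definition chain_family (R S : pzRingType) (theta : R -> S) (Y : lmodType R)
    (Z : lmodType S) (Q : aseq Y) (C : aseq Z) (u : family Q C) : Prop :=
  [/\ forall j i, slin theta (u j i),
      forall j i x, (j < i)%N -> u j i x = 0 &
      forall j i x, bd C i (u j.+1 i.+1 x) = u j i (bd Q j x)].

Lemma chain_map_family (R : pzRingType) (Y Z : lmodType R) (P : aseq Y)
  (Q : aseq Z) (f : chain_map P Q) : chain_family idfun f.
Proof.
split=> [j i|j i x|j i x]; [|exact: cm_deg|exact: cm_bd].
by apply: semilin_slin (cm_lin f j i).
Qed.

Definition cochain (R S : pzRingType) (Y : lmodType R) (Q : aseq Y) (Z : lmodType S) :=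
  forall j, Q j -> Z.

Section Cochains.
Variables (R S : pzRingType) (theta : R -> S).
Variables (Y : lmodType R) (Z : lmodType S) (Q : aseq Y).
Implicit Types c : cochain Q Z.

Definition cocycle c : Prop :=
  (forall j, slin theta (c j)) /\ forall j x, c j (bd Q j x) = 0.

Definition cohomologous c c' : Prop :=
  exists g : cochain Q Z, [/\ forall j, slin theta (g j),
    forall x, c 0%N x = c' 0%N x &
    forall j x, c j.+1 x - c' j.+1 x = g j (bd Q j x)].

Lemma cohomologous_eq c c' : (forall j x, c j x = c' j x) -> cohomologous c c'.
Proof.
move=> E; exists (fun j _ => 0); split=> // [j|j x]; first exact: slin_zero.
by rewrite E subrr.
Qed.
Lemma cohomologous_sym c c' : cohomologous c c' -> cohomologous c' c.
Proof.
case=> g [Lg g0 gd]; exists (fun j x => - g j x); split=> // [j|j x].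
  exact: slin_opp.
by rewrite -opprB gd.
Qed.
Lemma cohomologous_trans c' c c'' :
  cohomologous c c' -> cohomologous c' c'' -> cohomologous c c''.
Proof.
case=> g [Lg g0 gd] [h [Lh h0 hd]].
exists (fun j x => g j x + h j x); split=> [j|x|j x]; first exact: slin_add.
  by rewrite g0 h0.
by rewrite -gd -hd addrA subrK.
Qed.
Lemma cohomologousD c c' d d' : cohomologous c c' -> cohomologous d d' ->
  cohomologous (fun j x => c j x + d j x) (fun j x => c' j x + d' j x).
Proof.
case=> g [Lg g0 gd] [h [Lh h0 hd]].
exists (fun j x => g j x + h j x); split=> [j|x|j x]; first exact: slin_add.
  by rewrite g0 h0.
by rewrite -gd -hd opprD addrACA.
Qed.
End Cochains.

Lemma cohomologous_post (R S S' : pzRingType) (theta : R -> S) (th' : S -> S')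
    (Y : lmodType R) (Z : lmodType S) (Z' : lmodType S') (Q : aseq Y)
    (c c' : cochain Q Z) (p : Z -> Z') : slin th' p -> cohomologous theta c c' ->
  cohomologous (th' \o theta) (fun j x => p (c j x)) (fun j x => p (c' j x)).
Proof.
move=> Lp [g [Lg g0 gd]]; exists (fun j => p \o g j); split=> [j|x|j x] /=.
- exact: slin_comp.
- by rewrite g0.
- by rewrite -(slinB _ _ Lp) gd.
Qed.

(* Along a projective resolution Q, a chain family to an exact C is determined up
   to homotopy by the class of this cocycle. *)
Definition bdc (R S : pzRingType) (Y : lmodType R) (Z : lmodType S)
  (Q : aseq Y) (C : aseq Z) (u : family Q C) : cochain Q Z :=
  fun j x => aug C (u j 0%N x).
Arguments bdc {R S Y Z Q C} u j x.

Section Classify.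
Variables (R S : pzRingType) (theta : R -> S) (th : rng_morph theta).
Variables (Y : lmodType R) (Z : lmodType S) (Q : aseq Y) (C : aseq Z).
Hypotheses (Qr : proj_resolution Q) (Ce : exact_resolution C).
Let Qe := proj_resolution_exact Qr.
Let Qp : forall n, projective (Q n). Proof. by case: Qr. Qed.
Local Notation coh := (cohomologous theta).

Lemma bdc_cocycle (u : family Q C) : chain_family theta u -> cocycle theta (bdc u).
Proof.
case=> Lu u0 ud; split=> [j|j x].
  exact: (slin_comp (linear_slin (aug C)) (Lu j 0%N)).
by rewrite /bdc -ud (aug_bd Ce).
Qed.

Lemma homotopic_cohomologous (u v : family Q C) :
  theta 1 = 1 -> homotopic theta u v -> coh (bdc u) (bdc v).
Proof.
move=> t1 [h [Lh' _ h0 hd]]; have Lh j i := semilin_slin t1 (Lh' j i).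
exists (fun j x => aug C (h j 0%N x)); split=> [j|x|j x].
- exact: (slin_comp (linear_slin (aug C)) (Lh j 0%N)).
- by apply/eqP; rewrite -subr_eq0 -linearB h0 (aug_bd Ce).
- by rewrite -linearB hd linearD (aug_bd Ce) add0r.
Qed.

Lemma cohomologous_homotopic (u v : family Q C) :
  chain_family theta u -> chain_family theta v -> coh (bdc u) (bdc v) ->
  homotopic theta u v.
Proof.
case=> [Lu u0 ud] [Lv v0 vd] [g [Lg g0 gd]].
have [|||j|x|j x|H [LH _ H0 H1]] := @solve_homotopy _ _ _ th _ _ _ _ Qp (bd_bd Qe) Ce
  (fun j i x => u j i x - v j i x) g.
- by move=> j i; apply: slin_sub.
- by move=> i x; rewrite u0 // v0 // subrr.
- by move=> j i x; rewrite linearB /= ud vd.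
- exact: Lg.
- by rewrite linearB; apply/eqP; rewrite subr_eq0; apply/eqP/g0.
- by rewrite linearB; apply: gd.
exists H; split=> [j i|j i|i x|j i x].
- exact: slin_semilin.
(* The components of degree below -1 vanish by induction along the diagonal, since each right-hand
   side is zero there. *)
- elim: i j => // -[|i] IH [|j] x lt //.
  + by apply: (H0 _).2 => y; rewrite u0 // v0 // subrr.
  + apply: (H1 _ _).2 => y; rewrite u0 ?v0 ?IH ?subrr //.
- by rewrite (H0 i).1.
- by rewrite (H1 _ _).1 subrK.
Qed.

(** For w = 0 the solution satisfies d H = - H d; the factor (-1)^i on the component into C_i turns
    this into a chain family. *)
Lemma lift_cocycle (c : cochain Q Z) : cocycle theta c ->
  exists u : family Q C, [/\ chain_family theta u, forall j x, bdc u j x = c j x &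
    forall N, (forall j x, (N < j)%N -> c j x = 0) ->
      forall j i x, (i + N < j)%N -> u j i x = 0].
Proof.
case=> Lc cd.
have [||||||H [LH Ha H0 H1]] := @solve_homotopy _ _ _ th _ _ _ _ Qp (bd_bd Qe) Ce
  (fun j i x => 0) c.
- by move=> *; apply: slin_zero.
- by [].
- by move=> *; rewrite linear0.
- exact: Lc.
- by move=> *; rewrite linear0.
- by move=> j x; rewrite linear0 cd.
have H00 i x : H 0%N i.+1 x = 0 by apply: (H0 i).2.
have Hz i j : (forall x, H j i x = 0) -> forall x, H j.+1 i.+1 x = 0.
  by move=> E; apply: (H1 j i).2 => x; rewrite E subrr.
pose sg i := ((-1) ^+ i : S).
have sgD i x : bd C i (sg i.+1 *: x) = - (sg i *: bd C i x).
  by rewrite /sg exprS mulN1r scaleNr linearN linearZ.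
have sgC r i : r * sg i = sg i * r.
  by rewrite /sg; elim: i => [|i IH]; rewrite ?mul1r ?mulr1 // exprS mulN1r mulrN IH mulNr.
exists (fun j i x => sg i *: H j i x); split; last 1 first.
- move=> N cN j i x; elim: i j x => [|i IH] [|j] x //; rewrite ?addSn ?ltnS => lt.
    by rewrite (Ha _).2 ?scaler0 // => y; apply: cN.
  rewrite Hz ?scaler0 // => y.
  (* (-1)^i is its own inverse, so the inductive statement on the signed component gives
     [H j i y = 0]. *)
  have := congr1 (fun z => sg i *: z) (IH j y lt).
  by rewrite scalerA -exprD addnn -mul2n exprM sqrrN expr1n expr1n scale1r scaler0.
- split=> [j i|j i x|j i x].
  + split=> [x y|r x]; first by rewrite (slinD _ _ (LH _ _)) scalerDr.
    by rewrite (slinZ _ _ (LH _ _)) !scalerA sgC.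
  + elim: i j x => [|i IH] [|j] x // lt; first by rewrite H00 scaler0.
    rewrite Hz ?scaler0 // => y.
    have := congr1 (fun z => sg i *: z) (IH j y lt).
    by rewrite scalerA -exprD addnn -mul2n exprM sqrrN expr1n expr1n scale1r scaler0.
  + by rewrite sgD (H1 _ _).1 sub0r scalerN opprK.
- by move=> j x; rewrite /bdc /sg scale1r (Ha j).1.
Qed.

End Classify.

Definition chain_lift (R S : pzRingType) (theta : R -> S) (Y : lmodType R)
    (Z : lmodType S) (Q : aseq Y) (C : aseq Z) (p : Y -> Z)
    (phi : forall n, Q n -> C n) : Prop :=
  [/\ forall n, slin theta (phi n),
      forall x, aug C (phi 0%N x) = p (aug Q x) &
      forall n x, bd C n (phi n.+1 x) = phi n (bd Q n x)].

Lemma chain_lift_is_lift (R S : pzRingType) (theta : R -> S) (Y : lmodType R)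
    (Z : lmodType S) (Q : aseq Y) (C : aseq Z) (p : Y -> Z)
    (phi : forall n, Q n -> C n) :
  chain_lift theta p phi -> is_lift theta p phi.
Proof. by case=> L a b; split=> // n; apply: slin_semilin. Qed.

Lemma is_lift_chain_lift (R S : pzRingType) (theta : R -> S) (Y : lmodType R)
    (Z : lmodType S) (Q : aseq Y) (C : aseq Z) (p : Y -> Z)
    (phi : forall n, Q n -> C n) :
  theta 1 = 1 -> is_lift theta p phi -> chain_lift theta p phi.
Proof. by move=> t1 [L a b]; split=> // n; apply: semilin_slin. Qed.

Lemma chain_lift_comp (R S T : pzRingType) (th1 : R -> S) (th2 : S -> T)
    (Y : lmodType R) (Z : lmodType S) (W : lmodType T) (Q : aseq Y) (C : aseq Z)
    (D : aseq W) (p1 : Y -> Z) (p2 : Z -> W) (f1 : forall n, Q n -> C n)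
    (f2 : forall n, C n -> D n) :
  chain_lift th1 p1 f1 -> chain_lift th2 p2 f2 ->
  chain_lift (th2 \o th1) (p2 \o p1) (fun n => f2 n \o f1 n).
Proof.
case=> L1 a1 d1 [L2 a2 d2]; split=> [n|x|n x] /=.
- exact: slin_comp.
- by rewrite a2 a1.
- by rewrite d2 d1.
Qed.

Definition comp_family (R S T : pzRingType) (X : lmodType R) (Y : lmodType S)
    (Z : lmodType T) (P : aseq X) (Q : aseq Y) (C : aseq Z) (f : family Q C)
    (g : family P Q) : family P C :=
  fun j i x => \sum_(l < j.+1) f l i (g j l x).

(** A degree preserving map seen as an inhomogeneous family, so that [solve_homotopy] applies to
    it. *)
Definition diag_family (R S : pzRingType) (Y : lmodType R) (Z : lmodType S)
    (Q : aseq Y) (C : aseq Z) (phi : forall n, Q n -> C n) : family Q C :=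
  fun j i x => @cid _ _ C j i (phi j x).

Arguments diag_family {R S Y Z Q C} phi j i x.
Arguments comp_family {R S T X Y Z P Q C} f g j i x.

Section Cid.
Variables (R : pzRingType) (Y : lmodType R) (C : aseq Y).
Lemma slin_cid j i : slin idfun (@cid _ _ C j i).
Proof.
have [E|ne] := eqVneq j i; last first.
  by split=> [x y|r x]; rewrite !cid_neq ?addr0 ?scaler0.
by case: i / E; split=> [x y|r x]; rewrite !cid_id.
Qed.
Lemma bd_cid j i x : bd C i (@cid _ _ C j.+1 i.+1 x) = @cid _ _ C j i (bd C j x).
Proof.
have [E|ne] := eqVneq j i; first by case: i / E; rewrite !cid_id.
by rewrite !cid_neq ?linear0.
Qed.
End Cid.

Section Lifts.
Variables (R S : pzRingType) (theta : R -> S) (th : rng_morph theta).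
Variables (Y : lmodType R) (Z : lmodType S) (Q : aseq Y) (C : aseq Z).
Hypotheses (Qr : proj_resolution Q) (Ce : exact_resolution C).
Let Qe := proj_resolution_exact Qr.
Let Qp : forall n, projective (Q n). Proof. by case: Qr. Qed.

Lemma chain_lift_exists (p : Y -> Z) : slin theta p ->
  exists phi : forall n, Q n -> C n, chain_lift theta p phi.
Proof.
(* The lift is the degree 0 part of the chain family whose cocycle is p o aug in degree 0 and zero
   elsewhere. *)
move=> Lp; pose c : cochain Q Z :=
  fun j => match j return Q j -> Z with 0%N => fun x => p (aug Q x) | _ => fun=> 0 end.
have [|u [[Lu u0 ud] uc uN]] := @lift_cocycle _ _ _ th _ _ _ _ Qr Ce c.
  split=> [[|j]|[|j] x] //=; last 1 first.
  - by rewrite (aug_bd Qe) (slin0 Lp).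
  - exact: (slin_comp Lp (linear_slin (aug Q))).
  - exact: slin_zero.
exists (fun n => u n n); split=> [n|x|n x] //; first exact: uc.
Qed.

Lemma diag_family_chain (p : Y -> Z) (phi : forall n, Q n -> C n) : chain_lift theta p phi ->
  chain_family theta (diag_family phi).
Proof.
case=> L a b; split=> [j i|j i x lt|j i x].
- exact: (slin_comp (slin_cid C j i) (L j)).
- by rewrite /diag_family cid_neq // ltn_eqF.
- by rewrite /diag_family bd_cid b.
Qed.

Lemma chain_lift_homotopy (p p' : Y -> Z) (phi phi' : forall n, Q n -> C n) :
  chain_lift theta p phi -> chain_lift theta p' phi' ->
  (forall x, p (aug Q x) = p' (aug Q x)) ->
  exists s : forall n, Q n -> C n.+1, [/\ forall n, slin theta (s n),
    forall x, phi 0%N x - phi' 0%N x = bd C 0 (s 0%N x) &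
    forall n x, phi n.+1 x - phi' n.+1 x = bd C n.+1 (s n.+1 x) + s n (bd Q n x)].
Proof.
move=> F F' pp.
have [||||x|j x|H [LH _ H0 H1]] := @solve_homotopy _ _ _ th _ _ _ _ Qp (bd_bd Qe) Ce
  (fun j i x => diag_family phi j i x - diag_family phi' j i x) (fun _ _ => 0).
- have [L _ _] := diag_family_chain F; have [L' _ _] := diag_family_chain F'.
  by move=> j i; apply: slin_sub.
- have [_ E _] := diag_family_chain F; have [_ E' _] := diag_family_chain F'.
  by move=> i x; rewrite E ?E' ?subrr.
- have [_ _ E] := diag_family_chain F; have [_ _ E'] := diag_family_chain F'.
  by move=> j i x; rewrite linearB E E'.
- by move=> j; apply: slin_zero.
- have [_ E _] := F; have [_ E' _] := F'.
  by rewrite /diag_family !cid_id linearB /= E E' pp subrr.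
- by rewrite /diag_family !cid_neq // subrr linear0.
exists (fun n => H n n.+1); split=> [n|x|n x]; first exact: LH.
  by rewrite (H0 0%N).1 /diag_family !cid_id.
by rewrite (H1 n n.+1).1 /diag_family !cid_id subrK.
Qed.

Section Pull.
Variables (T : pzRingType) (th2 : S -> T) (W : lmodType T).
Implicit Types c : cochain C W.

Lemma cocycle_lift c (p : Y -> Z) (phi : forall n, Q n ->
  C n) : chain_lift theta p phi -> cocycle th2 c ->
  cocycle (th2 \o theta) (fun j x => c j (phi j x)).
Proof.
case=> L _ d [Lc cd]; split=> [j|j x]; first exact: slin_comp.
by rewrite -d cd.
Qed.

Lemma cohomologous_lift c c' (p : Y -> Z) (phi : forall n, Q n ->
  C n) : chain_lift theta p phi -> cohomologous th2 c c' ->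
  cohomologous (th2 \o theta) (fun j x => c j (phi j x)) (fun j x => c' j (phi j x)).
Proof.
case=> L _ d [g [Lg g0 gd]]; exists (fun j => g j \o phi j); split=> [j|x|j x] //=.
  exact: slin_comp.
by rewrite gd d.
Qed.

(** The homotopy s between the lifts gives the coboundary of c s. So a class pulled back along a
    lift depends only on the map that is lifted. *)
Lemma cohomologous_lifts c (p p' : Y -> Z) (phi phi' : forall n, Q n -> C n) :
  chain_lift theta p phi -> chain_lift theta p' phi' ->
  (forall x, p (aug Q x) = p' (aug Q x)) -> cocycle th2 c ->
  cohomologous (th2 \o theta) (fun j x => c j (phi j x)) (fun j x => c j (phi' j x)).
Proof.
move=> F F' pp [Lc cd]; have [s [Ls s0 sd]] := chain_lift_homotopy F F' pp.
exists (fun j x => c j.+1 (s j x)); split=> [j|x|j x]; first exact: slin_comp.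
  by apply/eqP; rewrite -subr_eq0 -(slinB _ _ (Lc _)) s0 cd.
by rewrite -(slinB _ _ (Lc _)) sd (slinD _ _ (Lc _)) cd add0r.
Qed.
End Pull.

Lemma post_lift_family (p : Y -> Z) (phi : forall n, Q n -> C n) (z : family Q Q) :
  chain_lift theta p phi -> chain_family idfun z ->
  chain_family theta (fun j i x => phi i (z j i x)).
Proof.
case=> L a b [Lz z0 zd]; split=> [j i|j i x lt|j i x].
- exact: (slin_comp (L i) (Lz j i)).
- by rewrite z0 // (slin0 (L i)).
- by rewrite b zd.
Qed.

Lemma pre_lift_family (p : Y -> Z) (phi : forall n, Q n -> C n) (u : family C C) :
  chain_lift theta p phi -> chain_family idfun u ->
  chain_family theta (fun j i (x : Q j) => u j i (phi j x)).
Proof.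
case=> L a b [Lz z0 zd]; split=> [j i|j i x lt|j i x].
- exact: (slin_comp (Lz j i) (L j)).
- by rewrite z0.
- by rewrite zd b.
Qed.

(** [lies_over] for one fixed lift [phi], read off cocycles: phi o z and u o phi are chain families
    from Q to C, hence homotopic as soon as their cocycles differ by a coboundary. *)
Definition over (p : Y -> Z) (phi : forall n, Q n -> C n) (z : family Q Q) (u : family C C) :=
  cohomologous theta (fun j x => p (bdc z j x)) (fun j x => bdc u j (phi j x)).

Lemma over_homotopic (p : Y -> Z) (phi : forall n, Q n -> C n) (z : family Q Q) (u : family C C) :
  chain_lift theta p phi -> chain_family idfun z -> chain_family idfun u ->
  over p phi z u ->
  homotopic theta (fun j i x => phi i (z j i x)) (fun j i x => u j i (phi j x)).
Proof.
move=> F z_ch u_ch E; apply: (cohomologous_homotopic th Qr Ce).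
- exact: (post_lift_family F).
- exact: (pre_lift_family F).
apply: cohomologous_trans E; apply: cohomologous_eq => j x.
by rewrite /bdc; case: F => _ -> _.
Qed.

Lemma lies_overP (p : Y -> Z) (phi : forall n, Q n ->
  C n) (z : family Q Q) (u : family C C) : theta 1 = 1 ->
  chain_lift theta p phi -> chain_family idfun z -> chain_family idfun u ->
  (@lies_over R S theta Y Z Q C p z u <-> over p phi z u).
Proof.
move=> t1 F z_ch u_ch; split=> [[phi' /(is_lift_chain_lift t1) F' E]|E].
  apply: (cohomologous_trans (c' := fun j x => bdc u j (phi' j x))).
    apply: (cohomologous_trans (c' := bdc (fun j i x => phi' i (z j i x)))).
      by apply: cohomologous_eq => j x; rewrite /bdc; case: F' => _ -> _.
    exact: (homotopic_cohomologous Ce t1 E).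
  by apply: (cohomologous_lifts F' F _ (bdc_cocycle Ce u_ch)).
exists phi; first exact: chain_lift_is_lift F.
exact: (over_homotopic F z_ch u_ch E).
Qed.

(** p z z' is first compared with u phi z', by composing the coboundary g of the first factor with
    z'. Then phi z' is replaced by u' phi through an actual homotopy, whose boundary part is killed
    by the cocycle of u. *)
Lemma over_mul (p : Y -> Z) (phi : forall n, Q n -> C n) (z z' : family Q Q) (u u' : family C C) :
  slin theta p -> chain_lift theta p phi ->
  chain_family idfun z -> chain_family idfun z' ->
  chain_family idfun u -> chain_family idfun u' ->
  theta 1 = 1 -> over p phi z u -> over p phi z' u' ->
  over p phi (comp_family z z') (comp_family u u').
Proof.
move=> Lp F z_ch z'_ch u_ch u'_ch t1 [g [Lg g0 gd]] E'.
have [h [Lh' _ h0 hd]] := over_homotopic F z'_ch u'_ch E'.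
have Lh j i := semilin_slin t1 (Lh' j i).
have [Lz' z'0 z'd] := z'_ch; have [Lc cd] := bdc_cocycle Ce u_ch.
have [LF _ Fd] := F.
apply: (cohomologous_trans
  (c' := fun j x => \sum_(l < j.+1) bdc u l (phi l (z' j l x)))).
  exists (fun j x => \sum_(l < j.+1) g l (z' j l x)); split=> [j|x|j x].
  - by apply: slin_bigsum => l; apply: (slin_comp (Lg l) (Lz' j l)).
  - by rewrite {1}/bdc /comp_family !big_ord1; apply: g0.
  rewrite {1}/bdc /comp_family linear_sum (slin_sum _ _ _ Lp) -sumrB big_ord_recl /=.
  rewrite [X in X + _](_ : _ = 0) ?add0r; last by apply/eqP; rewrite subr_eq0; apply/eqP/g0.
  by apply: eq_bigr => l _; rewrite /= -z'd -gd.
(* l runs up to j+1 because the homotopy h has components of degree -1. *)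
exists (fun j x => \sum_(l < j.+2) bdc u l (h j l x)); split=> [j|x|j x].
- by apply: slin_bigsum => l; apply: (slin_comp (Lc l) (Lh j l)).
- rewrite {2}/bdc /comp_family !big_ord1; apply/eqP.
  by rewrite -subr_eq0 -[X in _ - X]/(bdc u 0%N _) -(slinB _ _ (Lc _)) h0 cd.
rewrite {2}/bdc /comp_family linear_sum -sumrB; apply: eq_bigr => l _.
rewrite -[X in _ - X]/(bdc u l _) -(slinB _ _ (Lc _)) hd (slinD _ _ (Lc _)) cd.
by rewrite add0r.
Qed.
End Lifts.

(** Over R0 the restricted terms are still projective. The identity and the map that is s0 o aug in
    degree 0 and zero above both lift the identity of Y, so they are R0-linearly homotopic; the
    homotopy is the contraction. *)
Lemma contraction_exists (R0 S : pzRingType) (theta : {rmorphism R0 -> S})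
    (Y : lmodType S) (P : aseq Y) (s0 : Y -> P 0%N) :
  proj_resolution P -> (forall n, projective (restr theta (P n))) ->
  (forall x y, s0 (x + y) = s0 x + s0 y) ->
  (forall r y, s0 (theta r *: y) = theta r *: s0 y) ->
  (forall y, aug P (s0 y) = y) ->
  exists s : forall n, P n -> P n.+1,
    [/\ forall n x y, s n (x + y) = s n x + s n y,
        forall n r x, s n (theta r *: x) = theta r *: s n x,
        forall x, x - s0 (aug P x) = bd P 0 (s 0%N x) &
        forall n x, x = bd P n.+1 (s n.+1 x) + s n (bd P n x)].
Proof.
move=> Pr pr s0D s0Z s0K; have [_ Pa P0 Pd] := Pr.
pose rl (U V : lmodType S) (f : {linear U -> V}) : restr theta U -> restr theta V := f.
have rl_lin U V f : linear (@rl U V f).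
  by move=> r x y; exact: (linearP f (theta r) x y).
pose rL U V f : {linear restr theta U -> restr theta V} :=
  HB.pack (rl U V f) (GRing.isLinear.Build _ _ _ _ _ (rl_lin U V f)).
pose Q : aseq (restr theta Y) :=
  @ASeq R0 (restr theta Y) (fun n => restr theta (P n)) (fun n => rL _ _ (bd P n))
    (rL _ _ (aug P)).
have Qr : proj_resolution Q by split.
have th : rng_morph theta by split; [exact: rmorphD | exact: rmorphM].
have Pe := proj_resolution_exact Pr.
pose phi n : Q n -> P n := fun x => x.
have F : chain_lift theta (fun y : restr theta Y => y : Y) phi by split.
pose phi' n : Q n -> P n := match n with 0%N => fun x => s0 (aug P x) | _ => fun=> 0 end.
have F' : chain_lift theta (fun y : restr theta Y => y : Y) phi'.
  split=> [[|n]|x|[|n] x] /=.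
  - split=> [x y|r x]; first by rewrite linearD s0D.
    by rewrite -s0Z; congr s0; apply: linearZ.
  - exact: slin_zero.
  - exact: s0K.
  - rewrite linear0; apply: esym; have -> : s0 (aug P (bd P 0 x)) = s0 0.
      by rewrite (aug_bd Pe).
    by apply: (addrI (s0 0)); rewrite -s0D !addr0.
  - by rewrite linear0.
have [//|s [Ls sa sd]] := chain_lift_homotopy th Qr Pe F F'.
exists s; split=> [n x y|n r x|x|n x].
- exact: slinD (Ls n).
- exact: slinZ (Ls n).
- exact: sa.
- by rewrite -[LHS]subr0; apply: sd.
Qed.

(** * Exactness of the tensor constructions *)

Section Coinduction.
Variables (R S : pzRingType) (theta : {rmorphism R -> S}).

Section Object.
Variable U : lmodType R.
(** Hom_R(S, U), on which s in S acts by f |-> f(- s). *)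
Record coind := Coind {
  cofun :> S -> U;
  cofunD : forall x y, cofun (x + y) = cofun x + cofun y;
  cofunZ : forall r x, cofun (theta r * x) = r *: cofun x
}.
HB.instance Definition _ := gen_eqMixin coind.
HB.instance Definition _ := gen_choiceMixin coind.

Lemma coind_eq (f g : coind) : (forall x, f x = g x) -> f = g.
Proof.
case: f g => f fD fZ [g gD gZ] /= /funext E; case: g / E gD gZ => gD gZ.
by rewrite (Prop_irrelevance fD gD) (Prop_irrelevance fZ gZ).
Qed.

Definition coind_add (f g : coind) : coind.
Proof.
refine (@Coind (fun x => f x + g x) _ _) => [x y|r x].
- by rewrite !cofunD addrACA.
- by rewrite !cofunZ scalerDr.
Defined.
Definition coind_opp (f : coind) : coind.
Proof.
refine (@Coind (fun x => - f x) _ _) => [x y|r x].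
- by rewrite !cofunD opprD.
- by rewrite !cofunZ scalerN.
Defined.
Definition coind_zero : coind.
Proof. by refine (@Coind (fun x => 0) _ _) => [x y|r x]; rewrite ?addr0 ?scaler0. Defined.
Lemma coind_addA : associative coind_add.
Proof. by move=> f g h; apply: coind_eq => x /=; rewrite addrA. Qed.
Lemma coind_addC : commutative coind_add.
Proof. by move=> f g; apply: coind_eq => x /=; rewrite addrC. Qed.
Lemma coind_add0 : left_id coind_zero coind_add.
Proof. by move=> f; apply: coind_eq => x /=; rewrite add0r. Qed.
Lemma coind_addN : left_inverse coind_zero coind_opp coind_add.
Proof. by move=> f; apply: coind_eq => x /=; rewrite addNr. Qed.
HB.instance Definition _ :=
  GRing.isZmodule.Build coind coind_addA coind_addC coind_add0 coind_addN.

Definition coind_act (s : S) (f : coind) : coind.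
Proof.
refine (@Coind (fun x => f (x * s)) _ _) => [x y|r x].
- by rewrite mulrDl cofunD.
- by rewrite -mulrA cofunZ.
Defined.
Lemma coind_actA s t f : coind_act s (coind_act t f) = coind_act (s * t) f.
Proof. by apply: coind_eq => x /=; rewrite mulrA. Qed.
Lemma coind_act1 : left_id 1 coind_act.
Proof. by move=> f; apply: coind_eq => x /=; rewrite mulr1. Qed.
Lemma coind_actDr : right_distributive coind_act +%R.
Proof. by move=> s f g; apply: coind_eq. Qed.
Lemma coind_actDl f : {morph coind_act^~ f : s t / s + t}.
Proof. by move=> s t; apply: coind_eq => x /=; rewrite mulrDr cofunD. Qed.
HB.instance Definition _ := GRing.Zmodule_isLmodule.Build S coind
  coind_actA coind_act1 coind_actDr coind_actDl.
End Object.

(* Hom_R(S, -) is right adjoint to restriction, and exact since the [e i] and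
   [rho i] form a dual basis of S as a left R-module. *)
Lemma projective_restr (P : lmodType S) (n : nat) (e : 'I_n -> S)
    (rho : 'I_n -> S -> R) :
  (forall i x y, rho i (x + y) = rho i x + rho i y) ->
  (forall i r x, rho i (theta r * x) = r * rho i x) ->
  (forall s, s = \sum_(i < n) theta (rho i s) * e i) ->
  projective P -> projective (restr theta P).
Proof.
move=> rD rZ rK Pp U V g f gs.
have GD (u : coind U) x y : g (u (x + y)) = g (u x) + g (u y).
  by rewrite cofunD linearD.
have GZ (u : coind U) r x : g (u (theta r * x)) = r *: g (u x).
  by rewrite cofunZ linearZ.
pose G0 (u : coind U) := @Coind V (fun x => g (u x)) (GD u) (GZ u).
have G_lin : linear G0.
  by move=> s u v; apply: coind_eq => x /=; rewrite linearD.
pose G : {linear coind U -> coind V} := HB.pack G0 (GRing.isLinear.Build _ _ _ _ _ G_lin).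
have FD p x y : f ((x + y) *: p : P) = f (x *: p : P) + f (y *: p : P).
  by rewrite scalerDl; apply: (linearD f).
have FZ p r x : f ((theta r * x) *: p : P) = r *: f (x *: p : P).
  by rewrite -scalerA; exact: (linearZ_LR f r (x *: p : P)).
pose F0 (p : P) := @Coind V (fun x => f (x *: p : P)) (FD p) (FZ p).
have F_lin : linear F0.
  move=> s p q; apply: coind_eq => x /=.
  by rewrite scalerDr scalerA; apply: (linearD f).
pose F : {linear P -> coind V} := HB.pack F0 (GRing.isLinear.Build _ _ _ _ _ F_lin).
have [v|h hK] := Pp _ _ G F.
  (* A map v : S -> V is lifted by lifting its finitely many values at the dual basis. *)
  pose u i := sval (boolp.cid (gs (v (e i)))).
  have gu i : g (u i) = v (e i) by exact: svalP (boolp.cid (gs (v (e i)))).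
  pose w x := \sum_(i < n) rho i x *: u i.
  have wD x y : w (x + y) = w x + w y.
    by rewrite -big_split; apply: eq_bigr => i _; rewrite rD scalerDl.
  have wZ r x : w (theta r * x) = r *: w x.
    by rewrite scaler_sumr; apply: eq_bigr => i _; rewrite rZ scalerA.
  exists (Coind wD wZ); apply: coind_eq => x /=.
  rewrite /w linear_sum [in RHS](rK x).
  rewrite (big_morph v (cofunD v) (_ : v 0 = 0)); last first.
    by apply: (addrI (v 0)); rewrite -cofunD !addr0.
  by apply: eq_bigr => i _; rewrite linearZ gu cofunZ.
(* Evaluation at 1 turns the S-linear h into an R-linear map to U, the other half of the
   adjunction. *)
have k_lin : linear (fun x : restr theta P => h x 1).
  move=> r x y; have -> : h (r *: x + y) = theta r *: h x + h y by exact: (linearP h).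
  by congr (_ + _); rewrite -cofunZ mulr1 /=; rewrite mul1r.
pose K : {linear restr theta P -> U} :=
  HB.pack (fun x : restr theta P => h x 1) (GRing.isLinear.Build _ _ _ _ _ k_lin).
exists K => x; have /(congr1 (fun w : coind V => w 1)) /= := hK x.
by rewrite scale1r.
Qed.
End Coinduction.

Lemma projective_in_alg (k : fieldType) (A : falgType k) (P : lmodType A) :
  projective P -> projective (restr (in_alg A : {rmorphism k -> A}) P).
Proof.
pose e := vbasis {:A}.
apply: (@projective_restr k A _ P _ (fun i => e`_i) (fun i x => coord e i x)).
- by move=> i x y; rewrite linearD.
- by move=> i r x; rewrite mulr_algl linearZ.
- by move=> s; rewrite {1}(coord_vbasis (memvf s)); apply: eq_bigr => i _; rewrite mulr_algl.
Qed.

Section RightAction.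
Variables (k : fieldType) (C : falgType k).
Definition right_emb (c : C^c) : env C := epure 1 (c : C).
Lemma right_embB : zmod_morphism right_emb.
Proof.
move=> a b; apply: (addIr (right_emb b)); rewrite subrK /right_emb /epure.
by rewrite -apureDr subrK.
Qed.
Lemma right_embM : monoid_morphism right_emb.
Proof. by split=> [|a b] //; rewrite /right_emb epureM mul1r. Qed.
HB.instance Definition _ := GRing.isZmodMorphism.Build C^c (env C) right_emb right_embB.
HB.instance Definition _ :=
  GRing.isMonoidMorphism.Build C^c (env C) right_emb right_embM.

Lemma epureDl (a a' b : C) : epure (a + a') b = epure a b + epure a' b.
Proof. exact: (@apureDl k C C^c). Qed.
Lemma epureDr (a b b' : C) : epure a (b + b') = epure a b + epure a b'.
Proof. exact: (@apureDr k C C^c). Qed.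
Lemma epureZ (c : k) (a b : C) : epure (c *: a) b = epure a (c *: b).
Proof. exact: (@apureZ k C C^c). Qed.

Lemma projective_right (P : lmodType (env C)) :
  projective P -> projective (restr right_emb P).
Proof.
pose e := vbasis {:C}.
(* C^e is free as a left C^op-module on the elements e_i (x) 1, and [rho i] is the coordinate a (x)
   b |-> coord_i(a) b. *)
pose rho i (t : env C) : C^c := tlift (fun a b => (coord e i a *: (b : C)) : C^c) t.
have rb i : balanced (@scl_r k C) (@scl_l k C^c)
    (fun a b => (coord e i a *: (b : C)) : C^c).
  split=> [x x' y|x y y'|x c y]; rewrite ?linearD ?scalerDl ?scalerDr //.
  by rewrite /scl_r /scl_l linearZ /= -scalerA scalerA mulrC -scalerA.
have rhoE i a b : rho i (epure a b) = coord e i a *: (b : C).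
  by rewrite /rho tlift_pure.
have rhoD i x y : rho i (x + y) = rho i x + rho i y by rewrite /rho tliftD.
apply: (@projective_restr _ _ right_emb P _ (fun i => epure e`_i 1) rho).
- exact: rhoD.
- move=> i r; apply: env_ext => [x y|x y|a b].
  + by rewrite mulrDr rhoD.
  + by rewrite rhoD mulrDr.
  by rewrite epureM !rhoE mul1r scalerAl.
- apply: env_ext => [x y|x y|a b] //.
    by rewrite -big_split; apply: eq_bigr => i _; rewrite rhoD rmorphD mulrDl.
  rewrite {1}(coord_vbasis (memvf a)) (big_morph (fun a => epure a b) (fun x y => epureDl
    x y b) (_ : _ = 0)); last first.
    by apply: (addrI (epure 0 b)); rewrite -epureDl !addr0.
  by apply: eq_bigr => i _; rewrite rhoE epureZ /right_emb epureM mul1r mul1r.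
Qed.
End RightAction.

(** The maps i and s need only preserve 0: the contractions of the tensor products below are
    additive, not linear over the ring of the complex. *)
Lemma contraction_exact (R : pzRingType) (Y : lmodType R) (C : aseq Y)
    (i : Y -> C 0%N) (s : forall n, C n -> C n.+1) :
  (forall x, aug C (bd C 0 x) = 0) -> (forall n x, bd C n (bd C n.+1 x) = 0) ->
  i 0 = 0 -> (forall n, s n 0 = 0) -> (forall y, aug C (i y) = y) ->
  (forall x, x - i (aug C x) = bd C 0 (s 0%N x)) ->
  (forall n x, x = bd C n.+1 (s n.+1 x) + s n (bd C n x)) ->
  exact_resolution C.
Proof.
move=> a0 d0 i0 s0 iK h0 hd; split=> [y|x|n x]; first by exists (i y).
- split=> [E|[y <-]]; last exact: a0.
  by exists (s 0%N x); rewrite -h0 E i0 subr0.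
- split=> [E|[y <-]]; last exact: d0.
  by exists (s n.+1 x); rewrite [RHS](hd n) E s0 addr0.
Qed.

Section KSeq.
Variables (k : fieldType) (A : falgType k) (H : hopf A).

Lemma kpure0r (M N : lmodType A) (x : M) : kpure H x (0 : N) = 0.
Proof. by apply: (addrI (kpure H x 0)); rewrite -kpureDr !addr0. Qed.
Lemma kpure0l (M N : lmodType A) (y : N) : kpure H (0 : M) y = 0.
Proof. by apply: (addrI (kpure H 0 y)); rewrite -kpureDl !addr0. Qed.
Lemma kpureBl (M N : lmodType A) x x' (y : N) :
  kpure H (x - x' : M) y = kpure H x y - kpure H x' y.
Proof. by apply: (addIr (kpure H x' y)); rewrite subrK -kpureDl subrK. Qed.

Variables (P : aseq (trivmod H)) (M : lmodType A).
Hypothesis Pr : proj_resolution P.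

(* The terms of [P] are projective over k, which makes [P] contractible over k. *)
Lemma k_contraction : exists (x0 : P 0%N) (s : forall n, P n -> P n.+1),
  [/\ (aug P x0 : k) = 1, forall n x y, s n (x + y) = s n x + s n y,
      forall n (c : k) x, s n (c%:A *: x) = c%:A *: s n x,
      forall x, x - (aug P x : k)%:A *: x0 = bd P 0 (s 0%N x) &
      forall n x, x = bd P n.+1 (s n.+1 x) + s n (bd P n x)].
Proof.
have [Pp Ps _ _] := Pr; have [x0 x0E] := Ps (1 : k).
have [|||s [sD sZ s0 sd]] := @contraction_exists _ _ (in_alg A : {rmorphism k -> A}) _ P
  (fun c : k => c%:A *: x0) Pr (fun n => projective_in_alg (@Pp n)).
- by move=> x y; rewrite -scalerDl -[_ + _ in RHS]scalerDl.
- move=> r y; rewrite scalerA mulr_algl scalerA.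
  suff -> : r%:A *: (y : trivmod H) = (r * y : k) by [].
  by rewrite -[LHS]/(counit H r%:A * (y : k)) linearZ /= rmorph1 mulr1.
- move=> y; rewrite linearZ /= x0E -[LHS]/(counit H y%:A * 1).
  by rewrite linearZ /= rmorph1 !mulr1.
by exists x0, s.
Qed.

(** The contraction s of P is k-linear, so s (x) M is well defined, and it contracts P (x)_k M. *)
Lemma kseq_exact : exact_resolution (kseq P M).
Proof.
have [x0 [s [x0E sD sZ s0 sd]]] := k_contraction.
have Pe := proj_resolution_exact Pr.
have sb n : balanced (@kact_r _ _ (P n)) (@kact_l _ _ M) (fun x y => kpure H (s n x) y).
  split=> [x x' y|x y y'|x c y]; rewrite ?sD ?kpureDl ?kpureDr //.
  by rewrite /kact_r sZ kpureZ.
pose S n (t : ktens H (P n) M) : ktens H (P n.+1) M := tlift (fun x y => kpure H (s n x) y) t.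
have SE n x y : S n (kpure H x y) = kpure H (s n x) y by rewrite /S tlift_pure.
have SD n : {morph (S n) : x y / x + y} by move=> x y; rewrite /S tliftD.
apply: (@contraction_exact _ _ (kseq P M) (kpure H x0) S) => /=.
- apply: ktens_ext => [x y|x y|x m]; rewrite ?kmapD ?kaugD ?addr0 //.
  by rewrite kmapE kaugE (aug_bd Pe) scale0r scale0r.
- move=> n; apply: ktens_ext => [x y|x y|x m]; rewrite ?kmapD ?addr0 //.
  by rewrite !kmapE (bd_bd Pe) kpure0l.
- exact: kpure0r.
- by move=> n; apply: (addrI (S n 0)); rewrite -SD !addr0.
- by move=> y; rewrite kaugE x0E scale1r scale1r.
- apply: ktens_ext => [x y|x y|x m].
  + by rewrite kaugD kpureDr opprD addrACA.
  + by rewrite SD kmapD.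
  by rewrite SE kmapE kaugE -kpureZ -kpureBl s0.
- move=> n; apply: ktens_ext => [x y|x y|x m] //.
  + by rewrite SD !kmapD SD addrACA.
  by rewrite SE !kmapE SE -kpureDl -sd.
Qed.
End KSeq.

Section BSeq.
Variables (k : fieldType) (C : falgType k).

Lemma bpure0r (X : lmodType (env C)) (M : lmodType C) (x : X) : bpure x (0 : M) = 0.
Proof. by apply: (addrI (bpure x 0)); rewrite -bpureDr !addr0. Qed.
Lemma bpure0l (X : lmodType (env C)) (M : lmodType C) (m : M) : bpure (0 : X) m = 0.
Proof. by apply: (addrI (bpure 0 m)); rewrite -bpureDl !addr0. Qed.
Lemma bpureBl (X : lmodType (env C)) (M : lmodType C) (x x' : X) (m : M) :
  bpure (x - x') m = bpure x m - bpure x' m.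
Proof. by apply: (addIr (bpure x' m)); rewrite subrK -bpureDl subrK. Qed.

Lemma bireg_scaleE (a b : C) (c : bireg C) : epure a b *: c = a * c * b :> C.
Proof. exact: bireg_actE. Qed.

Variables (P : aseq (bireg C)) (M : lmodType C).
Hypothesis Pr : proj_resolution P.

(** P augments onto C, which is free as a right C-module, so P contracts linearly for the right
    action of C; this is what lets the contraction descend to - (x)_C M. *)
Lemma bseq_exact : exact_resolution (bseq P M).
Proof.
have Pe := proj_resolution_exact Pr.
have [Pp Ps _ _] := Pr; have [x0 x0E] := Ps (1 : C).
have [|||s [sD sZ s0 sd]] := @contraction_exists _ _ (@right_emb k C) _ P
  (fun c => epure 1 (c : C) *: x0) Pr (fun n => projective_right (@Pp n)).
- by move=> x y; rewrite -scalerDl -epureDr.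
- move=> r y; rewrite scalerA /right_emb epureM mul1r.
  by rewrite bireg_scaleE mul1r.
- by move=> y; rewrite linearZ /= x0E bireg_scaleE !mul1r.
have sb n : balanced (@bact_r _ _ (P n)) (@bact_l _ _ M) (fun x y => bpure (s n x) y).
  split=> [x x' y|x y y'|x c y]; rewrite ?sD ?bpureDl ?bpureDr //.
  by rewrite /bact_r (sZ n c) bpureM.
pose S n (t : btens (P n) M) : btens (P n.+1) M := tlift (fun x y => bpure (s n x) y) t.
have SE n x y : S n (bpure x y) = bpure (s n x) y by rewrite /S tlift_pure.
have SD n : {morph (S n) : x y / x + y} by move=> x y; rewrite /S tliftD.
apply: (@contraction_exact _ _ (bseq P M) (bpure x0) S) => /=.
- apply: btens_ext => [x y|x y|x m]; rewrite ?bmapD ?baugD ?addr0 //.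
  by rewrite bmapE baugE (aug_bd Pe) scale0r.
- move=> n; apply: btens_ext => [x y|x y|x m]; rewrite ?bmapD ?addr0 //.
  by rewrite !bmapE (bd_bd Pe) bpure0l.
- exact: bpure0r.
- by move=> n; apply: (addrI (S n 0)); rewrite -SD !addr0.
- by move=> y; rewrite baugE x0E scale1r.
- apply: btens_ext => [x y|x y|x m].
  + by rewrite baugD bpureDr opprD addrACA.
  + by rewrite SD bmapD.
  by rewrite SE bmapE baugE -bpureM -bpureBl s0.
- move=> n; apply: btens_ext => [x y|x y|x m] //.
  + by rewrite SD !bmapD SD addrACA.
  by rewrite SE !bmapE SE -bpureDl -sd.
Qed.
End BSeq.

Section Contract.
Variables (k : fieldType) (A : falgType k) (H : hopf A).

Lemma trivmodE (a : A) (c : trivmod H) : a *: c = counit H a * (c : k) :> k.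
Proof. by []. Qed.

Lemma counit_scalar (c : k) : counit H c%:A = c.
Proof. by rewrite linearZ /= rmorph1 mulr1. Qed.

Lemma slin_trivZ (X : lmodType A) (c : X -> trivmod H) : slin idfun c ->
  forall (a : k) x, c (a%:A *: x) = a * (c x : k) :> k.
Proof. by move=> L a x; rewrite (slinZ _ _ L) trivmodE counit_scalar. Qed.

Section Right.
Variables (M N N' : lmodType A) (f : {linear N -> N'}).
Definition kmapr (t : ktens H M N) : ktens H M N' := tlift (fun x y => kpure H x (f y)) t.
Lemma kmapr_bal : balanced (@kact_r _ _ M) (@kact_l _ _ N) (fun x y => kpure H x (f y)).
Proof.
split=> [x x' y|x y y'|x c y]; rewrite ?linearD ?kpureDl ?kpureDr //.
by rewrite /kact_r /kact_l linearZ /= kpureZ.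
Qed.
Lemma kmaprD : {morph kmapr : t t' / t + t'}.
Proof. by move=> t t'; rewrite /kmapr tliftD //; exact: kmapr_bal. Qed.
Lemma kmaprE x y : kmapr (kpure H x y) = kpure H x (f y).
Proof. by rewrite /kmapr tlift_pure //; exact: kmapr_bal. Qed.
Lemma kmapr_act2 s t : kmapr (kact2 s t) = kact2 s (kmapr t).
Proof.
move: t; apply: ktens_ext => [t t'|t t'|x y]; rewrite ?kact2Dr ?kmaprD ?kact2Dr //.
move: s; apply: atens_ext => [s t|s t|a b]; rewrite ?kact2Dl ?kmaprD ?kact2Dl //.
by rewrite kact2E !kmaprE kact2E linearZ.
Qed.
Lemma kmapr_linear : linear kmapr.
Proof. by move=> a t t'; rewrite kmaprD; congr (_ + _); apply: kmapr_act2. Qed.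
HB.instance Definition _ := GRing.isLinear.Build A (ktens H M N) (ktens H M N') _
  kmapr kmapr_linear.
End Right.

Section Contractions.
Variables (X M : lmodType A) (c : X -> trivmod H).
Hypothesis Lc : slin idfun c.

(** c (x) M followed by k (x) M = M. For the cocycle c of a chain map f of P it is the cocycle of f
    (x) M. *)
Definition contractl (t : ktens H X M) : M :=
  tlift (fun x m => ((c x : k)%:A : A) *: m) t.
Lemma contractl_bal : balanced (@kact_r _ _ X) (@kact_l _ _ M)
  (fun x m => ((c x : k)%:A : A) *: m).
Proof.
split=> [x x' m|x m m'|x a m]; rewrite ?scalerDr //.
  by rewrite (slinD _ _ Lc) !scalerDl.
by rewrite /kact_r /kact_l slin_trivZ // scalerA mulr_algl scalerA mulrC.
Qed.
Lemma contractlD : {morph contractl : t t' / t + t'}.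
Proof. by move=> t t'; rewrite /contractl tliftD //; exact: contractl_bal. Qed.
Lemma contractlE x m : contractl (kpure H x m) = ((c x : k)%:A : A) *: m.
Proof. by rewrite /contractl tlift_pure //; exact: contractl_bal. Qed.
Lemma contractl_act2 (s : atens A A) t :
  contractl (kact2 s t) = tlift (fun a b => counit H a *: b) s *: contractl t.
Proof.
have B : balanced (@scl_r k A) (@scl_l k A) (fun a b => counit H a *: b).
  split=> [a a' b|a b b'|a d b]; rewrite ?rmorphD ?scalerDl ?scalerDr //.
  by rewrite /scl_r /scl_l linearZ /= scalerA mulrC.
move: t; apply: ktens_ext => [t t'|t t'|x m].
- by rewrite kact2Dr contractlD.
- by rewrite contractlD scalerDr.
move: s; apply: atens_ext => [s t|s t|a b].
- by rewrite kact2Dl contractlD.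
- by rewrite tliftD // scalerDl.
rewrite kact2E !contractlE tlift_pure // (slinZ _ _ Lc) trivmodE.
by rewrite !scalerA mulr_algl mulr_algr scalerA mulrC.
Qed.
Lemma slin_contractl : slin idfun contractl.
Proof.
split=> [x y|a t]; first exact: contractlD.
by rewrite -[a *: t]/(kact2 (comul H a) t) contractl_act2 hopf_counitl.
Qed.

Definition contractr (t : ktens H M X) : M :=
  tlift (fun m x => ((c x : k)%:A : A) *: m) t.
Lemma contractr_bal : balanced (@kact_r _ _ M) (@kact_l _ _ X)
  (fun m x => ((c x : k)%:A : A) *: m).
Proof.
split=> [x x' m|m x x'|m a x]; rewrite ?scalerDr //.
  by rewrite (slinD _ _ Lc) !scalerDl.
by rewrite /kact_r /kact_l slin_trivZ // scalerA mulr_algl scalerA mulrC.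
Qed.
Lemma contractrD : {morph contractr : t t' / t + t'}.
Proof. by move=> t t'; rewrite /contractr tliftD //; exact: contractr_bal. Qed.
Lemma contractrE x m : contractr (kpure H m x) = ((c x : k)%:A : A) *: m.
Proof. by rewrite /contractr tlift_pure //; exact: contractr_bal. Qed.
Lemma contractr_act2 (s : atens A A) t :
  contractr (kact2 s t) = tlift (fun a b => counit H b *: a) s *: contractr t.
Proof.
have B : balanced (@scl_r k A) (@scl_l k A) (fun a b => counit H b *: a).
  split=> [a a' b|a b b'|a d b]; rewrite ?rmorphD ?scalerDl ?scalerDr //.
  by rewrite /scl_r /scl_l [counit H (_ *: _)]linearZ /= scalerA mulrC.
move: t; apply: ktens_ext => [t t'|t t'|m x].
- by rewrite kact2Dr contractrD.
- by rewrite contractrD scalerDr.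
move: s; apply: atens_ext => [s t|s t|a b].
- by rewrite kact2Dl contractrD.
- by rewrite tliftD // scalerDl.
rewrite kact2E !contractrE tlift_pure // (slinZ _ _ Lc) trivmodE.
by rewrite !scalerA mulr_algl mulr_algr scalerA mulrC.
Qed.
Lemma slin_contractr : slin idfun contractr.
Proof.
split=> [x y|a t]; first exact: contractrD.
by rewrite -[a *: t]/(kact2 (comul H a) t) contractr_act2 hopf_counitr.
Qed.
End Contractions.

Lemma contractl_kmap (X X' M : lmodType A) (c : X -> trivmod H)
    (c' : X' -> trivmod H) (f : {linear X' -> X}) (t : ktens H X' M) :
  slin idfun c -> slin idfun c' -> (forall x, c (f x) = c' x) ->
  contractl c (kmap f t) = contractl c' t.
Proof.
move=> L L' E; move: t; apply: ktens_ext => [s t|s t|x m].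
- by rewrite kmapD contractlD.
- exact: contractlD.
by rewrite kmapE !contractlE // E.
Qed.
Lemma contractl_kmapr (X M M' : lmodType A) (c : X -> trivmod H)
    (f : {linear M -> M'}) (t : ktens H X M) :
  slin idfun c -> contractl c (kmapr f t) = f (contractl c t).
Proof.
move=> L; move: t; apply: ktens_ext => [s t|s t|x m].
- by rewrite kmaprD contractlD.
- by rewrite contractlD // linearD.
by rewrite kmaprE !contractlE // linearZ.
Qed.
Lemma contractr_kmapr (X X' M : lmodType A) (c : X -> trivmod H)
    (c' : X' -> trivmod H) (f : {linear X' -> X}) (t : ktens H M X') :
  slin idfun c -> slin idfun c' -> (forall x, c (f x) = c' x) ->
  contractr c (kmapr f t) = contractr c' t.
Proof.
move=> L L' E; move: t; apply: ktens_ext => [s t|s t|x m].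
- by rewrite kmaprD contractrD.
- exact: contractrD.
by rewrite kmaprE !contractrE // E.
Qed.
Lemma contractr_kmap (X M M' : lmodType A) (c : X -> trivmod H)
    (f : {linear M -> M'}) (t : ktens H M X) :
  slin idfun c -> contractr c (kmap f t) = f (contractr c t).
Proof.
move=> L; move: t; apply: ktens_ext => [s t|s t|x m].
- by rewrite kmapD contractrD.
- by rewrite contractrD // linearD.
by rewrite kmapE !contractrE // linearZ.
Qed.
(** Both sides send x (x) y to c(x) b(y). Commutativity of cohomology rests on this: the order in
    which the factors are contracted does not matter. *)
Lemma contract_swap (X Y : lmodType A) (c : X -> trivmod H) (b : Y -> trivmod H)
    (t : ktens H X Y) : slin idfun c -> slin idfun b ->
  c (contractr b t) = b (contractl c t).
Proof.
move=> Lc Lb; move: t; apply: ktens_ext => [s t|s t|x y].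
- by rewrite contractrD // (slinD _ _ Lc).
- by rewrite contractlD // (slinD _ _ Lb).
by rewrite contractrE // contractlE // slin_trivZ // slin_trivZ // mulrC.
Qed.
Lemma contractl0 (X M : lmodType A) (c : X -> trivmod H) (t : ktens H X M) :
  (forall x, c x = 0) -> contractl c t = 0.
Proof.
move=> E; rewrite /contractl /tlift /tsum big1 // => p _.
by rewrite E scale0r scale0r.
Qed.
Lemma contractr0 (X M : lmodType A) (c : X -> trivmod H) (t : ktens H M X) :
  (forall x, c x = 0) -> contractr c t = 0.
Proof.
move=> E; rewrite /contractr /tlift /tsum big1 // => p _.
by rewrite E scale0r scale0r.
Qed.
End Contract.

Section BContract.
Variables (k : fieldType) (C : falgType k) (X : lmodType (env C)) (M : lmodType C).
Variable c : X -> bireg C.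
Definition bcontract (t : btens X M) : M := tlift (fun x m => (c x : C) *: m) t.
Hypothesis Lc : slin idfun c.
Lemma bcontract_bal : balanced (@bact_r _ _ X) (@bact_l _ _ M) (fun x m => (c x : C) *: m).
Proof.
split=> [x x' m|x m m'|x a m]; rewrite ?scalerDr //.
  by rewrite (slinD _ _ Lc); exact: (@scalerDl C M m).
by rewrite /bact_r (slinZ _ _ Lc) bireg_scaleE mul1r scalerA.
Qed.
Lemma bcontractD : {morph bcontract : t t' / t + t'}.
Proof. by move=> t t'; rewrite /bcontract tliftD //; exact: bcontract_bal. Qed.
Lemma bcontractE x m : bcontract (bpure x m) = (c x : C) *: m.
Proof. by rewrite /bcontract tlift_pure //; exact: bcontract_bal. Qed.
Lemma slin_bcontract : slin idfun bcontract.
Proof.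
split=> [t t'|a t]; first exact: bcontractD.
move: t; apply: btens_ext => [t t'|t t'|x m].
- by rewrite scalerDr bcontractD.
- by rewrite bcontractD scalerDr.
rewrite -[_ *: bpure _ _]/(bact _ _) bactE !bcontractE (slinZ _ _ Lc) bireg_scaleE.
by rewrite mulr1 scalerA.
Qed.
End BContract.

Section IContract.
Variables (k : fieldType) (A : falgType k) (H : hopf A) (X : lmodType A).
Variable c : X -> trivmod H.
(** A^e (x)_delta(A) c followed by A^e (x)_delta(A) k = A. *)
Definition icontract (t : induced (delta H) X) : bireg A :=
  tlift (fun s x => s *: ((c x : k)%:A : bireg A)) t.
Hypothesis Lc : slin idfun c.
Lemma icontract_bal : balanced (iact_r (delta H)) (@iact_l A X)
  (fun s x => s *: ((c x : k)%:A : bireg A)).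
Proof.
split=> [s s' x|s x x'|s a x]; first by rewrite scalerDl.
  by rewrite (slinD _ _ Lc) -scalerDr; congr (_ *: _); apply: (@scalerDl k A 1).
rewrite /iact_r /iact_l -scalerA; congr (_ *: _).
by rewrite delta_act (slinZ _ _ Lc).
Qed.
Lemma icontractD : {morph icontract : t t' / t + t'}.
Proof. by move=> t t'; rewrite /icontract tliftD //; exact: icontract_bal. Qed.
Lemma icontractE s x : icontract (ipure (delta H) s x) = s *: ((c x : k)%:A : bireg A).
Proof. by rewrite /icontract tlift_pure //; exact: icontract_bal. Qed.
Lemma slin_icontract : slin idfun icontract.
Proof.
split=> [t t'|a t]; first exact: icontractD.
move: t; apply: induced_ext => [t t'|t t'|s x].
- by rewrite scalerDr icontractD.
- by rewrite icontractD scalerDr.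
by rewrite -[_ *: ipure _ _ _]/(iact _ _) iactE !icontractE scalerA.
Qed.
End IContract.

(** * Antipode identities in Sweedler form *)

Section Sweedler.
Variables (k : fieldType) (A : falgType k) (H : hopf A).

Local Notation bal := (balanced (@scl_r k A) (@scl_l k A)).

Lemma comul1 : comul H 1 = apure 1 1. Proof. exact: rmorph1. Qed.

Lemma comul_scalar (c : k) : comul H c%:A = apure c%:A 1.
Proof. by rewrite linearZ /= comul1 -[LHS]/(ascale _ _) ascaleE. Qed.

Lemma antipode1 : antipode H 1 = 1.
Proof.
have := hopf_antipodel H 1; rewrite comul1 tlift_pure.
  by rewrite mulr1 rmorph1 scale1r.
split=> [x x' y|x y y'|x c y]; rewrite ?linearD ?mulrDl ?mulrDr //.
by rewrite /scl_r /scl_l linearZ /= -scalerAl scalerAr.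
Qed.

(** Coassociativity evaluated on a k-trilinear f. As Z is only an abelian group, trilinearity is
    stated as additivity together with moving scalars between neighbouring arguments. *)
Lemma sweedler3 (Z : zmodType) (f : A -> A -> A -> Z) (a : A) :
  (forall v w, {morph f^~ v ^~ w : x y / x + y}) ->
  (forall u w, {morph (fun v => f u v w) : x y / x + y}) ->
  (forall u v, {morph f u v : x y / x + y}) ->
  (forall (c : k) u v w, f (c *: u) v w = f u (c *: v) w) ->
  (forall (c : k) u v w, f u (c *: v) w = f u v (c *: w)) ->
  tlift (fun a1 a2 => tlift (fun u v => f u v a2) (comul H a1)) (comul H a) =
  tlift (fun a1 a2 => tlift (fun u v => f a1 u v) (comul H a2)) (comul H a).
Proof.
move=> D1 D2 D3 Z1 Z2.
pose G (s : atens A A) (w : A) := tlift (fun u v => f u v w) s.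
have Bin w : bal (fun u v => f u v w).
  by split=> [x x' y|x y y'|x c y]; rewrite ?D1 ?D2 // /scl_r /scl_l Z1.
have GE u v w : G (apure u v) w = f u v w by rewrite /G tlift_pure.
have GD w : {morph G^~ w : s t / s + t} by move=> s t; rewrite /G tliftD.
have GB : balanced (@scl_r k (atens A A)) (@scl_l k A) G.
  split=> [x x' y|x y y'|x c y]; first exact: GD.
    by rewrite /G -tlift_fD; apply: eq_tlift => u v; rewrite D3.
  move: x; apply: atens_ext => [s t|s t|u v]; rewrite ?GD //.
    by rewrite /scl_r scalerDr GD.
  by rewrite /scl_r -[c *: _]/(ascale c (apure u v)) ascaleE !GE Z1 Z2.
pose TG (t : vtens (atens A A) A) : Z := tlift G t.
have TD : {morph TG : x y / x + y} by move=> x y; apply: tliftD GB.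
have := congr1 TG (hopf_coassoc H a).
rewrite !(@tlift_morph _ _ _ _ _ _ _ _ _ _ TD) => E.
transitivity (tlift (fun x y => TG (vpure (comul H x) y)) (comul H a)).
  by apply: eq_tlift => x y; rewrite /TG tlift_pure.
rewrite E; apply: eq_tlift => x y; rewrite (@tlift_morph _ _ _ _ _ _ _ _ _ _ TD).
by apply: eq_tlift => u v; rewrite /TG tlift_pure // GE.
Qed.

Section Modules.
Variables (X M : lmodType A).

Lemma kactE a (t : ktens H X M) : a *: t = kact2 (comul H a) t. Proof. by []. Qed.

Lemma kact2_pure s (x : X) (y : M) :
  kact2 s (kpure H x y) = tlift (fun a b => kpure H (a *: x) (b *: y)) s.
Proof. by rewrite /kact2 tlift_pure //; exact: kact2_bal. Qed.

Lemma kpure_scalar (c : k) (x : X) (y : M) :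
  c%:A *: kpure H x y = kpure H x (c%:A *: y).
Proof. by rewrite kactE comul_scalar kact2E scale1r kpureZ. Qed.

(** The sum is h_1 x (x) h_2 S(h_3) y, and h_2 S(h_3) collapses to a counit. This makes [untwist]
    balanced over delta(A). *)
Lemma kpure_antipode h (x : X) (y : M) :
  tlift (fun h1 h2 => h1 *: kpure H x (antipode H h2 *: y)) (comul H h) =
  kpure H (h *: x) y.
Proof.
pose f (u v w : A) := kpure H (u *: x) ((v * antipode H w) *: y).
transitivity (tlift (fun a1 a2 => tlift (fun u v => f u v a2) (comul H a1)) (comul H h)).
  apply: eq_tlift => h1 h2; rewrite kactE kact2_pure.
  by apply: eq_tlift => u v; rewrite /f scalerA.
rewrite sweedler3 => [|v w a b|u w a b|u v a b|c u v w|c u v w]; last 1 first.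
- by rewrite /f linearZ /= -scalerAl -scalerAr.
- transitivity (tlift (fun a b => kpure H ((counit H b *: a) *: x) y) (comul H h)).
    apply: eq_tlift => a b; rewrite /f.
    transitivity (kpure H (a *: x) ((counit H b)%:A *: y)); last first.
      by rewrite -kpureZ scalerA -(mulr_algl (counit H b) a).
    rewrite -(hopf_antipoder H b).
    rewrite (@tlift_morph _ _ _ _ _ _ _ _ (fun t => kpure H (a *: x) (t *: y))) //.
    by move=> s t; rewrite scalerDl kpureDr.
  rewrite -{2}(hopf_counitr H h).
  rewrite (@tlift_morph _ _ _ _ _ _ _ _ (fun t => kpure H (t *: x) y)) //.
  by move=> s t; rewrite scalerDl kpureDl.
- by rewrite /f scalerDl kpureDl.
- by rewrite /f mulrDl scalerDl kpureDr.
- by rewrite /f linearD mulrDr scalerDl kpureDr.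
- rewrite /f -scalerAl -(mulr_algl c u) -(mulr_algl c (_ * _)) -!scalerA.
  by rewrite kpureZ.
Qed.
End Modules.

(** The second factor of A^e multiplies in reverse order, so the sum is a_1 (x) S(a_2) a_3 b. It
    writes a (x) b in terms of 1 (x) A and delta(A), as needed to invert [untwist]. *)
Lemma delta_antipode a b :
  tlift (fun a1 a2 => epure 1 (a2 * b) * delta H a1) (comul H a) = epure a b.
Proof.
pose f (u v w : A) : env A := epure u (antipode H v * w * b).
transitivity (tlift (fun a1 a2 => tlift (fun u v => f u v a2) (comul H a1)) (comul H a)).
  apply: eq_tlift => a1 a2; rewrite /delta.
  rewrite (@tlift_morph _ _ _ _ _ _ _ _ (fun t => epure 1 (a2 * b) * t)); last first.
    by move=> s t; rewrite mulrDr.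
  by apply: eq_tlift => u v; rewrite epureM mul1r /f mulrA.
rewrite sweedler3 => [|v w x y|u w x y|u v x y|c u v w|c u v w]; last 1 first.
- by rewrite /f linearZ /= -!scalerAl -!scalerAr -scalerAl.
- transitivity (tlift (fun x y => epure (counit H y *: x) b) (comul H a)).
    apply: eq_tlift => x y; rewrite /f.
    transitivity (epure x ((counit H y)%:A * b)); last by rewrite mulr_algl epureZ.
    rewrite -(hopf_antipodel H y).
    rewrite (@tlift_morph _ _ _ _ _ _ _ _ (fun t => epure x (t * b))) //.
    by move=> s t; rewrite mulrDl epureDr.
  rewrite -{2}(hopf_counitr H a).
  rewrite (@tlift_morph _ _ _ _ _ _ _ _ (fun t => epure t b)) //.
  by move=> s t; rewrite epureDl.
- by rewrite /f epureDl.
- by rewrite /f linearD !mulrDl epureDr.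
- by rewrite /f mulrDr mulrDl epureDr.
- by rewrite /f linearZ /= -!scalerAl epureZ.
Qed.

Lemma delta_scalar (c : k) : delta H c%:A = epure c%:A 1.
Proof.
rewrite /delta comul_scalar tlift_pure ?antipode1 //.
split=> [x x' y|x y y'|x d y]; rewrite ?epureDl ?linearD ?epureDr //.
by rewrite /scl_r /scl_l linearZ /= epureZ.
Qed.
End Sweedler.

Section Untwist.
Variables (k : fieldType) (A : falgType k) (H : hopf A).

(* The isomorphism A^e (x)_delta(A) X = X (x)_k A, (a (x) b) (x) x |-> a (x (x) b),
   followed by [b |-> b m] on the second factor. *)
Section Map.
Variables (X M : lmodType A) (m : M).

Definition untwist_env (s : env A) (x : X) : ktens H X M :=
  tlift (fun a b => a *: kpure H x ((b : A) *: m)) s.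
Lemma untwist_env_bal (x : X) : balanced (@scl_r k A) (@scl_l k A^c)
  (fun a b => a *: kpure H x ((b : A) *: m)).
Proof.
split=> [a a' b|a b b'|a c b]; first by rewrite scalerDl.
  by rewrite (scalerDl m) kpureDr scalerDr.
rewrite /scl_r /scl_l -(mulr_algr c a) -scalerA kpure_scalar scalerA.
by congr (_ *: kpure H x (_ *: m)); rewrite mulr_algl.
Qed.
Lemma untwist_envE a b (x : X) : untwist_env (epure a b) x = a *: kpure H x (b *: m).
Proof. by rewrite /untwist_env tlift_pure //; exact: untwist_env_bal. Qed.
Lemma untwist_envDl (x : X) : {morph untwist_env^~ x : s t / s + t}.
Proof. by move=> s t; rewrite /untwist_env tliftD //; exact: untwist_env_bal. Qed.
Lemma untwist_envDr s : {morph untwist_env s : x y / x + y}.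
Proof.
move=> x y; rewrite /untwist_env -tlift_fD; apply: eq_tlift => a b.
by rewrite kpureDl scalerDr.
Qed.

Definition untwist (t : induced (delta H) X) : ktens H X M := tlift untwist_env t.
(** On a (x) b the right factor delta(h) yields the sum of a h_1 (x (x) S(h_2) b m), which
    [kpure_antipode] identifies with a (h x (x) b m). *)
Lemma untwist_bal : balanced (iact_r (delta H)) (@iact_l A X) untwist_env.
Proof.
split=> [s s' x|s x x'|s h x]; [exact: untwist_envDl | exact: untwist_envDr |].
rewrite /iact_r /iact_l; move: s; apply: env_ext => [s t|s t|a b].
- by rewrite mulrDl untwist_envDl.
- exact: untwist_envDl.
rewrite untwist_envE -kpure_antipode /delta.
rewrite (@tlift_morph _ _ _ _ _ _ _ _ (fun t => epure a b * t)); last first.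
  by move=> s t; rewrite mulrDr.
rewrite (@tlift_morph _ _ _ _ _ _ _ _ _ _ (untwist_envDl x)).
rewrite (@tlift_morph _ _ _ _ _ _ _ _ (fun t : ktens H X M => a *: t)); last first.
  by move=> s t; rewrite scalerDr.
by apply: eq_tlift => u v; rewrite epureM untwist_envE !scalerA.
Qed.
Lemma untwistE a b (x : X) : untwist (ipure (delta H) (epure a b) x) = a *: kpure H x (b *: m).
Proof. by rewrite /untwist tlift_pure ?untwist_envE //; exact: untwist_bal. Qed.
Lemma untwistD : {morph untwist : s t / s + t}.
Proof. by move=> s t; rewrite /untwist tliftD //; exact: untwist_bal. Qed.
End Map.

Lemma induced_ext2 (X : lmodType A) (Z : zmodType) (f g : induced (delta H) X -> Z) :
  {morph f : x y / x + y} -> {morph g : x y / x + y} ->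
  (forall a b x, f (ipure (delta H) (epure a b) x) = g (ipure (delta H) (epure a b) x)) ->
  f =1 g.
Proof.
move=> fD gD E; apply: induced_ext => // s x; move: s.
by apply: env_ext => [s t|s t|a b]; rewrite ?ipureDl ?fD ?gD.
Qed.

Lemma untwist_left (X M : lmodType A) (m : M) c (t : induced (delta H) X) :
  untwist m (epure c 1 *: t) = c *: untwist m t.
Proof.
move: t; apply: induced_ext2 => [s t|s t|a b x].
- exact: etrans (congr1 _ (iactDr _ _ _)) (untwistD _ _ _).
- exact: etrans (congr1 _ (untwistD _ _ _)) (kactDr _ _ _).
by rewrite -[_ *: ipure _ _ _]/(iact _ _) iactE epureM mulr1 !untwistE scalerA.
Qed.
Lemma untwist_right (X M : lmodType A) (m : M) c (t : induced (delta H) X) :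
  untwist m (epure 1 c *: t) = untwist (c *: m) t.
Proof.
move: t; apply: induced_ext2 => [s t|s t|a b x].
- exact: etrans (congr1 _ (iactDr _ _ _)) (untwistD _ _ _).
- exact: untwistD.
by rewrite -[_ *: ipure _ _ _]/(iact _ _) iactE epureM mul1r !untwistE scalerA.
Qed.
Lemma untwistDm (X M : lmodType A) (t : induced (delta H) X) :
  {morph (fun m : M => untwist m t) : m m' / m + m'}.
Proof.
move=> m m'; move: t; apply: induced_ext2 => [s t|s t|a b x].
- exact: untwistD.
- exact: etrans (congr2 +%R (untwistD m s t) (untwistD m' s t)) (addrACA _ _ _ _).
by rewrite !untwistE scalerDr kpureDr scalerDr.
Qed.
Lemma untwist_imap (X X' M : lmodType A) (m : M) (f : {linear X ->
  X'}) (t : induced (delta H) X) :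
  untwist m (imap f t) = kmap f (untwist m t).
Proof.
move: t; apply: induced_ext2 => [s t|s t|a b x].
- exact: etrans (congr1 _ (imapD _ s t)) (untwistD _ _ _).
- exact: etrans (congr1 _ (untwistD _ s t)) (kmapD _ _ _).
by rewrite imapE !untwistE linearZ /= kmapE.
Qed.
Lemma untwist_contract (X M : lmodType A) (c : X -> trivmod H) (m : M) t :
  slin idfun c -> contractl c (untwist m t) = (icontract c t : A) *: m.
Proof.
move=> Lc; have [cD cZ] := slin_contractl M Lc.
move: t; apply: induced_ext2 => [s t|s t|a b x].
- exact: etrans (congr1 _ (untwistD m s t)) (cD _ _).
- by rewrite icontractD //; exact: (@scalerDl A M m).
rewrite untwistE cZ contractlE // icontractE // bireg_scaleE !scalerA.
by rewrite [in LHS]mulrA.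
Qed.

Definition retwist (X : lmodType A) (t : ktens H X A^o) : induced (delta H) X :=
  tlift (fun x b => ipure (delta H) (epure 1 (b : A)) x) t.
Lemma retwist_bal (X : lmodType A) : balanced (@kact_r _ _ X) (@kact_l _ _ A^o)
  (fun x b => ipure (delta H) (epure 1 (b : A)) x).
Proof.
split=> [x x' y|x y y'|x c y]; rewrite ?epureDr ?ipureDl ?ipureDr //.
rewrite /kact_r /kact_l -ipureM delta_scalar epureM !mul1r.
rewrite epureZ; congr (ipure _ (epure _ _) x).
exact: esym (mulr_algl c (y : A)).
Qed.
Lemma retwistE (X : lmodType A) x b :
  @retwist X (kpure H x b) = ipure (delta H) (epure 1 (b : A)) x.
Proof. by rewrite /retwist tlift_pure //; exact: retwist_bal. Qed.
Lemma retwistD (X : lmodType A) : {morph @retwist X : s t / s + t}.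
Proof. by move=> s t; rewrite /retwist tliftD //; exact: retwist_bal. Qed.
Lemma retwistK (X : lmodType A) : cancel (@untwist X A^o 1) (@retwist X).
Proof.
apply: induced_ext2 => [s t|//|a b x].
  exact: etrans (congr1 _ (untwistD _ s t)) (retwistD _ _).
rewrite untwistE kactE kact2_pure (@tlift_morph _ _ _ _ _ _ _ _ _ _ (@retwistD X)).
rewrite -[in RHS](delta_antipode H a b).
rewrite (@tlift_morph _ _ _ _ _ _ _ _ (fun t => ipure (delta H) t x)); last first.
  by move=> s t; rewrite ipureDl.
apply: eq_tlift => u v; rewrite retwistE -ipureM; congr (ipure _ (epure _ _ * _) _).
by rewrite -[_ *: (_ *: _)]/(v * (b * 1)) mulr1.
Qed.

(** [untwist] with m = 1 carries a cycle to the exact complex P (x)_k A, where it bounds; [retwist]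
    carries the bounding element back. *)
Lemma iseq_exact (P : aseq (trivmod H)) : proj_resolution P -> exact_resolution (iseq P).
Proof.
move=> Pr; have Ke := kseq_exact A^o Pr; have Pe := proj_resolution_exact Pr.
have [_ Pa _ _] := Pr; have [x0 x0E] := Pa (1 : k).
have u0 X : untwist (1 : A^o) (0 : induced (delta H) X) = 0.
  by apply: (@addrI _ (untwist (1 : A^o) (0 : induced (delta H) X)));
    rewrite addr0; exact: etrans (esym (untwistD _ _ _)) (congr1 _ (addr0 _)).
have i0 (X : lmodType A) s : ipure (delta H) s (0 : X) = 0.
  by apply: (addrI (ipure (delta H) s 0)); rewrite -ipureDr !addr0.
have r_imap n (t : ktens H (P n.+1) A^o) : retwist (kmap (bd P n) t) = imap (bd P n) (retwist t).
  move: t; apply: ktens_ext => [s t|s t|x b].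
  - exact: etrans (congr1 _ (kmapD _ s t)) (retwistD _ _).
  - exact: etrans (congr1 _ (retwistD s t)) (imapD _ _ _).
  by rewrite kmapE !retwistE imapE.
have exd n (x : ktens H (P n) A^o) (t : induced (delta H) (P n)) :
    untwist (1 : A^o) t = x -> (exists y, kmap (bd P n) y = x) -> exists y, imap (bd P n) y = t.
  move=> E [y yE]; exists (retwist y).
  by apply: etrans (esym (r_imap _ _)) _; rewrite yE -E; exact: retwistK.
split=> [y|x|n x] /=.
- exists (ipure (delta H) (epure y 1) x0); rewrite iaugE x0E bireg_scaleE mulr1.
  by rewrite scale1r mulr1.
- split=> [E|[y <-]].
    apply: (@exd 0%N _ x erefl); have [_ /(_ (untwist 1 x)) Ex _] := Ke; apply/Ex => /=.
    apply: etrans (untwist_contract _ _ (linear_slin (aug P))) _.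
    by rewrite -[icontract _ _]/(@iaug _ _ _ P x) E scale0r.
  move: y; apply: induced_ext2 => [s t|s t|a b x']; rewrite ?imapD ?iaugD ?addr0 //.
  by rewrite imapE iaugE (aug_bd Pe) scale0r scaler0.
- split=> [E|[y <-]].
    apply: (@exd n.+1 _ x erefl); have [_ _ /(_ n (untwist 1 x)) Ex] := Ke; apply/Ex => /=.
    by rewrite -untwist_imap E u0.
  move: y; apply: induced_ext2 => [s t|s t|a b x']; rewrite ?imapD ?addr0 //.
  by rewrite !imapE (bd_bd Pe) i0.
Qed.
End Untwist.

(** * Commutativity of the even cohomology *)

Section Total.
Variables (k : fieldType) (A : falgType k) (H : hopf A) (P : aseq (trivmod H)).

Section Term.
Variable n : nat.
(** The degree n part of P (x)_k P. Families over all i, j that vanish off i + j = n avoid transport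
    along equations between degrees. *)
Record tot := Tot {
  tc :> forall i j, ktens H (P i) (P j);
  tc_out : forall i j, (i + j)%N != n -> tc i j = 0
}.
HB.instance Definition _ := gen_eqMixin tot.
HB.instance Definition _ := gen_choiceMixin tot.
Lemma tot_eq (f g : tot) : (forall i j, f i j = g i j) -> f = g.
Proof.
case: f g => f fD [g gD] /= E.
have {}E : f = g by apply: functional_extensionality_dep => i;
  apply: functional_extensionality_dep => j.
by case: g / E gD => gD; rewrite (Prop_irrelevance fD gD).
Qed.
Definition tot_add (f g : tot) : tot.
Proof.
refine (@Tot (fun i j => f i j + g i j) _) => i j ne.
by rewrite !tc_out // addr0.
Defined.
Definition tot_opp (f : tot) : tot.
Proof. by refine (@Tot (fun i j => - f i j) _) => i j ne; rewrite tc_out // oppr0. Defined.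
Definition tot_zero : tot.
Proof. by refine (@Tot (fun i j => 0) _). Defined.
Lemma tot_addA : associative tot_add.
Proof. by move=> f g h; apply: tot_eq => i j /=; rewrite addrA. Qed.
Lemma tot_addC : commutative tot_add.
Proof. by move=> f g; apply: tot_eq => i j /=; rewrite addrC. Qed.
Lemma tot_add0 : left_id tot_zero tot_add.
Proof. by move=> f; apply: tot_eq => i j /=; rewrite add0r. Qed.
Lemma tot_addN : left_inverse tot_zero tot_opp tot_add.
Proof. by move=> f; apply: tot_eq => i j /=; rewrite addNr. Qed.
HB.instance Definition _ := GRing.isZmodule.Build tot tot_addA tot_addC tot_add0 tot_addN.
Definition tot_act (a : A) (f : tot) : tot.
Proof. by refine (@Tot (fun i j => a *: f i j) _) => i j ne; rewrite tc_out // scaler0. Defined.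
Lemma tot_actA a b f : tot_act a (tot_act b f) = tot_act (a * b) f.
Proof. by apply: tot_eq => i j /=; rewrite scalerA. Qed.
Lemma tot_act1 : left_id 1 tot_act.
Proof. by move=> f; apply: tot_eq => i j /=; rewrite scale1r. Qed.
Lemma tot_actDr : right_distributive tot_act +%R.
Proof. by move=> a f g; apply: tot_eq => i j /=; rewrite scalerDr. Qed.
Lemma tot_actDl f : {morph tot_act^~ f : a b / a + b}.
Proof. by move=> a b; apply: tot_eq => i j /=; rewrite scalerDl. Qed.
HB.instance Definition _ := GRing.Zmodule_isLmodule.Build A tot
  tot_actA tot_act1 tot_actDr tot_actDl.
Lemma totD (f g : tot) i j : (f + g) i j = f i j + g i j. Proof. by []. Qed.
Lemma totZ a (f : tot) i j : (a *: f) i j = a *: f i j. Proof. by []. Qed.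
Lemma tot0 i j : (0 : tot) i j = 0. Proof. by []. Qed.
End Term.

Local Notation sg i := ((-1) ^+ i : A).

Lemma sgS i : sg i.+1 = - sg i. Proof. by rewrite exprS mulN1r. Qed.
Lemma sg_comm i (a : A) : a * sg i = sg i * a.
Proof. by elim: i => [|i IH]; rewrite ?mul1r ?mulr1 // sgS mulrN IH mulNr. Qed.

Definition tot_bd n (t : tot n.+1) : tot n.
Proof.
refine (@Tot n (fun i j => kmap (bd P i) (t i.+1 j) + sg i *: kmapr (bd P j) (t i j.+1)) _).
by move=> i j ne; rewrite !tc_out ?addnS ?linear0 ?scaler0 ?addr0.
Defined.
Lemma tot_bdE n (t : tot n.+1) i j : tot_bd t i j =
  kmap (bd P i) (t i.+1 j) + sg i *: kmapr (bd P j) (t i j.+1).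
Proof. by []. Qed.
Lemma tot_bd_linear n : linear (@tot_bd n).
Proof.
move=> a x y; apply: tot_eq => i j; rewrite totD totZ !tot_bdE !totD !totZ.
rewrite kmapD kmaprD [kmap _ (a *: _)]linearZ [kmapr _ (a *: _)]linearZ /=.
by rewrite !scalerDr addrACA !scalerA sg_comm.
Qed.
HB.instance Definition _ n := GRing.isLinear.Build A (tot n.+1) (tot n) _
  (@tot_bd n) (@tot_bd_linear n).

Definition tot_aug (t : tot 0) : trivmod H := aug P (contractl (aug P) (t 0%N 0%N)).
Lemma tot_aug_linear : linear tot_aug.
Proof.
have [L1 L2] := slin_contractl (P 0%N) (linear_slin (aug P)).
by move=> a x y; rewrite /tot_aug L1 L2 linearP.
Qed.
HB.instance Definition _ := GRing.isLinear.Build A (tot 0) (trivmod H) _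
  tot_aug tot_aug_linear.

Definition tot_seq : aseq (trivmod H) :=
  @ASeq A (trivmod H) tot (fun n => @tot_bd n) tot_aug.

Hypothesis Pr : proj_resolution P.
Let Pe := proj_resolution_exact Pr.
Let La : slin idfun (aug P) := linear_slin (aug P).

Lemma tot_bd_bd n (t : tot n.+2) : tot_bd (tot_bd t) = 0.
Proof.
apply: tot_eq => i j; rewrite tot0 !tot_bdE kmapD kmaprD.
rewrite [kmap _ (_ *: _)]linearZ [kmapr _ (_ *: _)]linearZ /=.
have -> u : kmap (bd P i) (kmap (bd P i.+1) u) = 0 :> ktens H (P i) (P j).
  move: u; apply: ktens_ext => [x y|x y|x y]; rewrite ?kmapD ?addr0 //.
  by rewrite !kmapE (bd_bd Pe) kpure0l.
have -> u : kmapr (bd P j) (kmapr (bd P j.+1) u) = 0 :> ktens H (P i) (P j).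
  move: u; apply: ktens_ext => [x y|x y|x y]; rewrite ?kmaprD ?addr0 //.
  by rewrite !kmaprE (bd_bd Pe) kpure0r.
have -> u : kmap (bd P i) (kmapr (bd P j) u) = kmapr (bd P j) (kmap (bd P i) u).
  move: u; apply: ktens_ext => [x y|x y|x y]; rewrite ?kmapD ?kmaprD ?kmapD //.
  by rewrite kmapE !kmaprE kmapE.
by rewrite !scaler0 add0r addr0 sgS scaleNr addNr.
Qed.

(** Only the left factor is contracted: 1 = d S + S d + I pi, where S is s (x) P, pi = aug (x) P
    maps to P, and I v = x0 (x) v maps back. Exactness then follows from that of P. *)
Lemma tot_exact : exact_resolution tot_seq.
Proof.
have [x0 [s [x0E sD sZ s0 sd]]] := k_contraction Pr.
pose sL i j (t : ktens H (P i) (P j)) : ktens H (P i.+1) (P j) :=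
  tlift (fun x y => kpure H (s i x) y) t.
have sb i j : balanced (@kact_r _ _ (P i)) (@kact_l _ _ (P j)) (fun x y => kpure H (s i x) y).
  split=> [x x' y|x y y'|x c y]; rewrite ?sD ?kpureDl ?kpureDr //.
  by rewrite /kact_r sZ kpureZ.
have sLE i j x y : @sL i j (kpure H x y) = kpure H (s i x) y by rewrite /sL tlift_pure.
have sLD i j : {morph (@sL i j) : x y / x + y} by move=> x y; rewrite /sL tliftD.
have sL0 i j : @sL i j 0 = 0 by apply: (addrI (@sL i j 0)); rewrite -sLD !addr0.
have sLN i j u : @sL i j (- u) = - sL i j u.
  by apply: (addrI (@sL i j u)); rewrite -sLD !subrr sL0.
have sLsg i j l u : @sL i j (sg l *: u) = sg l *: sL i j u.
  elim: l u => [|l IH] u; first by rewrite !scale1r.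
  by rewrite sgS !scaleNr sLN IH.
have sLr i j u : kmapr (bd P j) (@sL i j.+1 u) = @sL i j (kmapr (bd P j) u).
  move: u; apply: ktens_ext => [x y|x y|x y]; rewrite ?sLD ?kmaprD ?sLD //.
  by rewrite sLE !kmaprE sLE.
have h0 j (u : ktens H (P 0%N) (P j)) :
    kmap (bd P 0) (sL 0%N j u) + kpure H x0 (contractl (aug P) u) = u.
  move: u; apply: ktens_ext => [x y|x y|x y] //.
    by rewrite sLD kmapD contractlD // kpureDr addrACA.
  by rewrite sLE kmapE contractlE // -kpureZ -kpureDl -s0 subrK.
have h1 i j (u : ktens H (P i.+1) (P j)) :
    kmap (bd P i.+1) (sL i.+1 j u) + sL i j (kmap (bd P i) u) = u.
  move: u; apply: ktens_ext => [x y|x y|x y] //.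
    by rewrite sLD !kmapD sLD addrACA.
  by rewrite sLE !kmapE sLE -kpureDl -sd.
pose S0 n (t : tot n) i j : ktens H (P i) (P j) :=
  match i return ktens H (P i) (P j) with 0%N => 0 | i'.+1 => sL i' j (t i' j) end.
have S0_out n (t : tot n) i j : (i + j)%N != n.+1 -> S0 n t i j = 0.
  by case: i => [|i] //= ne; rewrite tc_out.
pose S n (t : tot n) : tot n.+1 := Tot (@S0_out n t).
pose i0 n (v : P n) i j : ktens H (P i) (P j) :=
  match i return ktens H (P i) (P j) with
    0%N => kpure H x0 (@cid _ _ P n j v) | _ => 0 end.
have i0_out n (v : P n) i j : (i + j)%N != n -> i0 n v i j = 0.
  by case: i => [|i] //= ne; rewrite cid_neq ?kpure0r // eq_sym.
pose I n (v : P n) : tot n := Tot (@i0_out n v).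
have Ibd n (v : P n.+1) : tot_bd (I _ v) = I _ (bd P n v).
  apply: tot_eq => -[|i] j /=; rewrite !linear0 add0r ?scaler0 //.
  by rewrite scale1r kmaprE bd_cid.
(* For i = 0 the last term corrects S, because s contracts P only up to x0 aug; for i > 0 the mixed
   terms of d S and S d cancel by sign. *)
have hT n (t : tot n.+1) :
    t = tot_bd (S _ t) + S _ (tot_bd t) + I _ (contractl (aug P) (t 0%N n.+1)).
  apply: tot_eq => -[|i] j; rewrite !totD /=; last first.
    rewrite addr0 sLD sLsg sLr addrACA -scalerDl sgS addNr scale0r addr0.
    by rewrite h1.
  rewrite linear0 scaler0 !addr0; have [E|ne] := eqVneq n.+1 j.
    by case: j / E; rewrite cid_id h0.
  by rewrite cid_neq // kpure0r addr0 [t _ _]tc_out ?sL0 ?linear0 // eq_sym.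
have hT0 (t : tot 0) : t = tot_bd (S _ t) + I _ (contractl (aug P) (t 0%N 0%N)).
  apply: tot_eq => -[|i] j; rewrite !totD /=; last first.
    by rewrite [t i.+1 j]tc_out // [t i j.+1]tc_out ?addnS // !sL0 !linear0 scaler0 !addr0.
  rewrite linear0 scaler0 !addr0; have [E|ne] := eqVneq 0%N j.
    by case: j / E; rewrite cid_id h0.
  by rewrite cid_neq // kpure0r addr0 [t _ _]tc_out ?sL0 ?linear0 // eq_sym.
have S00 n : S n 0 = 0 by apply: tot_eq => -[|i] j //=; apply: sL0.
split=> [y|t|n t] /=.
- exists (I _ ((y : k)%:A *: x0)).
  rewrite /tot_aug /= cid_id contractlE // x0E scale1r scale1r linearZ /=.
  by rewrite -[LHS]/(counit H _ * (aug P x0 : k)) counit_scalar x0E mulr1.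
- split=> [E|[y <-]].
    have [_ /(_ (contractl (aug P) (t 0%N 0%N))) [+ _] _] := Pe => /(_ E)[w wE].
    by exists (S _ t + I _ w); rewrite linearD /= Ibd wE -hT0.
  rewrite /tot_aug /= contractlD // scale1r (contractl_kmapr _ _ La).
  rewrite linearD /= (aug_bd Pe) addr0.
  rewrite (contractl_kmap (c' := fun=> 0) _ La) ?contractl0 ?linear0 //.
    exact: slin_zero.
  by move=> x; rewrite (aug_bd Pe).
- split=> [E|[y <-]]; last exact: tot_bd_bd.
  have := congr1 (fun u : tot n => contractl (aug P) (u 0%N n)) E.
  rewrite /= contractlD // scale1r (contractl_kmapr _ _ La).
  rewrite (contractl_kmap (c' := fun=> 0) _ La) ?[contractl (fun=> 0) _]contractl0 //; first last.
  - by move=> x; rewrite (aug_bd Pe).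
  - exact: slin_zero.
  rewrite add0r.
  have -> : contractl (aug P) (0 : ktens H (P 0%N) (P n)) = 0.
    by apply: (addrI (contractl (aug P) 0)); rewrite -contractlD // !addr0.
  have [_ _ /(_ n) Ex] := Pe => /Ex[w wE].
  exists (S _ t + I _ w); rewrite linearD /= Ibd wE [RHS](hT n) E S00 addr0 //.
Qed.
End Total.

Lemma rng_morph_id (R : pzRingType) : rng_morph (@idfun R). Proof. by []. Qed.

Lemma rng_morph_rmorphism (R S : pzRingType) (theta : {rmorphism R -> S}) :
  rng_morph theta.
Proof. by split; [exact: rmorphD | exact: rmorphM]. Qed.

Lemma ext_cls_cohomologous (R : pzRingType) (Y Z : lmodType R) (P : aseq Y)
    (Q : aseq Z) (f g : chain_map P Q) :
  proj_resolution P -> exact_resolution Q ->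
  ext_cls f = ext_cls g <-> cohomologous idfun (bdc f) (bdc g).
Proof.
move=> Pr Qe; rewrite ext_clsP; split=> E.
  exact: (homotopic_cohomologous Qe) E.
by apply: (cohomologous_homotopic (@rng_morph_id R) Pr Qe) E; apply: chain_map_family.
Qed.

Lemma bdc_bound (R : pzRingType) (Y Z : lmodType R) (P : aseq Y) (Q : aseq Z)
    (f : chain_map P Q) : exists N, forall j x, (N < j)%N -> bdc f j x = 0.
Proof.
have [N fN] := cm_bound f; exists N => j x lt.
by rewrite /bdc fN ?linear0.
Qed.

Section Commutative.
Variables (k : fieldType) (A : falgType k) (H : hopf A) (P : aseq (trivmod H)).
Hypothesis Pr : proj_resolution P.
Let Pe := proj_resolution_exact Pr.
Let La : slin idfun (aug P) := linear_slin (aug P).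
Variable phi : forall n, P n -> tot P n.
Hypothesis F : chain_lift (C := tot_seq P) idfun idfun phi.

Let Lphi n i j : slin idfun (fun x : P n => phi x i j).
Proof.
have [/(_ n)[fD fZ] _ _] := F.
by split=> [x y|r x]; rewrite ?fD ?fZ.
Qed.
Let phi_bd n (x : P n.+1) i j : phi (bd P n x) i j =
  kmap (bd P i) (phi x i.+1 j) + (-1) ^+ i *: kmapr (bd P j) (phi x i j.+1).
Proof. by have [_ _ <-] := F. Qed.
Let phi_aug (x : P 0%N) : aug P (contractl (aug P) (phi x 0%N 0%N)) = aug P x.
Proof. by have [_ E _] := F; apply: E. Qed.

(** The composites of the diagonal [phi] with aug (x) P and P (x) aug both lift the identity of k,
    so pulling a cocycle back along either keeps its class. *)
Let projl n (x : P n) : P n := contractl (aug P) (phi x 0%N n).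
Let projr n (x : P n) : P n := contractr (aug P) (phi x n 0%N).

Let projl_lift : chain_lift (Q := P) (C := P) idfun idfun projl.
Proof.
split=> [n|x|n x].
- exact: (slin_comp (slin_contractl (P n) La) (Lphi n 0%N n)).
- exact: phi_aug.
rewrite /projl phi_bd contractlD // scale1r contractl_kmapr //.
rewrite (contractl_kmap (c' := fun=> 0) _ La) ?[contractl (fun=> 0) _]contractl0 ?add0r //.
  exact: slin_zero.
by move=> y; rewrite (aug_bd Pe).
Qed.
Let projr_lift : chain_lift (Q := P) (C := P) idfun idfun projr.
Proof.
split=> [n|x|n x].
- exact: (slin_comp (slin_contractr (P n) La) (Lphi n n 0%N)).
- by rewrite /projr contract_swap // phi_aug.
have [cD cZ] := slin_contractr (P n) La.
rewrite /projr phi_bd cD cZ contractr_kmap //.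
rewrite (contractr_kmapr (c' := fun=> 0) _ La) ?[contractr (fun=> 0) _]contractr0
  ?scaler0 ?addr0 //.
  exact: slin_zero.
by move=> y; rewrite (aug_bd Pe).
Qed.
Let id_lift : chain_lift (Q := P) (C := P) idfun idfun (fun n => idfun).
Proof. by split=> // n; split. Qed.

Section Twisted.
Variables (c : cochain P (trivmod H)) (N : nat).
Arguments c : clear implicits.
Hypotheses (Cc : cocycle idfun c) (cN : forall j x, (N < j)%N -> c j x = 0).

Let Lc j : slin idfun (c j). Proof. by case: Cc. Qed.
Let ccr n i j (x : P n) : contractr (c j) (kmapr (bd P j) (phi x i j.+1)) = 0 :> P i.
Proof. 
have [_ cd] := Cc.
rewrite (contractr_kmapr (c' := fun=> 0) _ (Lc j)) ?[contractr (fun=> 0) _]contractr0 //.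
exact: slin_zero.
Qed.
Let ccl n i j (x : P n) : contractl (c i) (kmap (bd P i) (phi x i.+1 j)) = 0 :> P j.
Proof. 
have [_ cd] := Cc.
rewrite (contractl_kmap (c' := fun=> 0) _ (Lc i)) ?[contractl (fun=> 0) _]contractl0 //.
exact: slin_zero.
Qed.

(** The chain map is (P (x) c) o phi. By [contract_swap], applying aug to it gives c o (aug (x) P) o
    phi, that is, c pulled back along [projl], which is cohomologous to c. *)
Lemma right_twist : exists f : chain_map P P,
  cohomologous idfun (bdc f) c /\
  forall n i x, (i <= n)%N -> f n i x = contractr (c (n - i)%N) (phi x i (n - i)%N).
Proof.
pose f n i (x : P n) := if (i <= n)%N then contractr (c (n - i)%N) (phi x i (n - i)%N)
  else 0 : P i.
have f_lin n i : semilin idfun (@f n i).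
  apply: slin_semilin; rewrite /f; case: (i <= n)%N; last exact: slin_zero.
  exact: (slin_comp (slin_contractr (P i) (Lc (n - i))) (Lphi n i (n - i))).
have f_deg n i x : (n < i)%N -> @f n i x = 0 by rewrite /f ltnNge => /negbTE ->.
have f_bound : exists N, forall j i x, (i + N < j)%N -> @f j i x = 0.
  exists N => j i x lt; rewrite /f; case: ifP => // le.
  by rewrite contractr0 // => y; rewrite cN // ltn_subRL.
have f_bd j i x : bd P i (@f j.+1 i.+1 x) = f j i (bd P j x).
  rewrite /f ltnS; case: ifP => [le|_]; last exact: linear0.
  have [cD cZ] := slin_contractr (P i) (Lc (j - i)).
  by rewrite phi_bd cD cZ ccr scaler0 addr0 subSS contractr_kmap.
exists (ChainMap f f_lin f_deg f_bound f_bd); split; last first.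
  by move=> n i x le /=; rewrite /f le.
apply: (cohomologous_trans (c' := fun n x => c n (projl x))).
  apply: cohomologous_eq => n x; rewrite /bdc /= /f leq0n subn0.
  by rewrite contract_swap.
exact: (cohomologous_lifts (@rng_morph_id A) Pr Pe projl_lift id_lift _ Cc).
Qed.

Hypothesis c_even : forall j x, (-1) ^+ j *: c j x = c j x.

(* [contractl (c i)] commutes with the differentials only up to (-1)^i. *)
Lemma left_twist : exists f : chain_map P P,
  cohomologous idfun (bdc f) c /\
  forall n i x, (i <= n)%N -> f n i x = contractl (c (n - i)%N) (phi x (n - i)%N i).
Proof.
(* A sign acts on k through the counit as the same sign, so evenness of c absorbs it. *)
have sgc j (M : lmodType A) t : (-1) ^+ j *: contractl (c j) t = contractl (c j) t :> M.
  move: t; apply: ktens_ext => [s t|s t|x m].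
  - by rewrite contractlD // scalerDr.
  - exact: contractlD.
  rewrite contractlE // -{2}c_even; have -> : (-1) ^+ j = ((-1) ^+ j : k)%:A :> A.
    by rewrite -signr_odd -[in RHS]signr_odd; case: odd; rewrite ?scaleN1r ?scale1r.
  by rewrite trivmodE counit_scalar scalerA mulr_algl scalerA.
pose f n i (x : P n) := if (i <= n)%N then contractl (c (n - i)%N) (phi x (n - i)%N i)
  else 0 : P i.
have f_lin n i : semilin idfun (@f n i).
  apply: slin_semilin; rewrite /f; case: (i <= n)%N; last exact: slin_zero.
  exact: (slin_comp (slin_contractl (P i) (Lc (n - i))) (Lphi n (n - i) i)).
have f_deg n i x : (n < i)%N -> @f n i x = 0 by rewrite /f ltnNge => /negbTE ->.
have f_bound : exists N, forall j i x, (i + N < j)%N -> @f j i x = 0.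
  exists N => j i x lt; rewrite /f; case: ifP => // le.
  by rewrite contractl0 // => y; rewrite cN // ltn_subRL.
have f_bd j i x : bd P i (@f j.+1 i.+1 x) = f j i (bd P j x).
  rewrite /f ltnS; case: ifP => [le|_]; last exact: linear0.
  have [cD cZ] := slin_contractl (P i) (Lc (j - i)).
  by rewrite phi_bd cD cZ ccl add0r sgc subSS contractl_kmapr.
exists (ChainMap f f_lin f_deg f_bound f_bd); split; last first.
  by move=> n i x le /=; rewrite /f le.
apply: (cohomologous_trans (c' := fun n x => c n (projr x))).
  apply: cohomologous_eq => n x; rewrite /bdc /= /f leq0n subn0.
  by rewrite -contract_swap.
exact: (cohomologous_lifts (@rng_morph_id A) Pr Pe projr_lift id_lift _ Cc).
Qed.
End Twisted.

(* Replace f and g by the homotopic chain maps f' and g' of [left_twist] and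
   [right_twist]: f o g' and g o f' have the same cocycle, namely the external
   product of the cocycles of f and g pulled back along [phi]. *)
Lemma ext_even_comm (f g : chain_map P P) :
  (forall j x, (-1) ^+ j *: bdc f j x = bdc f j x) ->
  ext_cls f * ext_cls g = ext_cls g * ext_cls f :> Ext P P.
Proof.
move=> f_even.
have [Nf fN] := bdc_bound f; have [Ng gN] := bdc_bound g.
have Cf := bdc_cocycle Pe (chain_map_family f).
have Cg := bdc_cocycle Pe (chain_map_family g).
have [f' [f'c f'E]] := left_twist Cf fN f_even.
have [g' [g'c g'E]] := right_twist Cg gN.
have Ef : ext_cls f' = ext_cls f by apply/(ext_cls_cohomologous _ _ Pr Pe).
have Eg : ext_cls g' = ext_cls g by apply/(ext_cls_cohomologous _ _ Pr Pe).
rewrite -[X in _ * X]Eg -[X in _ = _ * X]Ef.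
rewrite -[LHS]/(ext_comp _ _) -[RHS]/(ext_comp _ _) !ext_compE.
apply/(ext_cls_cohomologous _ _ Pr Pe); apply: cohomologous_eq => n x.
rewrite /bdc /= !linear_sum (reindex_inj rev_ord_inj) /=.
apply: eq_bigr => i _; have le : (i <= n)%N by rewrite -ltnS.
rewrite subSS g'E ?leq_subr // f'E // -[LHS]/(bdc f _ _) -[RHS]/(bdc g _ _).
by rewrite (subKn le) contract_swap; [|case: Cf|case: Cg].
Qed.
End Commutative.

Lemma Hev_comm (k : fieldType) (A : falgType k) (H : hopf A) (P : aseq (trivmod H))
    (e e' : Ext P P) :
  proj_resolution P -> Hev P e -> Hev P e' -> e * e' = e' * e.
Proof.
move=> Pr He _; have [phi F] := chain_lift_exists (@rng_morph_id A) Pr (tot_exact Pr)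
  (conj (fun _ _ => erefl) (fun _ _ => erefl) : slin idfun (@idfun (trivmod H))).
have [f fE f_even] : exists2 f : chain_map P P, ext_cls f = e &
    forall j x, (-1) ^+ j *: bdc f j x = bdc f j x.
  (* In characteristic 2 the signs are 1; in the other case the representative f has no cocycle
     components of odd degree. *)
  case: He => [char2|[f <- f0]].
    exists (ext_rep e) => [|j x]; first exact: ext_repK.
    rewrite -[LHS]/(counit H ((-1) ^+ j) * (bdc (ext_rep e) j x : k)).
    rewrite rmorphXn rmorphN1 (_ : -1 = 1) ?expr1n ?mul1r //.
    by apply/eqP; rewrite eq_sym -addr_eq0; have /andP[_] := char2.
  exists f => // j x; rewrite -signr_odd; case E: (odd j); last by rewrite scale1r.
  by rewrite /bdc f0 ?subn0 // linear0 scaler0.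
by rewrite -fE -[e']ext_repK; apply: (ext_even_comm Pr F).
Qed.

(** * Maps between Ext algebras *)

Section Scale.
Variables (k : fieldType) (R S : algType k) (theta : R -> S).
Lemma slin_scale (U : lmodType R) (V : lmodType S) (f : U -> V) (a : k) :
  slin theta f -> slin theta (fun x => a%:A *: f x).
Proof.
move=> [fD fZ]; split=> [x y|r x]; first by rewrite fD scalerDr.
by rewrite fZ !scalerA mulr_algl mulr_algr.
Qed.
Lemma cohomologous_scale (Y : lmodType R) (Z : lmodType S) (Q : aseq Y)
    (c c' : cochain Q Z) (a : k) : cohomologous theta c c' ->
  cohomologous theta (fun j x => a%:A *: c j x) (fun j x => a%:A *: c' j x).
Proof.
case=> g [Lg g0 gd]; exists (fun j x => a%:A *: g j x); split=> [j|x|j x].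
- exact: slin_scale.
- by rewrite g0.
- by rewrite -scalerBr gd.
Qed.
End Scale.

Lemma ext_of_cocycle (R : pzRingType) (Y Z : lmodType R) (P : aseq Y) (Q : aseq Z)
    (c : cochain P Z) N : proj_resolution P -> exact_resolution Q ->
  cocycle idfun c -> (forall j x, (N < j)%N -> c j x = 0) ->
  exists f : chain_map P Q, forall j x, bdc f j x = c j x.
Proof.
move=> Pr Qe Cc cN.
have [u [[Lu u0 ud] uE uN]] := lift_cocycle (@rng_morph_id R) Pr Qe Cc.
have ul j i : semilin idfun (u j i) by apply: slin_semilin.
by exists (ChainMap u ul u0 (ex_intro _ N (uN N cN)) ud).
Qed.

Lemma id_chain_lift (R : pzRingType) (Y : lmodType R) (P : aseq Y) :
  chain_lift (Q := P) (C := P) idfun idfun (fun n => idfun).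
Proof. by split=> // n; split. Qed.

Lemma slin_idfun (R : pzRingType) (U : lmodType R) : slin idfun (@idfun U).
Proof. by split. Qed.

Definition alg_hom (k : fieldType) (R S : algType k) (Y : lmodType R)
    (Z : lmodType S) (P : aseq Y) (Q : aseq Z) (G : Ext P P -> Ext Q Q) : Prop :=
  [/\ {morph G : x y / x + y}, {morph G : x y / x * y}, G 1 = 1 &
      forall (c : k) x, G (c *: x) = c *: G x].

Section RelHom.
Variables (k : fieldType) (R S : algType k) (Y : lmodType R) (Z : lmodType S).
Variables (P : aseq Y) (Q : aseq Z) (Rel : chain_map P P -> chain_map Q Q -> Prop).

(** A relation that depends only on the class on the left, determines the class on the right and
    respects the operations; any map selected from it, here by [xget], is an algebra
    homomorphism. *)
Definition rel_hom : Prop :=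
  [/\ forall f f' g, ext_cls f = ext_cls f' -> Rel f g -> Rel f' g,
      forall f g g', Rel f g -> (Rel f g' <-> ext_cls g = ext_cls g') &
   [/\ forall f f' g g', Rel f g -> Rel f' g' -> Rel (cm_add f f') (cm_add g g'),
      forall f f' g g', Rel f g -> Rel f' g' -> Rel (cm_comp f f') (cm_comp g g'),
      Rel (cm_id P) (cm_id Q) &
      forall c f g, Rel f g -> Rel (cm_scale c f) (cm_scale c g)]].

Lemma rel_hom_alg_hom (G : Ext P P -> Ext Q Q) : rel_hom ->
  (forall e, Rel (ext_rep e) (ext_rep (G e))) -> alg_hom G.
Proof.
case=> RI RU [RD RM R1 RZ] RG.
have GE f g : Rel f g -> G (ext_cls f) = ext_cls g.
  move=> r; rewrite -[LHS]ext_repK; apply/(RU _ _ _ (RG (ext_cls f))).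
  by apply: RI r; rewrite ext_repK.
split=> [x y|x y||c x].
- exact: GE (RD _ _ _ _ (RG x) (RG y)).
- exact: GE (RM _ _ _ _ (RG x) (RG y)).
- exact: GE R1.
- exact: GE (RZ c _ _ (RG x)).
Qed.
End RelHom.

Section OverFunctor.
Variables (k : fieldType) (R S : algType k) (X : lmodType R) (Y : lmodType S).
Variables (P : aseq X) (Q C : aseq Y) (F : chain_map P P -> family C C).
Arguments F : clear implicits.
Hypotheses (Pr : proj_resolution P) (Qr : proj_resolution Q) (Ce : exact_resolution C).
Variables (phi : forall n, Q n -> C n) (Hphi : chain_lift idfun idfun phi).

(** Covers - (x)_k M, - (x)_C M and A^e (x)_delta(A) -. Only cocycles are compared, as they
    determine chain families up to homotopy. *)
Definition chain_functor : Prop :=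
  [/\ forall f, chain_family idfun (F f),
      forall f g : chain_map P P, cohomologous idfun (bdc f) (bdc g) ->
        cohomologous idfun (bdc (F f)) (bdc (F g)),
      forall f, exists N, forall j x, (N < j)%N -> bdc (F f) j x = 0 &
   [/\ forall f g j x, bdc (F (cm_add f g)) j x = bdc (F f) j x + bdc (F g) j x,
       forall f g j x,
         bdc (F (cm_comp f g)) j x = bdc (comp_family (F f) (F g)) j x,
       forall j x, bdc (F (cm_id P)) j x = bdc (cm_id C) j x &
       forall c f j x, bdc (F (cm_scale c f)) j x = c%:A *: bdc (F f) j x]].

Hypothesis FF : chain_functor.
Definition functor_rel (f : chain_map P P) (g : chain_map Q Q) : Prop :=
  over idfun idfun phi g (F f).

Let Qe := proj_resolution_exact Qr.
Let Pe := proj_resolution_exact Pr.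

Lemma functor_rel_exists f : exists g, functor_rel f g.
Proof.
have [Fc _ Fb _] := FF; have [N FN] := Fb f.
have Cc := cocycle_lift Hphi (bdc_cocycle Ce (Fc f)).
have [|g gE] := ext_of_cocycle (N := N) Qr Qe Cc; first by move=> j x; apply: FN.
by exists g; apply: cohomologous_eq => j x; apply: gE.
Qed.

Lemma functor_rel_hom : rel_hom functor_rel.
Proof.
have [Fc Fh _ [FD FM F1 FZ]] := FF; split.
- move=> f f' g /(ext_cls_cohomologous _ _ Pr Pe) E r.
  apply: cohomologous_trans r _.
  by apply: (cohomologous_lift (th2 := idfun) Hphi); apply: Fh.
- move=> f g g' r; split=> [r'|/(ext_cls_cohomologous _ _ Qr Qe) E].
    apply/(ext_cls_cohomologous _ _ Qr Qe).
    exact: cohomologous_trans r (cohomologous_sym r').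
  exact: cohomologous_trans (cohomologous_sym E) r.
split.
- move=> f f' g g' r r'.
  apply: cohomologous_trans (cohomologous_trans _ (cohomologousD r r')) _.
    by apply: cohomologous_eq => j x; rewrite /bdc linearD.
  by apply: cohomologous_eq => j x; rewrite FD.
- move=> f f' g g' r r'.
  have E := over_mul (@rng_morph_id S) Qr Ce (@slin_idfun _ _) Hphi
    (chain_map_family g) (chain_map_family g') (Fc f) (Fc f') erefl r r'.
  apply: cohomologous_trans E _.
  by apply: cohomologous_eq => j x; rewrite FM.
- apply: cohomologous_eq => -[|j] x; rewrite F1 /bdc /=; last first.
    by rewrite !cid_neq // !linear0.
  by rewrite !cid_id; case: Hphi => _ -> _.
- move=> c f g r; apply: cohomologous_trans (cohomologous_trans _ (cohomologous_scale c r)) _.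
    by apply: cohomologous_eq => j x; rewrite /bdc /= linearZ.
  by apply: cohomologous_eq => j x; rewrite FZ.
Qed.

(** The set is nonempty, so [xget] returns one of its elements rather than the default 0. *)
Lemma functor_rel_xget (f : chain_map P P) :
  functor_rel f (ext_rep (xget 0 [set e : Ext Q Q |
    @lies_over S S idfun Y Y Q C id (ext_rep e) (F f)]%classic)).
Proof.
have [Fc _ _ _] := FF; have [_ RU _] := functor_rel_hom.
have [g r] := functor_rel_exists f.
case: xgetP => [e _ /= E|]; last first.
  move=> /(_ (ext_cls g)); case.
  apply/(lies_overP (@rng_morph_id S) Qr Ce erefl Hphi) => //.
    exact: chain_map_family.
  by apply/(RU _ _ _ r); rewrite ext_repK.
apply/(lies_overP (@rng_morph_id S) Qr Ce erefl Hphi) => //.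
exact: chain_map_family.
Qed.
End OverFunctor.

Lemma slin_bdc (R : pzRingType) (Y Z : lmodType R) (P : aseq Y) (Q : aseq Z)
    (f : chain_map P Q) j : slin idfun (bdc f j).
Proof. exact: (slin_comp (linear_slin (aug Q)) (linear_slin (cm f j 0%N))). Qed.

Lemma cm_comp_family (R : pzRingType) (Y : lmodType R) (P : aseq Y) (f g : chain_map P P) :
  chain_family idfun (comp_family f g).
Proof. exact: (chain_map_family (cm_comp f g)). Qed.

Lemma ipure0r (R S : pzRingType) (theta : R -> S) (X : lmodType R) s :
  ipure theta s (0 : X) = 0.
Proof. by apply: (addrI (ipure theta s 0)); rewrite -ipureDr !addr0. Qed.

Lemma ipure_sumr (R S : pzRingType) (theta : R -> S) (X : lmodType R) s I (r : seq I)
    (F : I -> X) : ipure theta s (\sum_(i <- r) F i) = \sum_(i <- r) ipure theta s (F i).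
Proof. exact: (big_morph (ipure theta s) (fun x y => ipureDr theta s x y) (ipure0r theta
  X s)). Qed.

Lemma bpure_suml (k : fieldType) (C : falgType k) (X : lmodType (env C))
    (M : lmodType C) (m : M) I (r : seq I) (F : I -> X) :
  bpure (\sum_(i <- r) F i) m = \sum_(i <- r) bpure (F i) m.
Proof. exact: (big_morph (fun x : X => bpure x m) (fun x y => bpureDl x y m) (bpure0l X m)). Qed.

Lemma kpure_suml (k : fieldType) (A : falgType k) (H : hopf A) (X M : lmodType A)
    (m : M) I (r : seq I) (F : I -> X) :
  kpure H (\sum_(i <- r) F i) m = \sum_(i <- r) kpure H (F i) m.
Proof. exact: (big_morph (fun x : X => kpure H x m) (fun x y => kpureDl H x y m) (kpure0l
  H X m)). Qed.

Lemma env_scalar (k : fieldType) (C : falgType k) (c : k) : c%:A = epure c%:A 1 :> env C.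
Proof. exact: (@ascaleE k C C^c c 1 1). Qed.

(** * The tensor and induction functors on chain maps *)

Section BMap.
Variables (k : fieldType) (C : falgType k) (P : aseq (bireg C)) (M : lmodType C).
Definition bmap_family (f : chain_map P P) : family (bseq P M) (bseq P M) :=
  fun j i => bmap (f j i).

Lemma bdc_bmap_family (f : chain_map P P) j t :
  bdc (bmap_family f) j t = bcontract (bdc f j) t.
Proof.
have L := slin_bdc f j.
move: t; apply: btens_ext => [t t'|t t'|x m].
- by rewrite /bdc /bmap_family bmapD linearD.
- exact: bcontractD.
by rewrite bcontractE // -[LHS]/(@baug _ _ P M (bmap _ _)) bmapE baugE.
Qed.

Lemma bmap_chain_functor : chain_functor bmap_family.
Proof.
split.
- move=> f; split=> [j i|j i|j i].
  + exact: linear_slin.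
  + move=> + lt; apply: btens_ext => [t t'|t t'|x m]; rewrite /bmap_family ?bmapD ?addr0 //.
    by rewrite bmapE /= cm_deg // bpure0l.
  + apply: btens_ext => [t t'|t t'|x m]; rewrite /bmap_family /= ?bmapD //.
    by rewrite !bmapE cm_bd.
- move=> f f' [g [Lg g0 gd]].
  have L := slin_bdc f; have L' := slin_bdc f'.
  exists (fun j => bcontract (g j)); split=> [j|t|j].
  + exact: slin_bcontract.
  + by rewrite !bdc_bmap_family; apply: eq_tlift => ? ?; rewrite g0.
  + apply: btens_ext => [t t'|t t'|x m].
    * by rewrite !bdc_bmap_family !bcontractD // opprD addrACA.
    * by rewrite /= bmapD bcontractD.
    by rewrite !bdc_bmap_family /= bmapE !bcontractE // -gd -scalerBl.
- move=> f; have [N fN] := bdc_bound f; exists N => j t lt.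
  rewrite bdc_bmap_family /bcontract /tlift /tsum big1 // => p _.
  by rewrite fN // scale0r.
split=> [f g j t|f g j|j|c f j t].
- rewrite !bdc_bmap_family /bcontract -tlift_fD; apply: eq_tlift => ? ?.
  by rewrite /bdc linearD; exact: (@scalerDl C M).
- have [Lc _ _] := cm_comp_family f g.
  have [Lf _ _] := chain_map_family f; have [Lg _ _] := chain_map_family g.
  have E i : forall t, bmap (cm_comp f g j i) t = comp_family (bmap_family f)
    (bmap_family g) j i t.
    apply: btens_ext => [t t'|t t'|x m].
    + exact: bmapD.
    + rewrite /comp_family -big_split; apply: eq_bigr => l _.
      by rewrite /= /bmap_family !bmapD.
    rewrite bmapE /comp_family bpure_suml.
    by apply: eq_bigr => l _; rewrite /bmap_family !bmapE.
  by move=> t; rewrite {1}/bdc {1}/bmap_family E.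
- have [Li _ _] := chain_map_family (cm_id P).
  suff E : forall t, bmap (cm_id P j 0%N) t = @cid _ _ (bseq P M) j 0%N t by move=> t;
    rewrite /bdc; congr (aug _ _); exact: E.
  have [E|ne] := eqVneq j 0%N.
    rewrite {}E; apply: btens_ext => [t t'|t t'|x m]; rewrite ?cid_id ?bmapD //.
    by rewrite bmapE /= cid_id.
  move=> t; rewrite cid_neq //; move: t.
  apply: btens_ext => [t t'|t t'|x m]; rewrite ?bmapD ?addr0 //.
  by rewrite bmapE /= cid_neq // bpure0l.
- rewrite !bdc_bmap_family; have L := slin_bdc f j; have L' := slin_bdc (cm_scale c f) j.
  move: t; apply: btens_ext => [t t'|t t'|x m].
  + exact: bcontractD.
  + by rewrite bcontractD // scalerDr.
  by rewrite !bcontractE // /bdc linearZ /= env_scalar bireg_scaleE mulr1 scalerA.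
Qed.
End BMap.

Section IMap.
Variables (k : fieldType) (A : falgType k) (H : hopf A) (P : aseq (trivmod H)).
Definition imap_family (f : chain_map P P) : family (iseq P) (iseq P) :=
  fun j i => imap (f j i).

Lemma bdc_imap_family (f : chain_map P P) j t :
  bdc (imap_family f) j t = icontract (bdc f j) t.
Proof.
have L := slin_bdc f j.
move: t; apply: induced_ext => [t t'|t t'|s x].
- by rewrite /bdc /imap_family imapD linearD.
- exact: icontractD.
by rewrite icontractE // -[LHS]/(@iaug _ _ _ P (imap _ _)) imapE iaugE.
Qed.

Lemma imap_chain_functor : chain_functor imap_family.
Proof.
split.
- move=> f; split=> [j i|j i|j i].
  + exact: linear_slin.
  + move=> + lt; apply: induced_ext => [t t'|t t'|s x]; rewrite /imap_family ?imapD ?addr0 //.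
    by rewrite imapE /= cm_deg // ipure0r.
  + apply: induced_ext => [t t'|t t'|s x]; rewrite /imap_family /= ?imapD //.
    by rewrite !imapE cm_bd.
- move=> f f' [g [Lg g0 gd]].
  have L := slin_bdc f; have L' := slin_bdc f'.
  exists (fun j => icontract (g j)); split=> [j|t|j].
  + exact: slin_icontract.
  + by rewrite !bdc_imap_family; apply: eq_tlift => ? ?; rewrite g0.
  + apply: induced_ext => [t t'|t t'|s x].
    * by rewrite !bdc_imap_family !icontractD // opprD addrACA.
    * by rewrite /= imapD icontractD.
    by rewrite !bdc_imap_family /= imapE !icontractE // -gd -scalerBr; congr (_ *: _);
      exact: (esym (@scalerBl k A _ _ _)).
- move=> f; have [N fN] := bdc_bound f; exists N => j t lt.
  rewrite bdc_imap_family /icontract /tlift /tsum big1 // => p _.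
  by rewrite fN // scale0r scaler0.
split=> [f g j t|f g j|j|c f j t].
- rewrite !bdc_imap_family /icontract -tlift_fD; apply: eq_tlift => ? ?.
  by rewrite /bdc linearD -scalerDr; congr (_ *: _); exact: (@scalerDl k A 1).
- have [Lc _ _] := cm_comp_family f g.
  have [Lf _ _] := chain_map_family f; have [Lg _ _] := chain_map_family g.
  have E i : forall t, imap (cm_comp f g j i) t = comp_family (imap_family f)
    (imap_family g) j i t.
    apply: induced_ext => [t t'|t t'|s x].
    + exact: imapD.
    + rewrite /comp_family -big_split; apply: eq_bigr => l _.
      by rewrite /= /imap_family !imapD.
    rewrite imapE /comp_family ipure_sumr.
    by apply: eq_bigr => l _; rewrite /imap_family !imapE.
  by move=> t; rewrite {1}/bdc {1}/imap_family E.
- have [Li _ _] := chain_map_family (cm_id P).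
  suff E : forall t, imap (cm_id P j 0%N) t = @cid _ _ (iseq P) j 0%N t by move=> t;
    rewrite /bdc; congr (aug _ _); exact: E.
  have [E|ne] := eqVneq j 0%N.
    rewrite {}E; apply: induced_ext => [t t'|t t'|s x]; rewrite ?cid_id ?imapD //.
    by rewrite imapE /= cid_id.
  move=> t; rewrite cid_neq //; move: t.
  apply: induced_ext => [t t'|t t'|s x]; rewrite ?imapD ?addr0 //.
  by rewrite imapE /= cid_neq // ipure0r.
- rewrite !bdc_imap_family; have L := slin_bdc f j; have L' := slin_bdc (cm_scale c f) j.
  move: t; apply: induced_ext => [t t'|t t'|s x].
  + exact: icontractD.
  + by rewrite icontractD // scalerDr.
  by rewrite !icontractE // /bdc linearZ /= trivmodE counit_scalar [RHS]scalerA mulr_algl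
    -(mulr_algr c s) -[RHS]scalerA env_scalar bireg_scaleE; congr (_ *: _);
      rewrite [RHS]mulr1; exact: etrans (esym (scalerA _ _ _)) (esym (mulr_algl _ _)).
Qed.
End IMap.

Section KMap.
Variables (k : fieldType) (A : falgType k) (H : hopf A) (P : aseq (trivmod H)) (M : lmodType A).
Definition kmap_family (f : chain_map P P) : family (kseq P M) (kseq P M) :=
  fun j i => kmap (f j i).

Lemma bdc_kmap_family (f : chain_map P P) j t :
  bdc (kmap_family f) j t = contractl (bdc f j) t.
Proof.
have L := slin_bdc f j.
move: t; apply: ktens_ext => [t t'|t t'|x m].
- by rewrite /bdc /kmap_family kmapD linearD.
- exact: contractlD.
by rewrite contractlE // -[LHS]/(@kaug _ _ _ P M (kmap _ _)) kmapE kaugE.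
Qed.

Lemma kmap_chain_functor : chain_functor kmap_family.
Proof.
split.
- move=> f; split=> [j i|j i|j i].
  + exact: linear_slin.
  + move=> + lt; apply: ktens_ext => [t t'|t t'|x m]; rewrite /kmap_family ?kmapD ?addr0 //.
    by rewrite kmapE /= cm_deg // kpure0l.
  + apply: ktens_ext => [t t'|t t'|x m]; rewrite /kmap_family /= ?kmapD //.
    by rewrite !kmapE cm_bd.
- move=> f f' [g [Lg g0 gd]].
  have L := slin_bdc f; have L' := slin_bdc f'.
  exists (fun j => contractl (g j)); split=> [j|t|j].
  + exact: slin_contractl.
  + by rewrite !bdc_kmap_family; apply: eq_tlift => ? ?; rewrite g0.
  + apply: ktens_ext => [t t'|t t'|x m].
    * by rewrite !bdc_kmap_family !contractlD // opprD addrACA.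
    * by rewrite /= kmapD contractlD.
    by rewrite !bdc_kmap_family /= kmapE !contractlE // -gd -scalerBl; congr (_ *: _);
      exact: (esym (@scalerBl k A _ _ _)).
- move=> f; have [N fN] := bdc_bound f; exists N => j t lt.
  rewrite bdc_kmap_family /contractl /tlift /tsum big1 // => p _.
  by rewrite fN // scale0r scale0r.
split=> [f g j t|f g j|j|c f j t].
- rewrite !bdc_kmap_family /contractl -tlift_fD; apply: eq_tlift => ? ?.
  by rewrite /bdc linearD !scalerDl.
- have [Lc _ _] := cm_comp_family f g.
  have [Lf _ _] := chain_map_family f; have [Lg _ _] := chain_map_family g.
  have E i : forall t, kmap (cm_comp f g j i) t = comp_family (kmap_family f)
    (kmap_family g) j i t.
    apply: ktens_ext => [t t'|t t'|x m].
    + exact: kmapD.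
    + rewrite /comp_family -big_split; apply: eq_bigr => l _.
      by rewrite /= /kmap_family !kmapD.
    rewrite kmapE /comp_family kpure_suml.
    by apply: eq_bigr => l _; rewrite /kmap_family !kmapE.
  by move=> t; rewrite {1}/bdc {1}/kmap_family E.
- have [Li _ _] := chain_map_family (cm_id P).
  suff E : forall t, kmap (cm_id P j 0%N) t = @cid _ _ (kseq P M) j 0%N t by move=> t;
    rewrite /bdc; congr (aug _ _); exact: E.
  have [E|ne] := eqVneq j 0%N.
    rewrite {}E; apply: ktens_ext => [t t'|t t'|x m]; rewrite ?cid_id ?kmapD //.
    by rewrite kmapE /= cid_id.
  move=> t; rewrite cid_neq //; move: t.
  apply: ktens_ext => [t t'|t t'|x m]; rewrite ?kmapD ?addr0 //.
  by rewrite kmapE /= cid_neq // kpure0l.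
- rewrite !bdc_kmap_family; have L := slin_bdc f j; have L' := slin_bdc (cm_scale c f) j.
  move: t; apply: ktens_ext => [t t'|t t'|x m].
  + exact: contractlD.
  + by rewrite contractlD // scalerDr.
  by rewrite !contractlE // /bdc linearZ /= trivmodE counit_scalar [RHS]scalerA mulr_algl
    [in RHS]scalerA.
Qed.
End KMap.

(* [S] is the corner of [R] cut out by the central idempotent [c]; for
   projective resolutions [Q] of [Y] and [C] of the corner [Z] of [Y], chain maps
   of [Q] then restrict to chain maps of [C]. *)
Section Corner.
Variables (k : fieldType) (R S : algType k) (theta : {rmorphism R -> S}) (iota : S -> R) (c : R).
Hypotheses (theta_scalar : forall a : k, theta a%:A = a%:A).
Hypotheses (iota_morph : rng_morph iota) (iotaK : cancel iota theta).
Hypotheses (thetaE : forall t, iota (theta t) = c * t) (c_comm : forall t, t * c = c * t).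
Variables (Y : lmodType R) (Z : lmodType S) (p : Y -> Z) (incl : Z -> Y).
Hypotheses (Lp : slin theta p) (Lincl : slin iota incl).
Hypotheses (inclK : cancel incl p) (pE : forall y, incl (p y) = c *: y).
Variables (Q : aseq Y) (C : aseq Z).
Hypotheses (Qr : proj_resolution Q) (Cr : proj_resolution C).
Variables (phi : forall n, Q n -> C n) (Hphi : chain_lift theta p phi).
Let Qe := proj_resolution_exact Qr.
Let Ce := proj_resolution_exact Cr.
Let th := rng_morph_rmorphism theta.

Lemma corner_section : exists psi : forall n, C n -> Q n, chain_lift iota incl psi.
Proof. exact: (chain_lift_exists iota_morph Cr Qe Lincl). Qed.

Lemma theta_iota : theta \o iota = idfun. Proof. by apply/funext => t; apply: iotaK. Qed.

Let theta_c : theta c = 1.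
Proof. by rewrite -[c]mulr1 -thetaE iotaK rmorph1. Qed.

Lemma corner_lift_id psi : chain_lift iota incl psi ->
  forall (c' : cochain C Z), cocycle idfun c' ->
  cohomologous idfun c' (fun j x => c' j (phi (psi j x))).
Proof.
move=> F c' Cc; have FF := chain_lift_comp F Hphi; rewrite theta_iota in FF.
apply: (cohomologous_lifts (@rng_morph_id S) Cr Ce (id_chain_lift C) FF _ Cc).
by move=> x /=; rewrite inclK.
Qed.

(** psi o phi and multiplication by c both lift y |-> c y, and a cocycle with values in Z does not
    notice c because theta(c) = 1. *)
Lemma corner_idempotent psi : chain_lift iota incl psi ->
  forall (c' : cochain Q Z), cocycle theta c' ->
  cohomologous theta c' (fun j x => c' j (psi j (phi x))).
Proof.
move=> F c' Cc.
(* iota o theta is multiplication by c, yet the composite is R-linear because c fixes the image of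
   psi. *)
have FF : chain_lift (Q := Q) (C := Q) idfun (incl \o p) (fun n => psi n \o phi (n := n)).
  have [L a d] := chain_lift_comp Hphi F; split=> // n; split=> [x y|r x].
    exact: slinD (L n).
  rewrite (slinZ _ _ (L n)) /= thetaE -c_comm -scalerA; congr (_ *: _).
  have [/(_ n) Lpsi _ _] := F; rewrite -[c]mulr1 -thetaE -(slinZ _ _ Lpsi) rmorph1.
  by rewrite scale1r.
have FC : chain_lift (Q := Q) (C := Q) idfun ( *:%R c) (fun n x => c *: x).
  split=> [n|x|n x]; rewrite ?linearZ //; split=> [x y|r x]; first by rewrite scalerDr.
  by rewrite !scalerA c_comm.
apply: (cohomologous_trans (c' := fun j x => c' j (c *: x))).
  apply: cohomologous_eq => j x; have [Lc _] := Cc.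
  by rewrite (slinZ _ _ (Lc j)) theta_c scale1r.
apply: (cohomologous_lifts (@rng_morph_id R) Qr Qe FC FF _ Cc).
by move=> x /=; rewrite pE.
Qed.

Definition corner_rel (f : chain_map Q Q) (g : chain_map C C) : Prop :=
  over theta p phi f g.

(** The cocycle of p o f on Q is moved to C along psi; pulling it back along phi returns its class
    by [corner_idempotent]. *)
Lemma corner_rel_exists f : exists g, corner_rel f g.
Proof.
have [psi F] := corner_section.
have [N fN] := bdc_bound f.
have Cf : cocycle theta (fun j x => p (bdc f j x)).
  have [L d] := bdc_cocycle Qe (chain_map_family f).
  split=> [j|j x]; first exact: (slin_comp Lp (L j)).
  by rewrite d (slin0 Lp).
have Cc := cocycle_lift F Cf; rewrite theta_iota in Cc.
have [|g gE] := ext_of_cocycle (N := N) Cr Ce Cc.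
  by move=> j x lt; rewrite fN // (slin0 Lp).
exists g; apply: cohomologous_trans (corner_idempotent F Cf) _.
by apply: cohomologous_eq => j x; rewrite gE.
Qed.

Lemma corner_rel_hom : rel_hom corner_rel.
Proof.
have [psi F] := corner_section; split.
- move=> f f' g /(ext_cls_cohomologous _ _ Qr Qe) E r.
  apply: cohomologous_trans r; apply: cohomologous_sym.
  exact: (cohomologous_post Lp E).
- move=> f g g' r; split=> [r'|/(ext_cls_cohomologous _ _ Cr Ce) E]; last first.
    by apply: cohomologous_trans r _; apply: (cohomologous_lift (th2 := idfun) Hphi).
  (* Uniqueness: the pullbacks of both cocycles to Q along phi are cohomologous, and pulling back
     further along psi recovers both classes on C. *)
  apply/(ext_cls_cohomologous _ _ Cr Ce).
  have := cohomologous_lift F (cohomologous_trans (cohomologous_sym r) r').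
  rewrite theta_iota => E.
  have Cg := bdc_cocycle Ce (chain_map_family g).
  have Cg' := bdc_cocycle Ce (chain_map_family g').
  apply: cohomologous_trans (corner_lift_id F Cg) _.
  apply: cohomologous_trans E _.
  exact: cohomologous_sym (corner_lift_id F Cg').
split.
- move=> f f' g g' r r'.
  apply: cohomologous_trans (cohomologous_trans _ (cohomologousD r r')) _.
    by apply: cohomologous_eq => j x; rewrite /bdc linearD (slinD _ _ Lp).
  by apply: cohomologous_eq => j x; rewrite /bdc linearD.
- move=> f f' g g' r r'.
  exact: (over_mul th Qr Ce Lp Hphi (chain_map_family f) (chain_map_family f')
    (chain_map_family g) (chain_map_family g') (rmorph1 _) r r').
- apply: cohomologous_eq => -[|j] x; rewrite /bdc /=; last first.
    by rewrite !cid_neq // !linear0 (slin0 Lp).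
  by rewrite !cid_id; case: Hphi => _ -> _.
- move=> a f g r; apply: cohomologous_trans (cohomologous_trans _ (cohomologous_scale a r)) _.
    by apply: cohomologous_eq => j x; rewrite /bdc linearZ (slinZ _ _ Lp) theta_scalar.
  by apply: cohomologous_eq => j x; rewrite /bdc linearZ.
Qed.

Lemma corner_rel_xget (f : chain_map Q Q) :
  corner_rel f (ext_rep (xget 0 [set z : Ext C C |
    @lies_over R S theta Y Z Q C p f (ext_rep z)]%classic)).
Proof.
have [_ RU _] := corner_rel_hom.
have [g r] := corner_rel_exists f.
case: xgetP => [e _ /= E|]; last first.
  move=> /(_ (ext_cls g)); case.
  apply/(lies_overP th Qr Ce (rmorph1 _) Hphi) => //; try exact: chain_map_family.
  by apply/(RU _ _ _ r); rewrite ext_repK.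
by apply/(lies_overP th Qr Ce (rmorph1 _) Hphi) => //; apply: chain_map_family.
Qed.
End Corner.

Lemma env1 (k : fieldType) (C : falgType k) : epure 1 1 = 1 :> env C.
Proof. by []. Qed.

(** * The principal block *)

Section BlockCorner.
Variables (k : fieldType) (A : falgType k) (H : hopf A) (B : principal_block H).
Local Notation C := (subvs_of B).
Local Notation p := (block_proj B).

Lemma block_projZ (a : k) (x : A) : p (a *: x) = a *: p x.
Proof. by rewrite /block_proj -scalerAl linearZ. Qed.

Lemma block_proj_scalar (a : k) : p a%:A = a%:A.
Proof. by rewrite block_projZ rmorph1. Qed.

Lemma block_proj_vsval (x : C) : p (vsval x) = x.
Proof. by apply: val_inj; rewrite /= block_projE algidr // subvsP. Qed.

Lemma block_projK (x : A) : vsval (p x) = x * algid B.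
Proof. exact: block_projE. Qed.

Let pb : balanced (@scl_r k A) (@scl_l k A^c) (fun a b => epure (p a) (p b)).
Proof.
split=> [x x' y|x y y'|x a y].
- by rewrite raddfD epureDl.
- exact: etrans (congr1 (epure _) (raddfD p _ _)) (epureDr _ _ _).
- rewrite /scl_r /scl_l block_projZ epureZ.
  by congr (epure _ _); apply: esym (block_projZ a (y : A)).
Qed.
Lemma block_proj_envE a b : block_proj_env B (epure a b) = epure (p a) (p b).
Proof. by rewrite /block_proj_env tlift_pure. Qed.
Lemma block_proj_envD : {morph block_proj_env B : s t / s + t}.
Proof. by move=> s t; rewrite /block_proj_env tliftD. Qed.
Lemma block_proj_envB : zmod_morphism (block_proj_env B).
Proof.
by move=> s t; apply: (addIr (block_proj_env B t)); rewrite -block_proj_envD !subrK.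
Qed.
Lemma block_proj_envM : monoid_morphism (block_proj_env B).
Proof.
split=> [|s t].
  by apply: etrans (block_proj_envE 1 1) _; rewrite rmorph1; apply: env1.
move: s; apply: env_ext => [s s'|s s'|a b].
- by rewrite mulrDl block_proj_envD.
- by rewrite block_proj_envD mulrDl.
move: t; apply: env_ext => [s s'|s s'|a' b'].
- by rewrite mulrDr block_proj_envD.
- by rewrite block_proj_envD mulrDr.
by rewrite epureM !block_proj_envE epureM !rmorphM.
Qed.
HB.instance Definition _ := GRing.isZmodMorphism.Build (env A) (env C)
  (block_proj_env B) block_proj_envB.
HB.instance Definition _ := GRing.isMonoidMorphism.Build (env A) (env C)
  (block_proj_env B) block_proj_envM.

Definition block_env_incl (t : env C) : env A :=
  tlift (fun a b => epure (vsval (a : C)) (vsval (b : C))) t.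
Let ib : balanced (@scl_r k C) (@scl_l k C^c)
  (fun a b => epure (vsval (a : C)) (vsval (b : C))).
Proof.
split=> [x x' y|x y y'|x a y]; rewrite ?linearD ?epureDl ?epureDr //.
by rewrite /scl_r /scl_l linearZ epureZ.
Qed.
Lemma block_env_inclE (a b : C) : block_env_incl (epure a b) = epure (vsval a) (vsval b).
Proof. by rewrite /block_env_incl tlift_pure. Qed.
Lemma block_env_incl_morph : rng_morph block_env_incl.
Proof.
have D : {morph block_env_incl : x y / x + y}.
  by move=> x y; rewrite /block_env_incl tliftD.
split=> // s t; move: s; apply: env_ext => [s s'|s s'|a b].
- by rewrite mulrDl D.
- by rewrite D mulrDl.
move: t; apply: env_ext => [s s'|s s'|a' b'].
- by rewrite mulrDr D.
- by rewrite D mulrDr.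
by rewrite epureM !block_env_inclE epureM.
Qed.
Lemma block_env_inclK : cancel block_env_incl (block_proj_env B).
Proof.
have [D _] := block_env_incl_morph.
apply: env_ext => [s s'|s s'|a b] //; first by rewrite D rmorphD.
by rewrite block_env_inclE block_proj_envE !block_proj_vsval.
Qed.
(** The central idempotent of A^e that cuts out B^e; it is the c of the corner argument. *)
Let e2 := epure (algid B : A) (algid B).
Lemma block_proj_envK t : block_env_incl (block_proj_env B t) = e2 * t.
Proof.
have [D _] := block_env_incl_morph.
move: t; apply: env_ext => [s s'|s s'|a b]; [by rewrite rmorphD D|by rewrite mulrDr|].
by rewrite block_proj_envE block_env_inclE !block_projK /e2 epureM block_algidC.
Qed.
Lemma block_env_central t : t * e2 = e2 * t.
Proof.
move: t; apply: env_ext => [s s'|s s'|a b]; [by rewrite mulrDl|by rewrite mulrDr|].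
by rewrite /e2 !epureM !block_algidC.
Qed.

Lemma slin_block_proj : slin (block_proj_env B) (p : bireg A -> bireg C).
Proof.
split=> [x y|t x]; first exact: (raddfD p).
move: t; apply: env_ext => [s s'|s s'|a b].
- by rewrite scalerDl; apply: (raddfD p).
- by rewrite rmorphD scalerDl.
by rewrite block_proj_envE !bireg_scaleE !rmorphM.
Qed.
Definition block_incl (x : bireg C) : bireg A := vsval (x : C).
Lemma slin_block_incl : slin block_env_incl block_incl.
Proof.
have [D _] := block_env_incl_morph.
split=> [x y|t x]; first exact: (linearD vsval).
have bD : {morph block_incl : x y / x + y} by move=> u v; apply: (linearD vsval).
move: t; apply: env_ext => [s s'|s s'|a b].
- by rewrite scalerDl bD.
- by rewrite D scalerDl.
by rewrite block_env_inclE bireg_scaleE /block_incl bireg_scaleE.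
Qed.
Lemma block_inclK : cancel block_incl (p : bireg A -> bireg C).
Proof. exact: block_proj_vsval. Qed.
Lemma block_inclE (y : bireg A) : block_incl (p y) = e2 *: y.
Proof.
rewrite /block_incl block_projK /e2 bireg_scaleE block_algidC.
by rewrite -mulrA algidl // memv_algid.
Qed.
Lemma block_proj_env_scalar (a : k) : block_proj_env B a%:A = a%:A.
Proof. by rewrite !env_scalar block_proj_envE block_proj_scalar rmorph1. Qed.
End BlockCorner.

Section Homs.
Variables (k : fieldType) (A : falgType k) (H : hopf A).
Variables (P : aseq (trivmod H)) (Pr : proj_resolution P).
Variables (PA : aseq (bireg A)) (PAr : proj_resolution PA).
Variables (B : principal_block H) (PB : aseq (bireg (subvs_of B))).
Hypothesis PBr : proj_resolution PB.
Local Notation C := (subvs_of B).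

Lemma HH_emb_rel chi : chain_lift (Q := PA) (C := iseq P) idfun idfun chi ->
  forall eta, functor_rel (@imap_family _ _ _ P) chi (ext_rep eta) (ext_rep (HH_emb P PA eta)).
Proof.
move=> F eta; exact: (functor_rel_xget Pr PAr (iseq_exact Pr) F (imap_chain_functor P)).
Qed.

Lemma HH_emb_alg_hom : alg_hom (HH_emb P PA).
Proof.
have [chi F] := chain_lift_exists (@rng_morph_id _) PAr (iseq_exact Pr) (@slin_idfun _ _).
exact: rel_hom_alg_hom (functor_rel_hom Pr PAr (iseq_exact Pr) F (imap_chain_functor P))
  (HH_emb_rel F).
Qed.

Lemma tens_B_rel (M : lmodType C) (Q : aseq M) (Qr : proj_resolution Q) phi :
  chain_lift (Q := Q) (C := bseq PB M) idfun idfun phi ->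
  forall z, functor_rel (@bmap_family _ _ PB M) phi (ext_rep z) (ext_rep (tens_B PB Q z)).
Proof.
move=> F z; exact: (functor_rel_xget PBr Qr (bseq_exact M PBr) F (bmap_chain_functor PB M)).
Qed.

Lemma tens_B_alg_hom (M : lmodType C) (Q : aseq M) :
  proj_resolution Q -> alg_hom (tens_B PB Q).
Proof.
move=> Qr.
have [phi F] := chain_lift_exists (@rng_morph_id _) Qr (bseq_exact M PBr) (@slin_idfun _ _).
exact: rel_hom_alg_hom (functor_rel_hom PBr Qr (bseq_exact M PBr) F (bmap_chain_functor PB M))
  (tens_B_rel Qr F).
Qed.

Lemma tens_k_rel (M : lmodType A) (Q : aseq M) (Qr : proj_resolution Q) phi :
  chain_lift (Q := Q) (C := kseq P M) idfun idfun phi ->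
  forall eta, functor_rel (@kmap_family _ _ _ P M) phi (ext_rep eta) (ext_rep (tens_k P Q eta)).
Proof.
move=> F z; exact: (functor_rel_xget Pr Qr (kseq_exact M Pr) F (kmap_chain_functor P M)).
Qed.

Lemma HH_proj_rel phi : chain_lift (Q := PA) (C := PB) (block_proj_env B) (block_proj B) phi ->
  forall e, corner_rel (block_proj_env B) (block_proj B : bireg A ->
    bireg C) phi (ext_rep e) (ext_rep (HH_proj PA PB e)).
Proof.
move=> F e; exact: (corner_rel_xget (@block_proj_env_scalar _ _ _ B) (block_env_incl_morph B)
  (@block_env_inclK _ _ _ B) (@block_proj_envK _ _ _ B) (@block_env_central _ _ _ B)
  (slin_block_proj B) (slin_block_incl B) (@block_inclK _ _ _ B) (@block_inclE _ _ _ B)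
  PAr PBr F).
Qed.

Lemma HH_proj_alg_hom : alg_hom (HH_proj PA PB).
Proof.
have [phi F] := chain_lift_exists (rng_morph_rmorphism (block_proj_env B)) PAr
  (proj_resolution_exact PBr) (slin_block_proj B).
have h := corner_rel_hom (@block_proj_env_scalar _ _ _ B) (block_env_incl_morph B)
  (@block_env_inclK _ _ _ B) (slin_block_proj B) (slin_block_incl B)
  (@block_inclK _ _ _ B) PAr PBr F.
exact: (@rel_hom_alg_hom _ _ _ _ _ _ _ _ _ h (HH_proj_rel F)).
Qed.
End Homs.

Lemma alg_hom0 (k : fieldType) (R S : algType k) (Y : lmodType R)
    (Z : lmodType S) (P : aseq Y) (Q : aseq Z) (G : Ext P P -> Ext Q Q) :
  alg_hom G -> G 0 = 0.
Proof. by case=> D _ _ _; apply: (addrI (G 0)); rewrite -D !addr0. Qed.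

Lemma functor_rel_eq0 (k : fieldType) (R S : algType k) (X : lmodType R)
    (Y : lmodType S) (P : aseq X) (Q C : aseq Y) (F : chain_map P P -> family C C)
    phi (f : chain_map P P) (e : Ext Q Q) : proj_resolution Q ->
  functor_rel F phi f (ext_rep e) ->
  (e = 0 <-> cohomologous idfun (fun j x => bdc (F f) j (phi j x)) (fun _ _ => 0)).
Proof.
move=> Qr r; have Qe := proj_resolution_exact Qr.
have Z : cohomologous idfun (bdc (cm_zero Q Q)) (fun _ _ => 0).
  by apply: cohomologous_eq => j x; rewrite /bdc linear0.
split=> [E|E].
  apply: cohomologous_trans (cohomologous_sym r) (cohomologous_trans _ Z).
  by apply/(ext_cls_cohomologous _ _ Qr Qe); rewrite ext_repK E.
rewrite -[e]ext_repK; apply/(ext_cls_cohomologous _ (cm_zero Q Q) Qr Qe).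
exact: cohomologous_trans (cohomologous_trans r E) (cohomologous_sym Z).
Qed.

Lemma bcontract_cohomologous (k : fieldType) (C : falgType k) (P : aseq (bireg C))
    (M : lmodType C) (c c' : cochain P (bireg C)) :
  (forall j, slin idfun (c j)) -> (forall j, slin idfun (c' j)) ->
  cohomologous idfun c c' ->
  cohomologous idfun (fun j => bcontract (M := M) (c j) : bseq P M j -> M)
    (fun j => bcontract (M := M) (c' j)).
Proof.
move=> L L' [g [Lg g0 gd]]; exists (fun j => bcontract (g j)); split=> [j|t|j].
- exact: slin_bcontract.
- by apply: eq_tlift => ? ?; rewrite g0.
apply: btens_ext => [t t'|t t'|x m].
- by rewrite !bcontractD // opprD addrACA.
- by rewrite /= bmapD bcontractD.
by rewrite /= bmapE !bcontractE // -gd -scalerBl.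
Qed.

(** * The action on M through A and through the block *)

Section Compare.
Variables (k : fieldType) (A : falgType k) (H : hopf A).
Variables (P : aseq (trivmod H)) (Pr : proj_resolution P).
Variables (PA : aseq (bireg A)) (PAr : proj_resolution PA).
Variables (B : principal_block H) (PB : aseq (bireg (subvs_of B))).
Hypothesis PBr : proj_resolution PB.
Local Notation C := (subvs_of B).
Variable M : lmodType C.
Local Notation Mi := (inflate M).
Local Notation D := (bseq PA Mi).

Section Alpha.
Variable chi : forall n, PA n -> iseq P n.
Arguments chi : clear implicits.
Hypothesis Hchi : chain_lift (Q := PA) (C := iseq P) idfun idfun chi.
Let Lchi n : slin idfun (chi n). Proof. by case: Hchi. Qed.

(** chi (x)_A M followed by (A^e (x)_delta(A) P_n) (x)_A M = P_n (x)_k M. *)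
Definition untwist_map n (t : D n) : kseq P Mi n := tlift (fun x m => untwist m (chi _ x)) t.
Let ub n : balanced (@bact_r _ _ (PA n)) (@bact_l _ _ Mi) (fun x m => untwist m (chi _ x)).
Proof.
split=> [x x' m|x m m'|x a m].
- by rewrite (slinD _ _ (Lchi n)); exact: untwistD.
- exact: untwistDm.
- by rewrite /bact_r (slinZ _ _ (Lchi n)); exact: untwist_right.
Qed.
Lemma untwist_mapD n : {morph @untwist_map n : t t' / t + t'}.
Proof. by move=> t t'; apply: tliftD (ub n). Qed.
Lemma untwist_mapE n x m : @untwist_map n (bpure x m) = untwist m (chi _ x).
Proof. exact: tlift_pure (ub n). Qed.

(** Contracting P by c corresponds to contracting the induced complex and then acting on M. This
    matches the two ways in which H^ev(A, k) acts. *)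
Lemma untwist_map_contract n (c : P n -> trivmod H) (t : D n) : slin idfun c ->
  contractl c (untwist_map t) = bcontract (fun x : PA n => icontract c (chi _ x)) t.
Proof.
move=> Lc.
have L : slin idfun (fun x : PA n => icontract c (chi _ x)).
  exact: (slin_comp (slin_icontract Lc) (Lchi n)).
move: t; apply: btens_ext => [t t'|t t'|x m].
- by apply: etrans (congr1 (contractl c) (untwist_mapD t t')) _; exact: contractlD.
- exact: bcontractD.
apply: etrans (congr1 _ (untwist_mapE _ _)) _.
by rewrite bcontractE //; exact: untwist_contract.
Qed.

Lemma untwist_map_lift : chain_lift (Q := D) (C := kseq P Mi) idfun idfun untwist_map.
Proof.
have [_ ca cd] := Hchi.
split=> [n|t|n].
- split=> [t t'|a]; first exact: untwist_mapD.
  apply: btens_ext => [t t'|t t'|x m].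
  + exact: etrans (congr1 _ (scalerDr _ _ _)) (untwist_mapD _ _).
  + exact: etrans (congr1 _ (untwist_mapD _ _)) (scalerDr _ _ _).
  rewrite -[_ *: bpure _ _]/(bact _ _) bactE !untwist_mapE (slinZ _ _ (Lchi n)).
  exact: untwist_left.
- apply: etrans (untwist_map_contract _ (linear_slin (aug P))) _.
  apply: eq_tlift => x m; congr (_ *: _); exact: ca.
apply: btens_ext => [t t'|t t'|x m].
- exact: etrans (congr1 _ (untwist_mapD _ _)) (linearD _ _ _).
- exact: etrans (congr1 _ (bmapD _ _ _)) (untwist_mapD _ _).
rewrite /= bmapE !untwist_mapE -cd; exact: esym (untwist_imap _ _ _).
Qed.
End Alpha.

Section Beta.
Variable phi : forall n, PA n -> PB n.
Arguments phi : clear implicits.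
Hypothesis Hphi : chain_lift (block_proj_env B) (block_proj B : bireg A -> bireg C) phi.
Let Lphi n : slin (block_proj_env B) (phi n). Proof. by case: Hphi. Qed.

Lemma block_proj_env_right a : block_proj_env B (epure 1 a) = epure 1 (block_proj B a).
Proof. by rewrite block_proj_envE rmorph1. Qed.
Lemma block_proj_env_left a : block_proj_env B (epure a 1) = epure (block_proj B a) 1.
Proof. by rewrite block_proj_envE rmorph1. Qed.

Definition block_map n (t : D n) : bseq PB M n := tlift (fun x m => bpure (phi _ x) (m : M)) t.
Let bb n : balanced (@bact_r _ _ (PA n)) (@bact_l _ _ Mi) (fun x m => bpure (phi _ x) (m : M)).
Proof.
split=> [x x' m|x m m'|x a m].
- by rewrite (slinD _ _ (Lphi n)) bpureDl.
- exact: bpureDr.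
- by rewrite /bact_r (slinZ _ _ (Lphi n)) block_proj_env_right bpureM.
Qed.
Lemma block_mapD n : {morph @block_map n : t t' / t + t'}.
Proof. by move=> t t'; apply: tliftD (bb n). Qed.
Lemma block_mapE n x m : @block_map n (bpure x m) = bpure (phi _ x) (m : M).
Proof. exact: tlift_pure (bb n). Qed.

Lemma block_map_lift :
  chain_lift (Q := D) (C := bseq PB M) (block_proj B) (fun m : Mi => m : M) block_map.
Proof.
have [_ pa pd] := Hphi.
split=> [n|t|n].
- split=> [t t'|a]; first exact: block_mapD.
  apply: btens_ext => [t t'|t t'|x m].
  + exact: etrans (congr1 _ (scalerDr _ _ _)) (block_mapD _ _).
  + exact: etrans (congr1 _ (block_mapD _ _)) (scalerDr _ _ _).
  rewrite -[_ *: bpure _ _]/(bact _ _) bactE !block_mapE (slinZ _ _ (Lphi n)).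
  by rewrite block_proj_env_left -[RHS]/(bact _ _) bactE.
- move: t; apply: btens_ext => [t t'|t t'|x m].
  + exact: etrans (congr1 _ (block_mapD _ _)) (linearD _ _ _).
  + exact: (linearD (aug D)).
  rewrite block_mapE /= !baugE; congr (_ *: _); exact: pa.
apply: btens_ext => [t t'|t t'|x m].
- exact: etrans (congr1 _ (block_mapD _ _)) (linearD _ _ _).
- exact: etrans (congr1 _ (bmapD _ _ _)) (block_mapD _ _).
by rewrite /= bmapE !block_mapE bmapE pd.
Qed.

(** The coboundary witnessing [corner_rel] takes values in B, so these values act on M; b is that
    coboundary tensored with M. *)
Lemma block_map_cohomologous (f : chain_map PA PA) (g : chain_map PB PB) :
  corner_rel (block_proj_env B) (block_proj B : bireg A -> bireg C) phi f g ->
  cohomologous (block_proj B)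
    (fun j (t : D j) => (bcontract (bdc f j) t : Mi) : M)
    (fun j (t : D j) => bcontract (bdc g j) (block_map t)).
Proof.
case=> h [Lh' h0 hd].
have Lh j : slin (block_proj_env B) (h j) := Lh' j.
have Lf := slin_bdc f; have Lg := slin_bdc g.
pose b j (t : D j) : M := tlift (fun x m => (h j x : C) *: (m : M)) t.
have hb j : balanced (@bact_r _ _ (PA j)) (@bact_l _ _ Mi) (fun x m => (h j x : C) *: (m : M)).
  split=> [x x' m|x m m'|x a m].
  - by rewrite (slinD _ _ (Lh j)); exact: (@scalerDl C M m).
  - exact: scalerDr.
  - by rewrite /bact_r (slinZ _ _ (Lh j)) block_proj_env_right bireg_scaleE mul1r -scalerA.
have bD j : {morph @b j : t t' / t + t'} by move=> t t'; apply: tliftD (hb j).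
have bE j x m : @b j (bpure x m) = (h j x : C) *: (m : M) by apply: tlift_pure (hb j).
exists b; split=> [j|t|j].
- split=> [t t'|a]; first exact: bD.
  apply: btens_ext => [t t'|t t'|x m].
  + exact: etrans (congr1 _ (scalerDr _ _ _)) (bD _ _ _).
  + exact: etrans (congr1 _ (bD _ _ _)) (scalerDr _ _ _).
  rewrite -[_ *: bpure _ _]/(bact _ _) bactE !bE (slinZ _ _ (Lh j)) block_proj_env_left.
  by rewrite bireg_scaleE mulr1 -scalerA.
- move: t; apply: btens_ext => [t t'|t t'|x m].
  + exact: (@bcontractD _ _ _ Mi _ (Lf 0%N) t t').
  + exact: etrans (congr1 (bcontract (bdc g 0%N)) (block_mapD t t')) (bcontractD (Lg _) _ _).
  by rewrite block_mapE !bcontractE // -h0.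
apply: btens_ext => [t t'|t t'|x m].
- rewrite block_mapD (bcontractD (Lg _)) opprD.
  by apply: etrans (congr1 (+%R^~ _) (@bcontractD _ _ _ Mi _ (Lf _) t t')) (addrACA _ _ _ _).
- exact: etrans (congr1 _ (bmapD _ _ _)) (bD _ _ _).
rewrite block_mapE !bcontractE //= bmapE bE -hd.
exact: esym (@scalerBl C M _ _ _).
Qed.
End Beta.

(* Both classes are compared on the resolution PA (x)_A M of M over A, which maps
   to P (x)_k M and to PB (x)_B M. *)
Lemma tens_k_tens_B (QB : aseq M) (QA : aseq Mi) (eta : Ext P P) :
  proj_resolution QB -> proj_resolution QA ->
  tens_k P QA eta = 0 <-> tens_B PB QB (HH_proj PA PB (HH_emb P PA eta)) = 0.
Proof.
move=> QBr QAr.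
have [chi Hchi] := chain_lift_exists (@rng_morph_id _) PAr (iseq_exact Pr) (@slin_idfun _ _).
have thp := rng_morph_rmorphism (block_proj B).
have [phi Hphi] := chain_lift_exists (rng_morph_rmorphism (block_proj_env B)) PAr
  (proj_resolution_exact PBr) (slin_block_proj B).
have De : exact_resolution D := bseq_exact Mi PAr.
have BMe := bseq_exact M PBr.
have [q Hq] := chain_lift_exists (@rng_morph_id _) QAr De (@slin_idfun _ _).
have [q' Hq'] := chain_lift_exists (@rng_morph_id _) QBr BMe (@slin_idfun _ _).
have Lid : slin (block_proj B) (fun m : Mi => m : M) by [].
(* [rho] and, below, [sigma] lift the identity of M in both directions, along A -> B and along the
   non-unital inclusion B -> A, so that vanishing can be moved between QA and QB. *)
have [rho Hrho] := chain_lift_exists thp QAr (proj_resolution_exact QBr) Lid.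
have incl_morph : rng_morph (vsval : C -> A) by split=> [x y|x y].
have Lincl : slin (vsval : C -> A) (fun m : M => m : Mi).
  by split=> // r x; rewrite -[RHS]/(block_proj B (vsval r) *: x) block_proj_vsval.
have [sigma Hsigma] := chain_lift_exists incl_morph QBr (proj_resolution_exact QAr) Lincl.
set e := HH_emb P PA eta; set z := HH_proj PA PB e.
have rk := tens_k_rel Pr QAr (chain_lift_comp Hq (untwist_map_lift Hchi)) eta.
have rB := tens_B_rel PBr QBr Hq' z.
have re := HH_emb_rel Pr PAr Hchi eta.
have rz := HH_proj_rel PAr PBr Hphi e.
rewrite (functor_rel_eq0 QAr rk) (functor_rel_eq0 QBr rB).
have Lz := slin_bdc (ext_rep z).
have Cz : cocycle idfun (bdc (@bmap_family _ _ PB M (ext_rep z))).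
  have [Fc _ _ _] := bmap_chain_functor PB M.
  exact: (bdc_cocycle BMe (Fc (ext_rep z))).
pose cB j (t : QA j) : M := bdc (@bmap_family _ _ PB M (ext_rep z)) j (block_map phi (q j t)).
(* Both cocycles are pulled back to QA through D. Up to coboundaries, untwisting identifies eta
   (x)_k M with e (x)_A M, and the block map identifies the latter with z (x)_B M. *)
have E : cohomologous (block_proj B) (fun j (t : QA j) =>
    bdc (@kmap_family _ _ _ P Mi (ext_rep eta)) j (untwist_map chi (q j t)) : M) cB.
  have E1 : cohomologous idfun (fun j (t : D j) =>
      bdc (@kmap_family _ _ _ P Mi (ext_rep eta)) j (untwist_map chi t))
      (fun j (t : D j) => bcontract (bdc (ext_rep e) j) t).
    apply: (cohomologous_trans (c' := fun j (t : D j) =>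
      bcontract (fun x : PA j => bdc (@imap_family _ _ _ P (ext_rep eta)) j (chi j x)) t)).
      apply: cohomologous_eq => j t.
      rewrite [LHS]bdc_kmap_family.
      apply: etrans (untwist_map_contract Hchi _ (slin_bdc _ _)) _.
      by apply: eq_tlift => x m; rewrite bdc_imap_family.
    apply: bcontract_cohomologous (cohomologous_sym re) => j; last exact: slin_bdc.
    have [Fc _ _ _] := imap_chain_functor P.
    have [L _] := bdc_cocycle (iseq_exact Pr) (Fc (ext_rep eta)).
    by have [Lc _ _] := Hchi; apply: (slin_comp (L j) (Lc j)).
  have E2 : cohomologous (block_proj B) (fun j (t : D j) =>
      (bdc (@kmap_family _ _ _ P Mi (ext_rep eta)) j (untwist_map chi t) : Mi) : M)
      (fun j t => (bcontract (bdc (ext_rep e) j) t : Mi) : M).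
    exact: cohomologous_post Lid E1.
  have {E1}E2 := cohomologous_lift Hq (cohomologous_trans E2 (block_map_cohomologous Hphi rz)).
  apply: cohomologous_trans E2 _; apply: cohomologous_eq => j t.
  by rewrite /cB bdc_bmap_family.
have Hbq := chain_lift_comp Hq (block_map_lift Hphi).
split=> E0.
- have {}E0 : cohomologous (block_proj B) cB (fun _ _ => 0).
    exact: cohomologous_trans (cohomologous_sym E) E0.
  have := cohomologous_lift Hsigma E0.
  have -> : block_proj B \o vsval = idfun by apply/funext => x; apply: block_proj_vsval.
  apply: cohomologous_trans.
  have Hs := chain_lift_comp Hsigma Hbq.
  have tE : (block_proj B \o idfun) \o vsval = idfun :> (C -> C).
    by apply/funext => x; apply: block_proj_vsval.
  rewrite tE in Hs.
  exact: (cohomologous_lifts (@rng_morph_id _) QBr BMe Hq' Hs (fun _ => erefl) Cz).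
- have E1 := cohomologous_lift Hrho E0.
  apply: (cohomologous_trans E); apply: cohomologous_trans E1.
  have Hr := chain_lift_comp Hrho Hq'.
  exact: (cohomologous_lifts thp QAr BMe Hbq Hr (fun _ => erefl) Cz).
Qed.
End Compare.

Local Open Scope classical_set_scope.

(** * Maximal spectra *)

Section Ideals.
Variables (k : fieldType) (E : pzRingType) (sc : k -> E).
Implicit Types S I m : set E.

Lemma idealN S I x : S (-1) -> is_ideal S I -> I x -> I (- x).
Proof. by move=> SN [_ _ _ M] Ix; rewrite -mulN1r; case: (M _ _ SN Ix). Qed.

Lemma idealB S I x y : S (-1) -> is_ideal S I -> I x -> I y -> I (x - y).
Proof.
move=> SN Ii Ix Iy; have [_ _ D _] := Ii.
by apply: D => //; apply: (idealN SN Ii Iy).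
Qed.

Lemma subalgX S x n : is_subalg sc S -> S 1 -> S x -> S (x ^+ n).
Proof.
by move=> [_ _ M] S1 Sx; elim: n => [|n IH]; rewrite ?expr0 // exprS; apply: M.
Qed.

Lemma idealX S I x a n : is_subalg sc S -> S 1 -> is_ideal S I -> S x -> I a ->
  I ((x + a) ^+ n - x ^+ n).
Proof.
move=> Sa S1 Ii Sx Ia; have [IS I0 D M] := Ii; have [_ SD _] := Sa.
elim: n => [|n IH]; first by rewrite !expr0 subrr.
have -> : (x + a) ^+ n.+1 - x ^+ n.+1 = (x + a) * ((x + a) ^+ n - x ^+ n) + a * x ^+ n.
  by rewrite !exprS mulrBr [X in _ - X + _]mulrDl opprD -!addrA addNr addr0.
apply: D; last by case: (M _ _ (subalgX n Sa S1 Sx) Ia).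
by case: (M _ _ (SD _ _ Sx (IS _ Ia)) IH).
Qed.

Lemma smallest_ideal S G : is_subalg sc S -> S 0 -> G `<=` S -> is_ideal S (gen_ideal S G).
Proof.
move=> Sa S0 GS; have [_ SD SM] := Sa.
have SS : is_ideal S S by split=> // s x Ss Sx; split; apply: SM.
split.
- by move=> x; apply; split.
- by move=> I [[_ ? _ _] _].
- by move=> x y Ix Iy I C; have [[_ _ D _] _] := C; apply: D; [apply: Ix | apply: Iy].
- move=> s x Ss Ix; split=> I C; have [[_ _ _ M] _] := C;
  by case: (M _ _ Ss (Ix _ C)).
Qed.

Lemma gen_subalg_subalg G : is_subalg sc (gen_subalg sc G).
Proof.
split=> [c I [[H _ _] _]|x y Hx Hy I C|x y Hx Hy I C]; first exact: H.
  by have [[_ D _] _] := C; apply: D; [apply: Hx | apply: Hy].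
by have [[_ _ M] _] := C; apply: M; [apply: Hx | apply: Hy].
Qed.

(** The elements commuting with a given set form a subalgebra. This is applied twice: to G, and then
    to the generated subalgebra. *)
Lemma gen_subalg_comm G : (forall c x, sc c * x = x * sc c) ->
  (forall x y, G x -> G y -> x * y = y * x) ->
  forall x y, gen_subalg sc G x -> gen_subalg sc G y -> x * y = y * x.
Proof.
move=> scC GC.
have sub (T : set E) : is_subalg sc [set x | forall y, T y -> x * y = y * x].
  split=> [c y _|x y Cx Cy z Tz|x y Cx Cy z Tz] /=; first exact: scC.
    by rewrite mulrDl mulrDr Cx ?Cy.
  by rewrite -mulrA Cy // mulrA Cx // mulrA.
have S1 x : gen_subalg sc G x -> forall y, G y -> x * y = y * x.
  by move=> Hx; apply: (Hx [set x | forall y, G y -> x * y = y * x]); split=> // z Gz y;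
    apply: GC.
move=> x y Hx Hy; apply/esym; move: x Hx.
apply: (Hy [set y | forall x, gen_subalg sc G x -> y * x = x * y]); split=> // z Gz x Hx.
exact: esym (S1 x Hx z Gz).
Qed.

Lemma nilpotentD S x y (n m : nat) : (forall x y, S x -> S y -> x * y = y * x) -> S x -> S y ->
  x ^+ n = 0 -> y ^+ m = 0 -> (x + y) ^+ (n + m) = 0.
Proof.
move=> SC Sx Sy xn ym; rewrite exprDn_comm; last exact: SC.
rewrite big1 // => i _; have [le|lt] := leqP m i.
  by rewrite -(subnK le) exprD ym mulr0 mulr0 mul0rn.
have le : (n <= n + m - i)%N by rewrite -addnBA ?leq_addr // ltnW.
by rewrite -(subnK le) exprD xn mulr0 mul0r mul0rn.
Qed.

Lemma nilpotentM S x y n : (forall x y, S x -> S y -> x * y = y * x) -> S x -> S y ->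
  x ^+ n = 0 -> (x * y) ^+ n = 0.
Proof. by move=> SC Sx Sy xn; rewrite exprMn_comm ?xn ?mul0r //; apply: SC. Qed.
End Ideals.

(* Every element of H is the image of an element of R up to the nil ideal N, so
   maximal ideals of H containing N are determined by their inverse images in R. *)
Section SpecIso.
Variables (k : fieldType) (E1 E2 : pzRingType) (sc1 : k -> E1) (sc2 : k -> E2).
Variables (R : set E1) (H : set E2) (Phi : E1 -> E2).
Variables (N annH : set E2) (annA : set E1).
Hypotheses (Ra : is_subalg sc1 R) (R1 : R 1) (RN : R (-1)).
Hypotheses (Ha : is_subalg sc2 H) (H1 : H 1) (HN : H (-1)).
Hypotheses (PhiD : {morph Phi : x y / x + y}) (PhiM : {morph Phi : x y / x * y}).
Hypotheses (Phi1 : Phi 1 = 1) (Phi_sc : forall c, Phi (sc1 c) = sc2 c).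
Hypotheses (Phi_sub : forall x, R x -> H (Phi x)).
Hypotheses (Ni : is_ideal H N) (Nnil : forall x, N x -> exists n, x ^+ n = 0).
Hypothesis (H_gen : forall z, H z -> exists x n, [/\ R x, N n & z = Phi x + n]).
Hypothesis (annHi : is_ideal H annH).
Hypothesis (annE : forall x, annA x <-> R x /\ annH (Phi x)).

Let Phi0 : Phi 0 = 0. Proof. by apply: (addrI (Phi 0)); rewrite -PhiD !addr0. Qed.
Let PhiN x : Phi (- x) = - Phi x.
Proof. by apply: (addrI (Phi x)); rewrite -PhiD !subrr Phi0. Qed.
Let PhiB x y : Phi (x - y) = Phi x - Phi y. Proof. by rewrite PhiD PhiN. Qed.
Let PhiX x n : Phi (x ^+ n) = Phi x ^+ n.
Proof. by elim: n => [|n IH]; rewrite ?expr0 // !exprS PhiM IH. Qed.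
Let R0 : R 0. Proof. by have [_ D _] := Ra; rewrite -(subrr 1); apply: D. Qed.

Let NannH := N `|` annH.

Definition contract_ideal (m : set E2) : set E1 := [set x | R x /\ m (Phi x)].
Definition extend_ideal (n : set E1) : set E2 :=
  [set z | exists x y a, [/\ n x, N y, annH a & z = Phi x + y + a]].

Lemma contract_ideal_ideal m : is_ideal H m -> is_ideal R (contract_ideal m).
Proof.
case=> mH m0 mD mM; have [_ RD RM] := Ra; split=> [x []//|||].
- by split; rewrite ?Phi0.
- by move=> x y [Rx mx] [Ry my]; split; [apply: RD | rewrite PhiD; apply: mD].
- move=> s x Rs [Rx mx]; have [l r] := mM _ _ (Phi_sub Rs) mx.
  by split; (split; [exact: RM | rewrite PhiM]).
Qed.

(** For J above the contraction, K = Phi(J) + m is an ideal because H = Phi(R) + N with N inside m.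
    If 1 = Phi(x) + y were in K, then 1 - x would lie in the contraction, hence in J, and so would
    1. Thus K = m, and J is the contraction. *)
Lemma contract_ideal_maximal m : is_maximal H m -> NannH `<=` m ->
  is_maximal R (contract_ideal m).
Proof.
move=> [mi m1 mmax] Nm; split; first exact: contract_ideal_ideal.
  by case=> _; rewrite Phi1.
move=> J Ji mJ J1; have [mH m0 mD mM] := mi; have [JR J0 JD JM] := Ji.
have [_ HD HM] := Ha.
pose K := [set z | exists x y, [/\ J x, m y & z = Phi x + y]].
have Kmul x y s : J x -> m y -> H s -> K (s * (Phi x + y)) /\ K ((Phi x + y) * s).
  move=> Jx my Hs; have [s0 [n [Rs Nn ->]]] := H_gen Hs.
  have mn : m n by apply: Nm; left.
  have Hn := mH _ mn; have Hx := Phi_sub (JR _ Jx); have Hy := mH _ my.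
  have HsE : H (Phi s0 + n) by apply: HD => //; apply: Phi_sub.
  have [Jl Jr] := JM _ _ Rs Jx; have [ml mr] := mM _ _ HsE my.
  have [nl nr] := mM _ _ Hx mn; split.
    exists (s0 * x), (n * Phi x + (Phi s0 + n) * y); split=> //; first exact: mD.
    by rewrite PhiM mulrDr addrA -mulrDl.
  exists (x * s0), (Phi x * n + y * (Phi s0 + n)); split=> //; first exact: mD.
  by rewrite PhiM addrA -mulrDr -mulrDl.
have Ki : is_ideal H K.
  split.
  - by move=> _ [x [y [Jx my ->]]]; apply: HD; [apply/Phi_sub/JR | apply: mH].
  - by exists 0, 0; rewrite Phi0 addr0.
  - move=> _ _ [x [y [Jx my ->]]] [x' [y' [Jx' my' ->]]].
    by exists (x + x'), (y + y'); split; [apply: JD|apply: mD|rewrite PhiD addrACA].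
  - by move=> s _ Hs [x [y [Jx my ->]]]; apply: Kmul.
have mK : m `<=` K by move=> y my; exists 0, y; rewrite Phi0 add0r.
have KE : K = m.
  apply: mmax => // -[x [y [Jx my E]]]; apply: J1.
  have : contract_ideal m (1 - x).
    have [_ RD RM] := Ra; split; first by apply: RD => //; rewrite -mulN1r; apply/RM/JR.
    by rewrite PhiB Phi1 E addrC addKr.
  by move=> /mJ Jx1; rewrite -(subrK x 1); apply: JD.
apply/seteqP; split=> // x Jx; split; first exact: JR.
by rewrite -KE; exists x, 0; rewrite addr0.
Qed.

Lemma extend_ideal_ideal n : is_ideal R n -> is_ideal H (extend_ideal n).
Proof.
move=> [nR n0 nD nM]; have [_ HD HM] := Ha.
have [NH N0 ND NM] := Ni; have [aH a0 aD aM] := annHi.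
split.
- move=> _ [x [y [a [nx Ny aa ->]]]]; apply: (HD); last exact: aH.
  by apply: HD; [apply/Phi_sub/nR | apply: NH].
- by exists 0, 0, 0; split; rewrite ?Phi0 ?addr0.
- move=> _ _ [x [y [a [nx Ny aa ->]]]] [x' [y' [a' [nx' Ny' aa' ->]]]].
  exists (x + x'), (y + y'), (a + a'); split; [exact: nD|exact: ND|exact: aD|].
  by rewrite PhiD addrACA; congr (_ + _); rewrite addrACA.
- move=> s _ Hs [x [y [a [nx Ny aa ->]]]]; have [s0 [t [Rs Nt sE]]] := H_gen Hs.
  have Hx := Phi_sub (nR _ nx); have [al ar] := aM _ _ Hs aa.
  have [yl yr] := NM _ _ Hs Ny; have [tl tr] := NM _ _ Hx Nt; have [xl xr] := nM _ _ Rs nx.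
  split.
    exists (s0 * x), (t * Phi x + s * y), (s * a); split=> //; first exact: ND.
    by rewrite !mulrDr; congr (_ + _); rewrite PhiM addrA -mulrDl -sE.
  exists (x * s0), (Phi x * t + y * s), (a * s); split=> //; first exact: ND.
  by rewrite !mulrDl; congr (_ + _); rewrite PhiM addrA -mulrDr -sE.
Qed.

(** Suppose 1 = Phi(x) + y + a. As y is nilpotent, a power of y + a = Phi(1 - x) lies in annH, so a
    power of 1 - x lies in annA and thus in n. That power is 1 modulo x, which puts 1 in n. *)
Lemma extend_ideal_proper n : is_ideal R n -> annA `<=` n -> ~ n 1 -> ~ extend_ideal n 1.
Proof.
move=> ni An n1 [x [y [a [nx Ny aa E]]]]; apply: n1.
have [nR n0 nD nM] := ni; have [_ RD _] := Ra.
have [N' yN] := Nnil Ny; have [NH _ _ _] := Ni.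
have := idealX N' Ha H1 annHi (NH _ Ny) aa; rewrite yN subr0.
have -> : y + a = Phi (1 + - x).
  by apply: (addrI (Phi x)); rewrite addrA -E PhiB Phi1 addrC subrK.
rewrite -PhiX => aX.
have RX : R ((1 + - x) ^+ N').
  by apply: subalgX Ra R1 _; apply: RD => //; apply: nR; apply: (idealN RN ni nx).
have nX : n ((1 + - x) ^+ N') by apply: An; apply/annE.
have := idealX N' Ra R1 ni R1 (idealN RN ni nx); rewrite expr1n => nY.
by rewrite -(subKr ((1 + - x) ^+ N') 1); apply: (idealB RN ni nX nY).
Qed.

Lemma contract_extend n : is_maximal R n -> annA `<=` n ->
  contract_ideal (extend_ideal n) = n.
Proof.
move=> [ni n1 nmax] An; apply: nmax.
- exact/contract_ideal_ideal/extend_ideal_ideal.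
- move=> x nx; split; first by have [nR _ _ _] := ni; apply: nR.
  by exists x, 0, 0; split=> //; rewrite ?addr0 //; [case: Ni|case: annHi].
- by case=> _; rewrite Phi1; apply: extend_ideal_proper.
Qed.

Lemma extend_ideal_maximal n : is_maximal R n -> annA `<=` n ->
  is_maximal H (extend_ideal n).
Proof.
move=> nM An; have [ni n1 nmax] := nM; split.
- exact: extend_ideal_ideal.
- exact: extend_ideal_proper.
move=> J Ji nJ J1; apply/seteqP; split=> // z Jz.
have [JH _ JD _] := Ji; have [x [y [Rx Ny zE]]] := H_gen (JH _ Jz).
have n0 : n 0 by case: ni.
have a0 : annH 0 by case: annHi.
have Jy : J y by apply: nJ; exists 0, y, 0; split=> //; rewrite Phi0 add0r addr0.
have JE : contract_ideal J = n.
  apply: nmax; first exact: contract_ideal_ideal.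
    move=> t nt; split; first by have [nR _ _ _] := ni; apply: nR.
    by apply: nJ; exists t, 0, 0; split=> //; rewrite ?addr0 //; case: Ni.
  by case=> _; rewrite Phi1.
exists x, y, 0; split=> //; last by rewrite addr0.
rewrite -JE; split=> //; rewrite -(addrK y (Phi x)) -zE.
exact: (idealB HN Ji).
Qed.

Lemma extend_contract m : is_maximal H m -> NannH `<=` m ->
  extend_ideal (contract_ideal m) = m.
Proof.
move=> [mi m1 mmax] Nm; have [mH m0 mD _] := mi.
apply/seteqP; split=> [_ [x [y [a [[_ mx] Ny aa ->]]]]|z mz].
  by apply: (mD); [apply: mD => //; apply: (Nm); left | apply: Nm; right].
have [x [y [Rx Ny zE]]] := H_gen (mH _ mz).
exists x, y, 0; split=> //; [split=> // | by case: annHi | by rewrite addr0].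
rewrite -(addrK y (Phi x)) -zE; apply: (idealB HN mi) => //.
by apply: Nm; left.
Qed.

Let sub_extend n : is_ideal R n -> NannH `<=` extend_ideal n.
Proof.
move=> [_ n0 _ _]; have [_ N0 _ _] := Ni; have [_ a0 _ _] := annHi.
by move=> z [Nz|az]; [exists 0, z, 0 | exists 0, 0, z]; rewrite Phi0 ?add0r ?addr0.
Qed.
Let sub_contract m : NannH `<=` m -> annA `<=` contract_ideal m.
Proof. by move=> Nm x /annE[Rx ax]; split=> //; apply: Nm; right. Qed.

Lemma spec_iso : var_iso (spec sc2 H NannH) (spec sc1 R annA).
Proof.
pose f (m : spec_point H NannH) : spec_point R annA :=
  exist _ (contract_ideal (sval m))
    (conj (contract_ideal_maximal (svalP m).1 (svalP m).2) (sub_contract (svalP m).2)).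
have gP (n : spec_point R annA) :
    is_maximal H (extend_ideal (sval n)) /\ NannH `<=` extend_ideal (sval n).
  case: n => n [nM An] /=; split; first exact: extend_ideal_maximal.
  by apply: sub_extend; case: nM.
pose g n : spec_point H NannH := exist _ _ (gP n).
have fK : cancel f g.
  by case=> m [mM Nm]; apply: eq_exist; apply: extend_contract.
have gK : cancel g f.
  by case=> n [nM An]; apply: eq_exist; apply: contract_extend.
exists f; first by exists g.
have [RS RD _] := Ra; have [HS HD _] := Ha.
move=> h; split=> /= -[s Ss sE].
  exists (Phi s); first exact: Phi_sub.
  by move=> m; have [_] := sE (f m); rewrite PhiB Phi_sc.
(* The nil part y of s lies in every point of the spectrum, so x defines the same function as s. *)
have [x [y [Rx Ny sxy]]] := H_gen Ss; exists x => // n.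
have [_ mi] : True /\ is_ideal H (extend_ideal (sval n)) by case: (gP n) => -[].
have := sE (g n); rewrite /= gK sxy => E.
have ny : extend_ideal (sval n) y by apply: (gP n).2; left.
have [nM An] := svalP n.
rewrite -(contract_extend nM An); split.
  apply: RD => //; have [_ _ RM] := Ra; rewrite -mulN1r; exact: RM.
rewrite PhiB Phi_sc; have := idealB HN mi E ny.
by rewrite addrAC addrK.
Qed.
End SpecIso.

(** * The center of the block *)

Lemma eigenvector_exists (k : closedFieldType) (V : vectType k) (f : {linear V -> V})
    (x : V) : x != 0 -> exists (a : k) (v : V), v != 0 /\ f v = a *: v.
Proof.
move=> x0; pose e := vbasis {:V}; have eF := basis_free (vbasisP {:V}).
pose F : 'M[k]_(\dim {:V}) := \matrix_(i, j) coord e j (f e`_i).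
have n0 : (0 < \dim {:V})%N.
  rewrite lt0n dimv_eq0; apply: contra_neq x0 => V0.
  by apply/eqP; rewrite -memv0 -V0 memvf.
have : size (char_poly F) != 1%N by rewrite size_char_poly eqSS -lt0n.
case/closed_rootP => a; rewrite -eigenvalue_root_char => /eigenvalueP[v vE v0].
exists a, (\sum_i v 0 i *: e`_i); split.
  apply: contra_neq v0 => E; apply/rowP => i.
  by rewrite -(coord_sum_free (v 0) i eF) E linear0 mxE.
rewrite [LHS](coord_vbasis (memvf _)) scaler_sumr; apply: eq_bigr => j _.
rewrite scalerA; congr (_ *: _); move/rowP/(_ j): vE; rewrite !mxE => <-.
by rewrite !linear_sum; apply: eq_bigr => i _; rewrite !linearZ mxE.
Qed.

Section Center.
Variables (k : closedFieldType) (A : falgType k) (H : hopf A) (B : principal_block H).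
Local Notation C := (subvs_of B).

Definition central (z : C) : Prop := forall x, z * x = x * z.

Lemma block_memr (a b : A) : b \in (B : {vspace A}) -> a * b \in (B : {vspace A}).
Proof.
have /andP[/subvP l _] := block_ideal B => Bb.
by apply: l; rewrite memv_mul ?memvf.
Qed.
Lemma block_meml (a b : A) : b \in (B : {vspace A}) -> b * a \in (B : {vspace A}).
Proof.
have /andP[_ /subvP r] := block_ideal B => Bb.
by apply: r; rewrite memv_mul ?memvf.
Qed.

(** An element a of A acts on the block through its component a e, with which z commutes. *)
Lemma central_vsval (z : C) : central z -> forall a : A, vsval z * a = a * vsval z.
Proof.
move=> zc a; have := congr1 (@vsval _ _ _) (zc (block_proj B a)).
rewrite /= block_projK mulrA => E.
rewrite -[in LHS](algidr (subvsP z)) -mulrA block_algidC mulrA E -mulrA.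
by rewrite (algidl (subvsP z)).
Qed.

Lemma centralX (z : C) n : central z -> central (z ^+ n).
Proof.
move=> zc x; elim: n => [|n IH]; first by rewrite expr0 mul1r mulr1.
by rewrite exprS -mulrA IH mulrA zc mulrA.
Qed.

(* Fitting's lemma for multiplication by [y]: B is the direct sum of the two-sided
   ideals B y^n and ker y^n. *)
Lemma central_zero_divisor_nilpotent (y v : C) :
  central y -> v != 0 -> v * y = 0 -> exists n, y ^+ n = 0.
Proof.
move=> yc v0 vy.
pose f n := amulr (vsval (y ^+ n) : A).
have fE n x : f n x = x * vsval (y ^+ n) by rewrite lfunE.
pose I n := (f n @: B)%VS.
have Yc n := central_vsval (centralX n yc).
have fD m n : f (m + n)%N = (f n \o f m)%VF.
  by apply/lfunP => x; rewrite comp_lfunE !fE exprD /= mulrA.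
have IB n : (I n <= B)%VS.
  by apply/subvP => _ /memv_imgP[b Bb ->]; rewrite fE; apply: block_meml.
have ID m n : (f n @: I m)%VS = I (m + n)%N by rewrite /I fD limg_comp.
have Isub m n : (I (m + n)%N <= I m)%VS.
  by rewrite /I addnC fD limg_comp; apply/limgS/IB.
(* The ideals B y^n decrease, so n > 0 with least dimension works. Positivity ensures below that v
   lies in ker y^n. *)
have [n n0 nE] : exists2 n, (0 < n)%N & \dim (I (n + n)%N) = \dim (I n).
  have ex : exists d, `[< exists2 n, (0 < n)%N & \dim (I n) = d >].
    by exists (\dim (I 1%N)); apply/asboolP; exists 1%N.
  have [d /asboolP[n n0 nE] dmin] := ex_minnP ex.
  exists n => //; apply/eqP; rewrite eqn_leq dimvS ?Isub // nE.
  by apply: dmin; apply/asboolP; exists (n + n)%N; rewrite // addn_gt0 n0.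
pose J := (B :&: lker (f n))%VS.
have IJ : (I n :&: J = 0)%VS.
  apply/eqP; rewrite -subv0.
  have : \dim (I n :&: lker (f n)) = 0%N.
    have := limg_ker_dim (f n) (I n); rewrite ID nE => /eqP.
    by rewrite -{2}[\dim (I n)]add0n eqn_add2r => /eqP.
  move/eqP; rewrite dimv_eq0 => /eqP <-.
  by apply: capvS => //; apply: capvSr.
have IJB : (I n + J = B)%VS.
  apply/eqP; rewrite eqEdim; apply/andP; split.
    by rewrite subv_add IB capvSl.
  by rewrite (dimv_disjoint_sum IJ) addnC limg_ker_dim.
have I2 : two_sided (I n).
  apply/andP; split; apply/prodvP.
    move=> a _ _ /memv_imgP[b Bb ->]; rewrite fE mulrA -fE.
    by apply: memv_img; apply: block_memr.
  move=> _ a /memv_imgP[b Bb ->] _; rewrite fE -mulrA Yc mulrA -fE.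
  by apply: memv_img; apply: block_meml.
have J2 : two_sided J.
  apply/andP; split; apply/prodvP => a b.
    move=> _; rewrite !memv_cap !memv_ker !fE => /andP[Bb /eqP E].
    by rewrite block_memr // -mulrA E mulr0 eqxx.
  rewrite !memv_cap !memv_ker !fE => /andP[Ba /eqP E] _.
  by rewrite block_meml // -mulrA -Yc mulrA E mul0r eqxx.
(* If B y^n = 0 then y^n = 0; the other case is excluded by v, a nonzero element of J. *)
case: (block_indecomposable I2 J2 IJB IJ) => [I0|J0].
  exists n; apply: val_inj => /=.
  have : f n (algid B) \in I n by apply: memv_img; apply: memv_algid.
  by rewrite I0 memv0 fE (algidl (subvsP _)) => /eqP.
have : vsval v \in J.
  rewrite memv_cap subvsP memv_ker fE -(prednK n0) exprS /=.
  by rewrite mulrA -[X in X * _]/(vsval (v * y)) vy mul0r.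
rewrite J0 memv0 => /eqP E; case/eqP: v0; exact: val_inj.
Qed.

(** Multiplication by z has an eigenvector v because k is algebraically closed; z - a then kills v
    and, the block being indecomposable, is nilpotent. *)
Lemma central_decomposition (z : C) : central z ->
  exists (a : k) n, (z - a%:A) ^+ n = 0.
Proof.
move=> zc.
have [a [v [v0 vE]]] := eigenvector_exists [the {linear C -> C} of z \o* idfun] (oner_neq0 C).
exists a; apply: (central_zero_divisor_nilpotent _ v0).
  by move=> x; rewrite mulrBl mulrBr zc mulr_algl mulr_algr.
by rewrite mulrBr mulr_algr -vE /= subrr.
Qed.
End Center.

Section CenterExt.
Variables (k : fieldType) (C : falgType k) (P : aseq (bireg C)).

Lemma epure_central (z : C) : (forall x, z * x = x * z) ->
  forall t : env C, t * epure z 1 = epure z 1 * t.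
Proof.
move=> zc; apply: env_ext => [s t|s t|a b]; rewrite ?mulrDl ?mulrDr //.
by rewrite !epureM mulr1 mul1r zc.
Qed.

Definition cm_center (z : C) (zc : forall x, z * x = x * z) : chain_map P P.
Proof.
refine (@ChainMap _ _ _ P P (fun j i x => epure z 1 *: cm_id P j i x) _ _ _ _).
- move=> j i r x y; rewrite cm_lin /= scalerDr !scalerA.
  by rewrite epure_central.
- by move=> j i x lt; rewrite cm_deg // scaler0.
- by exists 0%N => j i x lt /=; rewrite cid_neq ?scaler0 // neq_ltn -[i]addn0 lt orbT.
- by move=> j i x; rewrite linearZ /= bd_cid.
Defined.

Lemma cm_center_comm z zc (e : Ext P P) :
  ext_cls (@cm_center z zc) * e = e * ext_cls (cm_center zc).
Proof.
elim/ext_ind: e => f; rewrite -[LHS]/(ext_comp _ _) -[RHS]/(ext_comp _ _) !ext_compE.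
have := ext_comp1 (ext_cls f); have := ext_compr1 (ext_cls f); rewrite !ext_compE.
move=> E1 E2; apply: ext_eq => j i x /=.
have E l m y : f l m (epure z 1 *: y) = epure z 1 *: f l m y by apply: linearZ.
have -> : \sum_(l < j.+1) f l i (epure z 1 *: cid l x) = epure z 1 *: f j i x.
  rewrite big_ord_recr /= cid_id E big1 ?add0r // => l _.
  by rewrite cid_neq ?scaler0 ?linear0 // neq_ltn ltn_ord orbT.
rewrite -scaler_sumr; congr (_ *: _).
have [le|lt] := leqP i j.
  rewrite (bigD1 (Ordinal (le : i < j.+1)%N)) //= cid_id big1 ?addr0 // => l ne.
  by rewrite cid_neq //; apply: contraNneq ne => E'; apply/eqP/val_inj.
rewrite cm_deg // big1 // => l _; rewrite cid_neq // neq_ltn.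
by rewrite (leq_ltn_trans _ lt) // -ltnS.
Qed.

Hypothesis Pr : proj_resolution P.
Let Pe := proj_resolution_exact Pr.

Lemma bdc_center z zc j x : bdc (@cm_center z zc) j x = (z * (bdc (cm_id P) j x : C) : C).
Proof. by rewrite /bdc /= linearZ; apply: etrans (bireg_scaleE _ _ _) _; rewrite mulr1. Qed.

(** The cocycle c : P_0 -> C vanishes on the kernel of aug, so it is determined by z = c(x0) with
    aug(x0) = 1. Left and right linearity give c = aug z = z aug, and surjectivity of aug makes z
    central. *)
Lemma ext_homog0_center e : ext_homog P 0 e ->
  exists z zc, e = ext_cls (@cm_center z zc).
Proof.
case=> f <- f0; have [Es E0 _] := Pe; have [x0 x0E] := Es (1 : C).
pose c : P 0%N -> C := bdc f 0%N.
have Lc : slin idfun (c : P 0%N -> bireg C) := slin_bdc f 0%N.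
have [_ Cd] := bdc_cocycle Pe (chain_map_family f).
have cker x : aug P x = 0 -> c x = 0.
  by move=> /E0[y <-]; have [_ _ d] := chain_map_family f; apply: Cd.
pose z := c x0.
have cl x : c x = (aug P x : C) * z.
  apply/eqP; rewrite -subr_eq0; apply/eqP.
  have -> : (aug P x : C) * z = c (epure (aug P x : C) 1 *: x0).
    by rewrite (slinZ _ _ Lc) bireg_scaleE mulr1.
  rewrite -[LHS](slinB _ _ Lc); apply: cker; rewrite linearB linearZ /= x0E.
  by apply/eqP; rewrite subr_eq0 bireg_scaleE !mulr1.
have cr x : c x = z * (aug P x : C).
  apply/eqP; rewrite -subr_eq0; apply/eqP.
  have -> : z * (aug P x : C) = c (epure 1 (aug P x : C) *: x0).
    by rewrite (slinZ _ _ Lc) bireg_scaleE mul1r.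
  rewrite -[LHS](slinB _ _ Lc); apply: cker; rewrite linearB linearZ /= x0E.
  by apply/eqP; rewrite subr_eq0 bireg_scaleE !mul1r.
have zc x : z * x = x * z.
  by have [y <-] := Es x; rewrite -cl -cr.
exists z, zc; apply/(ext_cls_cohomologous _ _ Pr Pe).
apply: cohomologous_eq => -[|j] x; rewrite bdc_center /bdc /=.
  by rewrite cid_id -cr.
by rewrite f0 // cid_neq // !linear0 mulr0.
Qed.

(** The proof of centrality is an argument of [cm_center], so one has to be produced for the power
    as well. *)
Lemma cm_centerX z zc n : exists zc', ext_cls (@cm_center z zc) ^+ n = ext_cls
  (@cm_center (z ^+ n) zc').
Proof.
elim: n => [|n [zc' IH]].
  have zc0 x : z ^+ 0 * x = x * z ^+ 0 by rewrite mul1r mulr1.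
  exists zc0; rewrite expr0; apply: ext_eq => j i x /=.
  by rewrite env1 scale1r.
have zcS x : z ^+ n.+1 * x = x * z ^+ n.+1.
  by rewrite exprS -mulrA zc' mulrA zc mulrA.
exists zcS; rewrite exprS IH -[LHS]/(ext_comp _ _) ext_compE.
apply/(ext_cls_cohomologous _ _ Pr Pe); apply: cohomologous_eq => j x.
rewrite bdc_center; apply: etrans (_ : (z * (bdc (cm_center zc') j x : C) : C) = _).
  rewrite /bdc /= big_ord_recl /= cid_id big1 ?addr0.
    by rewrite linearZ; apply: etrans (bireg_scaleE _ _ _) _; rewrite mulr1.
  by move=> l _; rewrite cid_neq ?scaler0 // scaler0.
by rewrite bdc_center exprS mulrA.
Qed.

Lemma cm_center_sub z zc (a : k) : exists zc',
  ext_cls (@cm_center z zc) - ext_sc P a = ext_cls (@cm_center (z - a%:A) zc').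
Proof.
have zc' x : (z - a%:A) * x = x * (z - a%:A).
  by rewrite mulrBl mulrBr zc mulr_algl mulr_algr.
exists zc'; apply/eqP; rewrite subr_eq; apply/eqP; apply: esym.
rewrite -[ext_sc P a]/(ext_scale a (ext_cls (cm_id P))) ext_scaleE.
rewrite -[LHS]/(ext_add _ _) ext_addE; apply: ext_eq => j i x /=.
rewrite env_scalar -scalerDl -epureDl subrK //.
Qed.

Lemma cm_center0 zc : ext_cls (@cm_center 0 zc) = 0.
Proof.
apply/(ext_cls_cohomologous _ (cm_zero P P) Pr Pe); apply: cohomologous_eq => j x.
by rewrite bdc_center mul0r /bdc /= linear0.
Qed.
End CenterExt.

Section Nilradical.
Variables (k : fieldType) (E : pzRingType) (sc : k -> E) (S : set E).
Hypotheses (Sa : is_subalg sc S) (S1 : S 1) (SN : S (-1)).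
Hypothesis SC : forall x y, S x -> S y -> x * y = y * x.

Definition nilradical : set E := [set x | S x /\ exists n, x ^+ n = 0].

Let S0 : S 0. Proof. by have [_ D _] := Sa; rewrite -(subrr 1); apply: D. Qed.

Lemma nilradical_ideal : is_ideal S nilradical.
Proof.
have [_ SD SM] := Sa; split=> [x []//|||].
- by split=> //; exists 1%N; rewrite expr1.
- move=> x y [Sx [n xn]] [Sy [m ym]]; split; first exact: SD.
  by exists (n + m)%N; apply: (nilpotentD SC).
- move=> s x Ss [Sx [n xn]].
  have Nxs : nilradical (x * s).
    by split; [exact: SM | exists n; apply: (nilpotentM SC)].
  by split=> //; rewrite SC.
Qed.

Hypotheses (scM : forall a b, sc (a * b) = sc a * sc b) (sc1 : sc 1 = 1) (sc0 : sc 0 = 0).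
Hypothesis local : forall x, S x -> exists a n, (x - sc a) ^+ n = 0.

(** Every element is a scalar plus a nilpotent, so an ideal strictly above the nilradical contains a
    nonzero scalar: the nilradical is maximal. Conversely a nilpotent x lies in every maximal ideal
    m, as m + S x cannot contain 1. *)
Lemma jacobson_nilradical : jacobson S = nilradical.
Proof.
have [Ssc SD SM] := Sa; apply/seteqP; split=> x [Sx].
  (* If 1 = 0 there are no maximal ideals, and all elements are nilpotent. *)
  have [E0|E1] := pselect (1 = 0 :> E).
    by move=> _; split=> //; exists 1%N; rewrite expr1 -[x]mulr1 E0 mulr0.
  apply; split; first exact: nilradical_ideal.
    by case=> _ [n]; rewrite expr1n.
  move=> K Ki NK K1; have [KS _ KD KM] := Ki.
  apply/seteqP; split=> // y Ky; have Sy := KS _ Ky.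
  have [b [n yb]] := local Sy.
  have Kyb : K (y - sc b).
    apply: NK; split; last by exists n.
    by apply: SD => //; rewrite -mulN1r; apply: SM.
  have Kb : K (sc b) by rewrite -(subKr y (sc b)); apply: (idealB SN Ki).
  have [b0|b0] := eqVneq b 0.
    by split=> //; exists n; rewrite -yb b0 sc0 subr0.
  case: K1; rewrite -sc1 -(mulVf b0) scM.
  by have [] := KM _ _ (Ssc b^-1) Kb.
move=> [n xn]; split=> // m [mi m1 mmax]; have [mS m0 mD mM] := mi.
pose K := [set y | exists a s, [/\ m a, S s & y = a + s * x]].
have Ki : is_ideal S K.
  split.
  - by move=> _ [a [s [ma Ss ->]]]; apply: SD; [exact: mS | exact: SM].
  - by exists 0, 0; rewrite mul0r addr0.
  - move=> _ _ [a [s [ma Ss ->]]] [b [t [mb St ->]]]; exists (a + b), (s + t).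
    by split; [exact: mD | exact: SD | rewrite addrACA -mulrDl].
  - move=> t _ St [a [s [ma Ss ->]]]; have [al ar] := mM _ _ St ma; split.
      by exists (t * a), (t * s); split=> //; [exact: SM | rewrite mulrDr mulrA].
    exists (a * t), (s * t); split=> //; first exact: SM.
    by rewrite mulrDl -!mulrA (SC Sx St).
have mK : m `<=` K by move=> y my; exists y, 0; rewrite mul0r addr0.
suff KE : K = m by rewrite -KE; exists 0, 1; rewrite mul1r add0r.
apply: mmax => // -[a [s [ma Ss E1]]]; apply: m1.
have Ssx : S (s * x) by exact: SM.
have := idealX n Sa S1 mi Ssx ma; rewrite [s * x + a]addrC -E1 expr1n.
have -> : (s * x) ^+ n = 0 by rewrite SC //; apply: (nilpotentM SC).
by rewrite subr0.
Qed.
End Nilradical.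

Section ExtGrading.
Variables (k : fieldType) (R : algType k) (Y : lmodType R) (P : aseq Y).

Lemma ext_even_sc c : ext_even P (ext_sc P c).
Proof.
exists (cm_scale c (cm_id P)); first by rewrite -ext_scaleE.
move=> j i x o /=; rewrite cid_neq ?scaler0 //.
by apply: contraTneq o => ->; rewrite subnn.
Qed.
Lemma ext_evenD e e' : ext_even P e -> ext_even P e' -> ext_even P (e + e').
Proof.
case=> f <- f0 [g <- g0]; exists (cm_add f g); first by rewrite -ext_addE.
by move=> j i x o /=; rewrite f0 ?g0 ?addr0.
Qed.
Lemma ext_evenM e e' : ext_even P e -> ext_even P e' -> ext_even P (e * e').
Proof.
case=> f <- f0 [g <- g0]; exists (cm_comp f g); first by rewrite -ext_compE.
move=> j i x o /=; apply: big1 => l _; have [le|lt] := leqP i l; last by rewrite cm_deg.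
have lj : (l <= j)%N by rewrite -ltnS.
have : odd (l - i) || odd (j - l).
  have E : (j - i = (j - l) + (l - i))%N by rewrite addnBA // subnK.
  by move: o; rewrite E oddD; case: odd; case: odd.
by case/orP => o'; [rewrite f0 | rewrite g0 ?linear0].
Qed.

Lemma ext_homog0_sc c : ext_homog P 0 (ext_sc P c).
Proof.
exists (cm_scale c (cm_id P)); first by rewrite -ext_scaleE.
by move=> j i x; rewrite addn0 => ne /=; rewrite cid_neq ?scaler0.
Qed.
Lemma ext_homog0D e e' : ext_homog P 0 e -> ext_homog P 0 e' -> ext_homog P 0 (e + e').
Proof.
case=> f <- f0 [g <- g0]; exists (cm_add f g); first by rewrite -ext_addE.
by move=> j i x ne /=; rewrite f0 ?g0 ?addr0.
Qed.
Lemma ext_homog0M e e' : ext_homog P 0 e -> ext_homog P 0 e' -> ext_homog P 0 (e * e').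
Proof.
case=> f <- f0 [g <- g0]; exists (cm_comp f g); first by rewrite -ext_compE.
move=> j i x ne /=; apply: big1 => l _; have [E|ne'] := eqVneq (l : nat) (i + 0)%N.
  by rewrite g0 ?linear0 // addn0; apply: contra_neq ne => ->; rewrite E addn0.
by rewrite f0.
Qed.

Lemma ext_sc1 : ext_sc P 1 = 1. Proof. exact: scale1r. Qed.
Lemma ext_sc0 : ext_sc P 0 = 0. Proof. exact: scale0r. Qed.
Lemma ext_scN1 : ext_sc P (-1) = -1. Proof. exact: scaleN1r. Qed.
Lemma ext_scE c (e : Ext P P) : ext_sc P c * e = c *: e.
Proof.
elim/ext_ind: e => f; rewrite -[RHS]/(ext_scale _ _) ext_scaleE.
rewrite -[ext_sc P c]/(ext_scale c (ext_cls (cm_id P))) ext_scaleE.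
rewrite -[LHS]/(ext_comp _ _) ext_compE.
have := ext_comp1 (ext_cls f); rewrite ext_compE => E.
have := congr1 (ext_scale c) E; rewrite !ext_scaleE => <-.
by apply: ext_eq => j i x /=; rewrite -scaler_sumr.
Qed.
Lemma ext_scC c (e : Ext P P) : ext_sc P c * e = e * ext_sc P c.
Proof.
rewrite ext_scE; elim/ext_ind: e => f; rewrite -[LHS]/(ext_scale _ _) ext_scaleE.
rewrite -[ext_sc P c]/(ext_scale c (ext_cls (cm_id P))) ext_scaleE.
rewrite -[RHS]/(ext_comp _ _) ext_compE.
have := ext_compr1 (ext_cls f); rewrite ext_compE => E.
have := congr1 (ext_scale c) E; rewrite !ext_scaleE => <-.
apply: ext_eq => j i x /=; rewrite scaler_sumr; apply: eq_bigr => l _.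
by rewrite linearZ.
Qed.
Lemma ext_scM c d : ext_sc P (c * d) = ext_sc P c * ext_sc P d.
Proof. by rewrite ext_scE /ext_sc scalerA. Qed.
End ExtGrading.

Lemma Hev_subalg (k : fieldType) (A : falgType k) (H : hopf A) (P : aseq (trivmod H)) :
  is_subalg (ext_sc P) (Hev P).
Proof.
split=> [c|x y [c2|Ex] [c2'|Ey]|x y [c2|Ex] [c2'|Ey]]; try by left.
- by right; apply: ext_even_sc.
- by right; apply: ext_evenD.
- by right; apply: ext_evenM.
Qed.

Lemma ext_homog0_local (k : closedFieldType) (A : falgType k) (H : hopf A)
    (B : principal_block H) (PB : aseq (bireg (subvs_of B))) (e : Ext PB PB) :
  proj_resolution PB -> ext_homog PB 0 e ->
  exists a n, (e - ext_sc PB a) ^+ n = 0.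
Proof.
move=> PBr /(ext_homog0_center PBr)[z [zc ->]].
have [a [n zn]] := central_decomposition zc; exists a, n.
have [zc' ->] := cm_center_sub PB zc a.
have [zc'' ->] := cm_centerX PBr zc' n.
by move: zc''; rewrite zn => zc''; apply: cm_center0.
Qed.

Lemma ext_homog0_comm (k : fieldType) (C : falgType k) (P : aseq (bireg C)) (e e' : Ext P P) :
  proj_resolution P -> ext_homog P 0 e -> e * e' = e' * e.
Proof. by move=> Pr /(ext_homog0_center Pr)[z [zc ->]]; apply: cm_center_comm. Qed.

(** * The subalgebra H and its nil ideal *)

Section HsubTheory.
Variables (k : closedFieldType) (A : falgType k) (H : hopf A).
Variables (P : aseq (trivmod H)) (Pr : proj_resolution P).
Variables (PA : aseq (bireg A)) (PAr : proj_resolution PA).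
Variables (B : principal_block H) (PB : aseq (bireg (subvs_of B))).
Hypothesis PBr : proj_resolution PB.

Definition HH_block_emb (eta : Ext P P) : Ext PB PB := HH_proj PA PB (HH_emb P PA eta).
Local Notation Phi := HH_block_emb.
Local Notation HS := (Hsub P PA PB).

Lemma HH_block_emb_alg_hom : alg_hom Phi.
Proof.
have [eD eM e1 eZ] := HH_emb_alg_hom Pr PAr; have [pD pM p1 pZ] := HH_proj_alg_hom PAr PBr.
split=> [x y|x y||c x]; rewrite /Phi.
- by rewrite eD pD.
- by rewrite eM pM.
- by rewrite e1 p1.
- by rewrite eZ pZ.
Qed.

Lemma HH_block_emb_sc c : Phi (ext_sc P c) = ext_sc PB c.
Proof. by have [_ _ e1 eZ] := HH_block_emb_alg_hom; rewrite /ext_sc eZ e1. Qed.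

Lemma Hsub_subalg : is_subalg (ext_sc PB) HS.
Proof. exact: gen_subalg_subalg. Qed.

Lemma Hsub_homog0 e : ext_homog PB 0 e -> HS e.
Proof. by move=> He I [_ GI]; apply: GI; left. Qed.

Lemma Hsub_emb eta : Hev P eta -> HS (Phi eta).
Proof. by move=> He I [_ GI]; apply: GI; right; exists eta. Qed.

Lemma Hsub1 : HS 1. Proof. by rewrite -(ext_sc1 PB);
  exact: (Hsub_homog0 (ext_homog0_sc _ _)). Qed.
Lemma HsubN1 : HS (-1). Proof. by rewrite -(ext_scN1 PB);
  exact: (Hsub_homog0 (ext_homog0_sc _ _)). Qed.

(** It is enough to check generators: HH^0(B) is central, and classes from H^ev(A, k) commute before
    the embedding. *)
Lemma Hsub_comm x y : HS x -> HS y -> x * y = y * x.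
Proof.
move: x y; apply: gen_subalg_comm; first exact: ext_scC.
have [_ eM _ _] := HH_block_emb_alg_hom.
move=> x y [Hx _|[eta He <-]]; first exact: ext_homog0_comm.
case=> [Hy|[eta' He' <-]]; first by apply/esym/ext_homog0_comm.
by rewrite -![HH_proj _ _ _]/(Phi _) -!eM (Hev_comm Pr He He').
Qed.

Lemma Hsub0E : Hsub0 P PA PB = ext_homog PB 0.
Proof. by apply/seteqP; split=> [x []//|x Hx]; split=> //; apply: Hsub_homog0. Qed.

Lemma jacobson_Hsub0 : jacobson (Hsub0 P PA PB) = nilradical (ext_homog PB 0).
Proof.
rewrite Hsub0E; apply: (jacobson_nilradical (sc := ext_sc PB)).
- by split; [exact: ext_homog0_sc | exact: ext_homog0D | exact: ext_homog0M].
- by rewrite -(ext_sc1 PB); apply: ext_homog0_sc.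
- by rewrite -(ext_scN1 PB); apply: ext_homog0_sc.
- by move=> x y Hx _; apply: ext_homog0_comm.
- exact: ext_scM.
- exact: ext_sc1.
- exact: ext_sc0.
- by move=> x; apply: ext_homog0_local.
Qed.

Lemma N_H_ideal : is_ideal HS (N_H P PA PB).
Proof.
apply: (smallest_ideal Hsub_subalg).
  by rewrite -(ext_sc0 PB); exact: (Hsub_homog0 (ext_homog0_sc _ _)).
by move=> x [[]//|]; rewrite jacobson_Hsub0 => -[/Hsub_homog0].
Qed.

(** The nilradical of the commutative algebra H is an ideal and contains the generators of [N_H];
    the radical of HH^0(B) is nil because HH^0(B) is local with residue field k. *)
Lemma N_H_nilpotent x : N_H P PA PB x -> exists n, x ^+ n = 0.
Proof.
move=> Nx; have [] // := Nx (nilradical HS); split.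
  exact: (nilradical_ideal Hsub_subalg Hsub1 HsubN1 Hsub_comm).
by move=> y [[Hy _ ny]//|]; rewrite jacobson_Hsub0 => -[/Hsub_homog0 Hy ny].
Qed.

(* The degree 0 part is k + rad HH^0(B), and rad HH^0(B) lies in [N_H]. *)
Lemma Hsub_decomposition z : HS z ->
  exists eta x, [/\ Hev P eta, N_H P PA PB x & z = Phi eta + x].
Proof.
have [eD eM e1 eZ] := HH_block_emb_alg_hom.
have [Rsc RD RM] := Hev_subalg P; have [_ N0 ND NM] := N_H_ideal.
move=> Hz; apply: (Hz [set z | exists eta x, [/\ Hev P eta, N_H P PA PB x & z = Phi eta + x]]).
split; first split=> [c|_ _ [a [x [Ra Nx ->]]] [b [y [Rb Ny ->]]]|_ _ [a [x [Ra Nx ->]]]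
  [b [y [Rb Ny ->]]]].
- by exists (ext_sc P c), 0; rewrite HH_block_emb_sc addr0.
- by exists (a + b), (x + y); split; [exact: RD | exact: ND | rewrite eD addrACA].
- have [axl _] := NM _ _ (Hsub_emb Ra) Ny.
  have [_ bxr] := NM _ _ (Hsub_emb Rb) Nx.
  have [NH _ _ _] := N_H_ideal; have [xy _] := NM _ _ (NH _ Nx) Ny.
  exists (a * b), (Phi a * y + (x * Phi b + x * y)).
  split; [exact: RM | by apply: (ND) => //; apply: ND |].
  by rewrite eM mulrDl !mulrDr !addrA.
move=> x [Hx|[eta He <-]]; last by exists eta, 0; rewrite addr0.
have [a [n xn]] := ext_homog0_local PBr Hx.
exists (ext_sc P a), (x - ext_sc PB a); split=> //; last by rewrite HH_block_emb_sc addrC subrK.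
move=> I [_ GI]; apply: GI; right; rewrite jacobson_Hsub0; split; last by exists n.
apply: ext_homog0D => //; rewrite -(mulr1 (ext_sc PB a)).
by rewrite -mulrN -(ext_scN1 PB) -ext_scM; apply: ext_homog0_sc.
Qed.
End HsubTheory.

(** A class kills Ext(M, M) iff it kills the identity, so the annihilator is the kernel of [tens_B]
    on H. *)
Lemma ann_HE (k : fieldType) (A : falgType k) (H : hopf A) (P : aseq (trivmod H))
    (PA : aseq (bireg A)) (B : principal_block H) (PB : aseq (bireg (subvs_of B)))
    (M : lmodType (subvs_of B)) (Q : aseq M) z :
  ann_H P PA PB Q z <-> Hsub P PA PB z /\ tens_B PB Q z = 0.
Proof.
split=> [[Hz E]|[Hz E]]; split=> //; first by rewrite -[LHS]mul1r E.
by move=> e; rewrite E mulr0.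
Qed.

Lemma ann_AE (k : fieldType) (A : falgType k) (H : hopf A) (P : aseq (trivmod H))
    (M : lmodType A) (Q : aseq M) eta :
  ann_A P Q eta <-> Hev P eta /\ tens_k P Q eta = 0.
Proof.
split=> [[Hz E]|[Hz E]]; split=> //; first by rewrite -[LHS]mul1r E.
by move=> e; rewrite E mulr0.
Qed.

Theorem mainTheorem8 (k : closedFieldType) (A : falgType k) (H : hopf A)
    (Pk : aseq (trivmod H)) (hPk : proj_resolution Pk)
    (fg : fg_condition Pk)
    (PA : aseq (bireg A)) (hPA : proj_resolution PA)
    (B0 : principal_block H)
    (PB : aseq (bireg (subvs_of B0))) (hPB : proj_resolution PB)
    (M : lmodType (subvs_of B0)) (hM : fin_dim M)
    (QB : aseq M) (hQB : proj_resolution QB)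
    (QA : aseq (inflate M)) (hQA : proj_resolution QA) :
  var_iso (V_H Pk PA PB QB) (V_A Pk QA).
Proof.
have [eD eM e1 _] := HH_block_emb_alg_hom hPk hPA hPB.
have tB := tens_B_alg_hom hPB hQB; have [tD tM _ _] := tB; have t0 := alg_hom0 tB.
have Ha := Hsub_subalg Pk PA PB; have [_ HD HM] := Ha.
apply: (@spec_iso k _ _ (ext_sc Pk) (ext_sc PB) (Hev Pk) (Hsub Pk PA PB)
  (HH_block_emb PA PB)) => //.
- exact: Hev_subalg.
- by rewrite -(ext_sc1 Pk); have [] := Hev_subalg Pk.
- by rewrite -(ext_scN1 Pk); have [] := Hev_subalg Pk.
- exact: Hsub1.
- exact: HsubN1.
- exact: HH_block_emb_sc.
- exact: Hsub_emb.
- exact: N_H_ideal.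
- exact: N_H_nilpotent.
- exact: Hsub_decomposition.
(* The annihilator is an ideal, being the kernel of an algebra homomorphism restricted to H. *)
- split=> [z /ann_HE[]//||x y /ann_HE[Hx x0] /ann_HE[Hy y0]|s x Hs /ann_HE[Hx x0]].
  + by apply/ann_HE; split=> //; rewrite -(subrr 1); apply: HD; [exact: Hsub1 | exact: HsubN1].
  + by apply/ann_HE; split; [exact: HD | rewrite tD x0 y0 addr0].
  + by split; apply/ann_HE; (split; [exact: HM | rewrite tM x0 ?mulr0 ?mul0r]).
- move=> eta; rewrite ann_AE ann_HE (tens_k_tens_B hPk hPA hPB eta hQB hQA).
  by split=> [[He t]|[He [_ t]]]; split=> //; split=> //; apply: Hsub_emb.
Qed.
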